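(* Let $\{\xi_i\}_{i\in\mathbb N}$, $\xi_i=(u_i,v_i,p_i,q_i)^T$, be the eigenvectors of the operator $A$ and assume that, for each $i\in\mathbb N$, either $v_i(l_0)\neq 0$ or $\int_0^l\psi_j''(x)v_i(x)\,dx\neq 0$ for some $j\in\{1,\dots,k\}$. Then the solution $\xi=0$ of the closed-loop system $\frac{d}{dt}\xi(t)=\tilde A\xi(t)$, $\xi(t)\in X$, is strongly asymptotically stable.
   Context: Parameters: $l>0$, $l_0\in(0,l)$; $E,I,\rho,m,\varkappa$ are positive constants; $k\in\mathbb N$; $\alpha_0,\alpha_1,\dots,\alpha_k>0$ are constants; the shape functions $\psi_j$ ($j=1,\dots,k$) on $[0,l]$ are real-valued with $\operatorname{supp}\psi_j\cap\{0,l_0,l\}=\emptyset$ and $\psi_j''\in C^2[0,l]$. State space: write $\mathring H^2(0,l)=\{u\in H^2(0,l): u(0)=u(l)=0\}$ (complex-valued functions). Let $X=\mathring H^2(0,l)\times L^2(0,l)\times\mathbb C^2$ be the full product space, with elements $(u,v,p,q)^T$ (no relation between $p$ and $u$ is imposed in $X$) and inner product $$\langle(u_1,v_1,p_1,q_1)^T,(u_2,v_2,p_2,q_2)^T\rangle_X=\int_0^l\big(EI\,u_1''\bar u_2''+\rho\, v_1\bar v_2\big)dx+\varkappa p_1\bar p_2+m q_1\bar q_2 .$$ Operators: let $D(\tilde A)=D(A)$ be the set of $\xi=(u,v,p,q)^T\in X$ such that the restrictions of $u$ to $(0,l_0)$ and $(l_0,l)$ belong to $H^4(0,l_0)$ and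 $H^4(l_0,l)$, $u''(0)=u''(l)=0$, $u''(l_0-0)=u''(l_0+0)$, $v\in\mathring H^2(0,l)$, $p=u(l_0)$, $q=v(l_0)$. Put $L=EI\,(u'''(l_0-0)-u'''(l_0+0))$. Define $$A\xi=\Big(v,\;-\tfrac{EI}{\rho}u'''',\;q,\;\tfrac1m(L-\varkappa p)\Big)^T,$$ $$\tilde A\xi=\Big(v,\;-\tfrac{EI}{\rho}u''''+\tfrac1\rho\sum_{j=1}^k\psi_j''(x)M_j,\;q,\;\tfrac1m(L-\varkappa p+F)\Big)^T,$$ where $u''''$ is taken separately on $(0,l_0)$ and $(l_0,l)$, and $M_j=-\alpha_j\int_0^l\psi_j''(x)v(x)\,dx$, $F=-\alpha_0 q$. The operator $\tilde A$ describes a simply supported Euler--Bernoulli beam with an attached spring-mass system at $l_0$ under linear feedback. Solutions of $\dot\xi=\tilde A\xi$ with $\xi(0)\in X$ are understood as trajectories of the $C_0$-semigroup generated by $\tilde A$ on $X$. Strong asymptotic stability of $\xi=0$ means: $\xi=0$ is Lyapunov stable in the norm of $X$, and $\|\xi(t)\|_X\to0$ as $t\to+\infty$ for every solution with $\xi(0)\in X$.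
   Formalization: No C_0-semigroup on all of X has generator Ã, since D(Ã) lies in the proper closed subspace p=u(l_0); the formal theorem takes the given semigroup generated by Ã on any closed subspace Y of X, and proves stability for all ξ(0) in Y. *)

(* Defs.v *)
From mathcomp Require Import all_boot all_order all_algebra.
From mathcomp Require Import all_classical all_reals all_analysis.
From mathcomp Require Import complex.

Set Implicit Arguments.
Unset Strict Implicit.
Unset Printing Implicit Defensive.

Import Order.TTheory GRing.Theory Num.Theory.
Import numFieldNormedType.Exports.

Local Open Scope classical_set_scope.
Local Open Scope ring_scope.
Local Open Scope complex_scope.

(* R[i] carries no topology or measure structure in the libraries, so the
   analytic operations on complex-valued functions of a real variable are
   taken on the real and imaginary parts. *)
Section ComplexFunctions.
Context {R : realType}.
Implicit Types (a b : R) (n : nat) (f g : R -> R[i]).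

Definition reF f : R -> R := fun x => complex.Re (f x).
Definition imF f : R -> R := fun x => complex.Im (f x).

Definition sqmod (z : R[i]) : R := complex.Re z ^+ 2 + complex.Im z ^+ 2.

Definition cint a b f : R[i] :=
  (\int[lebesgue_measure]_(x in `]a, b[) reF f x)
  +i* (\int[lebesgue_measure]_(x in `]a, b[) imF f x).

Definition ccontinuous (D : set R) f :=
  {within D, continuous (reF f)} /\ {within D, continuous (imF f)}.

Definition cderiv n f : R -> R[i] :=
  fun x => derive1n n (reF f) x +i* derive1n n (imF f) x.

Definition ccvg (F : set_system R) f (z : R[i]) :=
  (reF f x @[x --> F] --> complex.Re z) /\ (imF f x @[x --> F] --> complex.Im z).

Definition clim (F : set_system R) f : R[i] :=
  lim (reF f x @[x --> F]) +i* lim (imF f x @[x --> F]).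

Definition L2 a b f :=
  [/\ measurable_fun `]a, b[ (reF f), measurable_fun `]a, b[ (imF f) &
      lebesgue_measure.-integrable `]a, b[ (EFin \o (fun x => sqmod (f x)))].

Definition test_function a b (phi : R -> R) :=
  (forall n x, derivable (derive1n n phi) x 1) /\
  exists c d, [/\ a < c, d < b & forall x, phi x != 0 -> c <= x <= d].

Definition weak_derivative n a b f g :=
  forall phi, test_function a b phi ->
    cint a b (fun x => f x * (derive1n n phi x)%:C)
    = (-1) ^+ n * cint a b (fun x => g x * (phi x)%:C).

Definition Sobolev n a b f :=
  L2 a b f /\
  forall j, (j <= n)%N -> exists2 g, L2 a b g & weak_derivative j a b f g.

(* A representative of the weak derivative (unique up to a null set). *)
Definition wderiv n a b f : R -> R[i] :=
  xget (fun=> 0) [set g | L2 a b g /\ weak_derivative n a b f g].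

(* g is C^n on the open interval and its derivatives up to order n extend
   continuously to the closed one: the values of g outside ]a, b[ are not
   used. *)
Definition Cn_closed n a b (g : R -> R) :=
  [/\ forall j x, (j < n)%N -> x \in `]a, b[ -> derivable (derive1n j g) x 1,
      forall j x, (j <= n)%N -> x \in `]a, b[ ->
        {for x, continuous (derive1n j g)} &
      forall j, (j <= n)%N ->
        cvg (derive1n j g x @[x --> a^'+]) /\ cvg (derive1n j g x @[x --> b^'-])].

End ComplexFunctions.

(* [spot] is the attachment point l_0 of the spring-mass system. *)
Record beam (R : realType) := Beam {
  len : R;
  spot : R;
  young : R;
  inertia : R;
  rho : R;
  mass : R;
  kappa : R;
  len_gt0 : 0 < len;
  spot_in : 0 < spot < len;
  young_gt0 : 0 < young;
  inertia_gt0 : 0 < inertia;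
  rho_gt0 : 0 < rho;
  mass_gt0 : 0 < mass;
  kappa_gt0 : 0 < kappa }.

Definition EI (R : realType) (b : beam R) : R := young b * inertia b.

(* Elements of X are handled through representatives (u, v, p, q): u is the
   continuous representative on [0, l] and v is any square-integrable
   representative.  Two states are identified when the norm of their
   difference is 0. *)
Definition state (R : realType) : Type :=
  ((R -> R[i]) * (R -> R[i]) * R[i] * R[i])%type.

Section Beam.
Context {R : realType}.
Variable b : beam R.
Implicit Types (xi eta zeta : state R).

Local Notation l := (len b).
Local Notation l0 := (spot b).

Definition st_u xi : R -> R[i] := xi.1.1.1.
Definition st_v xi : R -> R[i] := xi.1.1.2.
Definition st_p xi : R[i] := xi.1.2.
Definition st_q xi : R[i] := xi.2.

Definition H2o (u : R -> R[i]) :=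
  [/\ Sobolev 2 0 l u, ccontinuous `[0, l] u, u 0 = 0 & u l = 0].

Definition X : set (state R) :=
  [set xi | H2o (st_u xi) /\ L2 0 l (st_v xi)].

Definition innerX xi eta : R[i] :=
  cint 0 l (fun x =>
    (EI b)%:C * wderiv 2 0 l (st_u xi) x * (wderiv 2 0 l (st_u eta) x)^*
    + (rho b)%:C * st_v xi x * (st_v eta x)^*)
  + (kappa b)%:C * st_p xi * (st_p eta)^* + (mass b)%:C * st_q xi * (st_q eta)^*.

Definition normX xi : R := Num.sqrt (complex.Re (innerX xi xi)).

Definition eqX xi eta : Prop := normX (xi - eta) = 0.

(* On each piece u is of class C^3, being continuous and in H^4, so one-sided
   values of u'' and u''' are limits of classical derivatives.  For elements
   of the domain, v is its continuous representative. *)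
Definition domA : set (state R) :=
  [set xi | let u := st_u xi in let v := st_v xi in
    [/\ X xi, Sobolev 4 0 l0 u /\ Sobolev 4 l0 l u,
        ccvg 0^'+ (cderiv 2 u) 0 /\ ccvg l^'- (cderiv 2 u) 0,
        clim l0^'- (cderiv 2 u) = clim l0^'+ (cderiv 2 u) &
        [/\ H2o v, st_p xi = u l0 & st_q xi = v l0]]].

Definition shear_jump (u : R -> R[i]) : R[i] :=
  (EI b)%:C * (clim l0^'- (cderiv 3 u) - clim l0^'+ (cderiv 3 u)).

Definition fourth (u : R -> R[i]) : R -> R[i] :=
  fun x => if x < l0 then wderiv 4 0 l0 u x else wderiv 4 l0 l u x.

Definition opA xi : state R :=
  (st_v xi,
   fun x => - (EI b / rho b)%:C * fourth (st_u xi) x,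
   st_q xi,
   ((mass b)^-1)%:C * (shear_jump (st_u xi) - (kappa b)%:C * st_p xi)).

Definition eigenvector (D : set (state R)) (G : state R -> state R) xi :=
  [/\ D xi, ~ eqX xi 0 & exists lambda : R[i], eqX (G xi) (lambda *: xi)].

Definition shape_function (psi : R -> R) :=
  [/\ forall x, x \in `]0, l[ ->
        derivable psi x 1 /\ derivable (derive1n 1 psi) x 1,
      Cn_closed 2 0 l (derive1n 2 psi) &
      forall x, x \in [:: 0; l0; l] ->
        ~ closure [set y | y \in `[0, l] /\ psi y != 0] x].

Definition moment (psi : R -> R) (v : R -> R[i]) : R[i] :=
  cint 0 l (fun x => (derive1n 2 psi x)%:C * v x).

Definition opAt (k : nat) (alpha0 : R) (alpha : 'I_k -> R)
    (psi : 'I_k -> R -> R) xi : state R :=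
  let M j := - (alpha j)%:C * moment (psi j) (st_v xi) in
  let F := - alpha0%:C * st_q xi in
  (st_v xi,
   fun x => - (EI b / rho b)%:C * fourth (st_u xi) x
     + ((rho b)^-1)%:C * \sum_(j < k) (derive1n 2 (psi j) x)%:C * M j,
   st_q xi,
   ((mass b)^-1)%:C * (shear_jump (st_u xi) - (kappa b)%:C * st_p xi + F)).

(* The relation p = u(l_0) required in domA is closed in the norm of X, so domA
   is not dense in X and no strongly continuous semigroup on all of X can have
   a generator with this domain.  A semigroup is therefore considered on a
   closed subspace Y of X; Y = X is the literal case, and a generator with
   domain domA forces Y to be the closure of domA. *)
Definition closed_subspace (Y : set (state R)) :=
  [/\ Y `<=` X, Y 0,
      forall (c : R[i]) xi eta, Y xi -> Y eta -> Y (c *: xi + eta) &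
      forall (s : nat -> state R) xi, (forall n, Y (s n)) -> X xi ->
        normX (s n - xi) @[n --> \oo] --> (0 : R) -> Y xi].

Definition C0_semigroup (Y : set (state R)) (T : R -> state R -> state R) :=
  [/\ forall t xi, 0 <= t -> Y xi -> Y (T t xi),
      forall t, 0 <= t ->
        (forall (c : R[i]) xi eta, Y xi -> Y eta ->
           eqX (T t (c *: xi + eta)) (c *: T t xi + T t eta)) /\
        (exists K : R, forall xi, Y xi -> normX (T t xi) <= K * normX xi),
      forall xi, Y xi -> eqX (T 0 xi) xi,
      forall s t xi, 0 <= s -> 0 <= t -> Y xi ->
        eqX (T (s + t) xi) (T s (T t xi)) &
      forall xi, Y xi -> normX (T t xi - xi) @[t --> 0^'+] --> (0 : R)].

(* The graph of the infinitesimal generator of T is the graph of the operator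
   G with domain D, both taken modulo equality in X. *)
Definition generated_by (Y : set (state R)) (T : R -> state R -> state R)
    (D : set (state R)) (G : state R -> state R) :=
  forall xi eta, X xi -> X eta ->
    (Y xi /\
     normX ((h^-1)%:C *: (T h xi - xi) - eta) @[h --> 0^'+] --> (0 : R))
    <-> exists zeta, [/\ D zeta, eqX xi zeta & eqX eta (G zeta)].

Definition lyapunov_stable (Y : set (state R)) (T : R -> state R -> state R) :=
  forall eps : R, 0 < eps -> exists2 delta : R, 0 < delta &
    forall xi t, Y xi -> normX xi < delta -> 0 <= t -> normX (T t xi) < eps.

Definition strongly_asymptotically_stable (Y : set (state R))
    (T : R -> state R -> state R) :=
  lyapunov_stable Y T /\
  forall xi, Y xi -> normX (T t xi) @[t --> +oo] --> (0 : R).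

End Beam.

(* Main.v *)
Require Import Defs.
From HB Require Import structures.
From mathcomp Require Import all_boot all_order all_algebra.
From mathcomp Require Import all_classical all_reals all_analysis.
From mathcomp Require Import complex measurable_realfun.
From mathcomp Require Import ring lra.

Set Implicit Arguments.
Unset Strict Implicit.
Unset Printing Implicit Defensive.

Import Order.TTheory GRing.Theory Num.Theory.
Import numFieldNormedType.Exports.

Local Open Scope classical_set_scope.
Local Open Scope ring_scope.

(** Half the squared norm of X is the mechanical energy. Integrating by parts
    twice on each span shows that along a solution it changes at the rate
      - alpha0 * |q|^2 - sum_j alpha_j * |moment_j|^2,
    everything conservative cancelling out (dissipation). The semigroup is
    therefore contractive, which gives Lyapunov stability. Decay is an instance of
    the invariance principle of LaSalle, for which two facts about the generator
    are needed.

    Compactness (graph_compact): a bound on the graph norm of (u, v, p, q) bounds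
    u'' and u'''' on each span and v and v'' in mean square. Testing against one
    fixed bump turns this into Lipschitz bounds for u'' and v, so a sequence with
    bounded graph norm is Cauchy along any ultrafilter.

    Unique continuation (eig_null): if the generator has an eigenvalue i mu, the
    energy of the eigenvector is conserved, so q and all the moments vanish on it.
    The feedback is then inactive and the vector is an eigenvector of the operator
    without feedback, which the observability assumption excludes.

    The link between the two is strong_stability, proved for an abstract
    contraction semigroup. Orbits starting in the domain are precompact, so they
    accumulate on the space N of vectors with isometric orbits (omega_limit). On N
    the generator G is skew. If N were not trivial, compactness would provide a
    vector u of N and of the domain that minimises |G u|^2 / |u|^2; comparing it
    with its neighbours shows that its orbit rotates in the plane of u and G u,
    and therefore G (G u) = - m^2 u (isom_gen_trivial). For m = 0 this is a kernel
    vector; otherwise G u + i m u and G u - i m u are eigenvectors for imaginary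
    eigenvalues. Both have just been excluded. So every orbit starting in the
    domain tends to 0, and by density and contractivity so does every orbit.

    A state is a tuple of functions, identified with another one when their
    difference has norm 0. The abstract part therefore works with a real
    semi-inner product that is complete, with operators that are linear up to null
    vectors and with one-sided difference quotients. Uniform boundedness of the
    semigroup near 0 comes from the Banach-Steinhaus theorem, density of the domain
    from weak integrals of the orbits. Sobolev functions are handled through chains
    of primitives (sob_chain): by the lemma of du Bois-Reymond a continuous
    function with n + 1 square-integrable weak derivatives is an iterated primitive
    of the last one, and integration by parts holds for such primitives. *)

(** * One-sided calculus on the half-line *)

Section OneSided.
Context {R : realType}.
Implicit Types (f g phi : R -> R) (a b c d e t : R).

Definition contP f := forall t, 0 <= t -> forall e, 0 < e ->
  exists2 d, 0 < d & forall s, 0 <= s -> `|s - t| <= d -> `|f s - f t| <= e.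

(** One-sided, because an orbit of a semigroup only comes with a right difference
    quotient. *)
Definition rderiv f t c := forall e, 0 < e ->
  exists2 d, 0 < d & forall h, 0 < h -> h <= d ->
    `|f (t + h) - f t - h * c| <= h * e.

(** If the mean slope exceeded c by ep, the last point up to which f stays below
    the line of slope c + ep would be interior, and the bound on the right
    derivative pushes it further. *)
Lemma rderiv_mv f (c : R) a b (df : R -> R) : 0 <= a -> a <= b -> contP f ->
  (forall t, a <= t -> t < b -> rderiv f t (df t)) ->
  (forall t, a <= t -> t < b -> df t <= c) ->
  f b - f a <= c * (b - a).
Proof.
move=> a0 ab fc fd dc; rewrite leNgt; apply/negP => H.
have ltab : a < b.
  rewrite lt_neqAle ab andbT; apply/eqP => eab; move: H.
  by rewrite eab !subrr mulr0 ltxx.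
pose ep := (f b - f a - c * (b - a)) / (2 * (b - a)).
have ba0 : 0 < b - a by rewrite subr_gt0.
have ep0 : 0 < ep by rewrite divr_gt0 ?subr_gt0// mulr_gt0.
have epE : ep * (b - a) = (f b - f a - c * (b - a)) / 2.
  by rewrite /ep; field; rewrite subr_eq0 gt_eqF.
have Hb : (c + ep) * (b - a) < f b - f a.
  by rewrite mulrDl epE; move: H; set u := f b - f a; set v := c * _; lra.
pose E := [set t | a <= t <= b /\ f t - f a <= (c + ep) * (t - a)].
have Ea : E a by split; rewrite ?lexx ?ab// !subrr mulr0.
have hE : has_sup E.
  split; first by exists a.
  by exists b => x [/andP[_ ->]].
pose s := sup E.
have as_ : a <= s by apply: ub_le_sup => //; exact: hE.2.
have sb : s <= b by apply: ge_sup; [exists a|move=> x [/andP[_ ->]]].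
have s0 : 0 <= s by exact: le_trans as_.
have Es : f s - f a <= (c + ep) * (s - a).
  rewrite leNgt; apply/negP => Hs.
  pose g := f s - f a - (c + ep) * (s - a).
  have g0 : 0 < g by rewrite subr_gt0.
  have [d d0 Hd] := fc s s0 (g / 2) (divr_gt0 g0 (ltr0Sn _ 1)).
  pose K := `|c + ep| + 1.
  have K0 : 0 < K by rewrite ltr_wpDl.
  pose d' := Num.min d (g / (4 * K)).
  have d'0 : 0 < d' by rewrite lt_min d0 divr_gt0// mulr_gt0.
  have [t [tab Et] st] := sup_adherent d'0 hE.
  have ts : t <= s by apply: ub_le_sup => //; exact: hE.2.
  have t0 : 0 <= t by case/andP: tab => at_ _; exact: le_trans at_.
  have dts : s - t <= d' by rewrite -/s in st; lra.
  have := Hd t t0; rewrite distrC ger0_norm ?subr_ge0//.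
  move=> /(_ (le_trans dts _)); rewrite ge_min lexx => /(_ isT).
  rewrite ler_norml => /andP[h1 h2].
  have h3 : s - t <= g / (4 * K) by apply: le_trans dts _; rewrite ge_min lexx orbT.
  have h4 : K * (s - t) <= g / 4.
    apply: (@le_trans _ _ (K * (g / (4 * K)))); first by rewrite ler_pM2l.
    rewrite le_eqVlt; apply/orP; left; apply/eqP; field.
    exact: lt0r_neq0.
  have h5 : - ((c + ep) * (s - t)) <= K * (s - t).
    rewrite -mulNr ler_wpM2r ?subr_ge0//.
    by rewrite (le_trans (ler_norm _))// normrN /K lerDl.
  rewrite /g in h1 h2 h4 g0; move: h1 h2 h4 h5 Et g0.
  move: (c + ep) => q; move: (f s) (f t) (f a) => A B C.
  have -> : q * (s - a) = q * (s - t) + q * (t - a) by ring.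
  move: (q * (s - t)) (q * (t - a)) (K * _) => u v w.
  lra.
have ltsb : s < b.
  rewrite lt_neqAle sb andbT; apply/eqP => esb.
  by move: Es; rewrite esb leNgt Hb.
have [d d0 Hd] := fd s as_ ltsb ep ep0.
pose h := Num.min d (b - s).
have h0 : 0 < h by rewrite lt_min d0 subr_gt0.
have hd : h <= d by rewrite ge_min lexx.
have hb : h <= b - s by rewrite ge_min lexx orbT.
have := Hd h h0 hd; rewrite ler_norml => /andP[_ h2].
have : s + h <= s.
  apply: ub_le_sup; first exact: hE.2.
  split; first by apply/andP; split; lra.
  have h3 : h * df s <= h * c by rewrite ler_pM2l// dc.
  move: Es h2 h3; move: (f (s + h)) (f s) (f a) => A B C.
  have -> : (c + ep) * (s + h - a) = (c + ep) * (s - a) + h * c + h * ep by ring.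
  by move: ((c + ep) * _) (h * c) (h * ep) (h * df s) => u v w z; lra.
by rewrite gerDl leNgt h0.
Qed.

Lemma contPD f g : contP f -> contP g -> contP (fun t => f t + g t).
Proof.
move=> cf cg t t0 e e0.
have e2 : 0 < e / 2 by rewrite divr_gt0.
have [d1 d10 H1] := cf t t0 _ e2; have [d2 d20 H2] := cg t t0 _ e2.
exists (Num.min d1 d2); first by rewrite lt_min d10.
move=> s s0; rewrite le_min => /andP[/(H1 s s0) h1 /(H2 s s0) h2].
rewrite (_ : _ - _ = (f s - f t) + (g s - g t)); last by ring.
by rewrite (le_trans (ler_normD _ _))//; lra.
Qed.

Lemma contPM f g : contP f -> contP g -> contP (fun t => f t * g t).
Proof.
move=> cf cg t t0 e e0.
pose K := `|f t| + `|g t| + 1.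
have K0 : 0 < K by rewrite ltr_wpDl// addr_ge0.
pose e' := Num.min 1 (e / (2 * K)).
have e'0 : 0 < e' by rewrite lt_min ltr01 divr_gt0// mulr_gt0.
have [d1 d10 H1] := cf t t0 _ e'0; have [d2 d20 H2] := cg t t0 _ e'0.
exists (Num.min d1 d2); first by rewrite lt_min d10.
move=> s s0; rewrite le_min => /andP[/(H1 s s0) h1 /(H2 s s0) h2].
have -> : f s * g s - f t * g t =
  (f s - f t) * (g s - g t) + ((f s - f t) * g t + f t * (g s - g t)) by ring.
apply: (@le_trans _ _ (e' * 1 + (e' * `|g t| + `|f t| * e'))).
  rewrite (le_trans (ler_normD _ _))// lerD//.
    rewrite normrM ler_pM//; apply: le_trans h2 _.
    by rewrite ge_min lexx.
  by rewrite (le_trans (ler_normD _ _))// !normrM lerD// ?ler_wpM2l ?ler_wpM2r.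
have -> : e' * 1 + (e' * `|g t| + `|f t| * e') = e' * K by rewrite /K; ring.
apply: (@le_trans _ _ ((e / (2 * K)) * K)).
  by rewrite ler_pM2r// /e' ge_min lexx orbT.
rewrite (_ : e / (2 * K) * K = e / 2); last by field; exact: lt0r_neq0.
lra.
Qed.

Lemma contP_cst c : contP (fun=> c).
Proof. by move=> t t0 e e0; exists 1 => // s _ _; rewrite subrr normr0 ltW. Qed.

Lemma continuous_contP f : (forall t, 0 <= t -> {for t, continuous f}) -> contP f.
Proof.
move=> cf t t0 e e0.
have /cvgrPdist_le/(_ e e0)/nbhs_ballP[d /= d0 H] := cf t t0.
exists (d / 2); first by rewrite divr_gt0.
move=> s _ h; rewrite distrC; apply: H; rewrite /ball /= distrC.
by rewrite (le_lt_trans h)// ltr_pdivrMr// ltr_pMr// ltr1n.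
Qed.

Lemma rderivD f g t c d : rderiv f t c -> rderiv g t d ->
  rderiv (fun s => f s + g s) t (c + d).
Proof.
move=> cf cg e e0.
have e2 : 0 < e / 2 by rewrite divr_gt0.
have [d1 d10 H1] := cf _ e2; have [d2 d20 H2] := cg _ e2.
exists (Num.min d1 d2); first by rewrite lt_min d10.
move=> h h0; rewrite le_min => /andP[/(H1 h h0) h1 /(H2 h h0) h2].
rewrite (_ : _ - _ - _ = (f (t + h) - f t - h * c) + (g (t + h) - g t - h * d)); last by ring.
rewrite (le_trans (ler_normD _ _))// (_ : h * e = h * (e/2) + h * (e/2)); last by field.
exact: lerD.
Qed.

Lemma rderivZ f t c k : rderiv f t c -> rderiv (fun s => k * f s) t (k * c).
Proof.
move=> cf e e0.
have K0 : 0 < `|k| + 1 by rewrite ltr_wpDl.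
have e2 : 0 < e / (`|k| + 1) by rewrite divr_gt0.
have [d1 d10 H1] := cf _ e2.
exists d1 => // h h0 /(H1 h h0) h1.
rewrite (_ : _ - _ - _ = k * (f (t + h) - f t - h * c)); last by ring.
rewrite normrM; apply: (@le_trans _ _ ((`|k| + 1) * (h * (e / (`|k| + 1))))).
  by rewrite ler_pM// lerDl.
by rewrite le_eqVlt; apply/orP; left; apply/eqP; field; exact: lt0r_neq0.
Qed.

Lemma rderiv_is_derive f t c : is_derive t (1 : R) f c -> rderiv f t c.
Proof.
move=> [df fc] e e0; move: df; rewrite /derivable => /cvgrPdist_le /(_ e e0).
rewrite -[lim _]/('D_1 f t) fc => /nbhs_ballP[d /= d0 H].
exists (d / 2); first by rewrite divr_gt0.
move=> h h0 hd.
have := H h; rewrite /ball/= sub0r normrN gtr0_norm// => /(_ _ _).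
have hd' : h < d by rewrite (le_lt_trans hd)// ltr_pdivrMr// ltr_pMr// ltr1n.
move=> /(_ hd' (lt0r_neq0 h0)); rewrite /GRing.scale/= mulr1 (addrC h t) => le.
rewrite (_ : _ - _ - _ = - (h * (c - h^-1 * (f (t + h) - f t)))); last first.
  by field; exact: lt0r_neq0.
by rewrite normrN normrM gtr0_norm// ler_pM2l.
Qed.

Lemma rderivM f g t c d : rderiv f t c -> rderiv g t d ->
  rderiv (fun s => f s * g s) t (f t * d + c * g t).
Proof.
move=> cf cg e e0.
pose K := `|f t| + `|g t| + `|c| + `|d| + 2.
have K0 : 1 < K by rewrite /K; move: (normr_ge0 (f t)) (normr_ge0 (g t)) (normr_ge0 c) (normr_ge0 d); lra.
have K00 : 0 < K by lra.
pose e' := Num.min 1 (e / (4 * K)).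
have e'0 : 0 < e' by rewrite lt_min ltr01 divr_gt0// mulr_gt0.
have e'1 : e' <= 1 by rewrite ge_min lexx.
have e'2 : e' * K <= e / 4.
  apply: (@le_trans _ _ ((e / (4 * K)) * K)).
    by rewrite ler_pM2r// /e' ge_min lexx orbT.
  by rewrite (_ : e / (4 * K) * K = e / 4) //; field; exact: lt0r_neq0.
have [d1 d10 H1] := cf _ e'0; have [d2 d20 H2] := cg _ e'0.
pose d3 := e / (4 * (K * K)).
have d30 : 0 < d3 by rewrite divr_gt0// !mulr_gt0.
exists (Num.min d3 (Num.min d1 d2)); first by rewrite !lt_min d10 d20 d30.
move=> h h0; rewrite !le_min => /andP[hd3 /andP[/(H1 h h0) h1 /(H2 h h0) h2]].
set F := f (t + h) - f t in h1 *; set G := g (t + h) - g t in h2 *.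
have hF : `|F| <= h * K.
  rewrite (_ : F = (F - h * c) + h * c); last by ring.
  rewrite (le_trans (ler_normD _ _))// normrM (gtr0_norm h0).
  have : h * e' <= h * 1 by rewrite ler_pM2l.
  have : h * (1 + `|c|) <= h * K by rewrite ler_pM2l// /K; move: (normr_ge0 (f t)) (normr_ge0 (g t)) (normr_ge0 d); lra.
  move: h1; rewrite (mulrDr h 1); move: (`|F - _|) (h * `|c|) (h * K) (h * e') (h * 1) => *; lra.
have hG : `|G| <= h * K.
  rewrite (_ : G = (G - h * d) + h * d); last by ring.
  rewrite (le_trans (ler_normD _ _))// normrM (gtr0_norm h0).
  have : h * e' <= h * 1 by rewrite ler_pM2l.
  have : h * (1 + `|d|) <= h * K by rewrite ler_pM2l// /K; move: (normr_ge0 (f t)) (normr_ge0 (g t)) (normr_ge0 c); lra.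
  move: h2; rewrite (mulrDr h 1); move: (`|G - _|) (h * `|d|) (h * K) (h * e') (h * 1) => *; lra.
rewrite (_ : _ - _ - _ = (F - h * c) * g t + f t * (G - h * d) + F * G); last by rewrite /F /G; ring.
apply: (@le_trans _ _ (h * e' * `|g t| + `|f t| * (h * e') + (h * K) * (h * K))).
  rewrite (le_trans (ler_normD _ _))// lerD//.
    by rewrite (le_trans (ler_normD _ _))// !normrM lerD// ?ler_wpM2r ?ler_wpM2l.
  by rewrite normrM ler_pM.
have : h * K * (h * K) <= h * (e / 4).
  rewrite -mulrA ler_pM2l//.
  apply: (@le_trans _ _ (d3 * (K * K))); last first.
    rewrite /d3 (_ : e / (4 * (K * K)) * (K * K) = e / 4)//; field; exact: lt0r_neq0.
  by rewrite mulrCA ler_wpM2r// mulr_ge0// ltW.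
have : h * e' * `|g t| + `|f t| * (h * e') <= h * (e / 4).
  rewrite (_ : _ + _ = h * (e' * (`|f t| + `|g t|))); last by ring.
  rewrite ler_pM2l// (le_trans _ e'2)// ler_pM2l// /K.
  by move: (normr_ge0 c) (normr_ge0 d); lra.
have : h * (e / 4) + h * (e / 4) <= h * e by rewrite -mulrDr ler_pM2l//; lra.
by move: (h * e' * _ + _) (h * K * _) (h * (e / 4)) (h * e) => *; lra.
Qed.

(** The absolute value extends phi continuously to the line, where the
    fundamental theorem of calculus applies. *)
Lemma contP_primitive phi : contP phi -> exists Phi,
  [/\ Phi 0 = 0, contP Phi & forall t, 0 <= t -> rderiv Phi t (phi t)].
Proof.
move=> cphi; pose psi (x : R) : R := phi `|x|.
have cpsi : continuous psi.
  move=> x; apply/cvgrPdist_le => e e0.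
  have [d d0 H] := cphi `|x| (normr_ge0 _) e e0.
  apply/nbhs_ballP; exists d => //= y; rewrite /ball /= => xy.
  rewrite distrC; apply: H => //; apply: le_trans (ltW xy).
  by rewrite [leRHS]distrC; exact: ler_dist_dist.
have ipsi u : lebesgue_measure.-integrable `[-1, u] (EFin \o psi).
  apply: continuous_compact_integrable; first exact: segment_compact.
  by apply: continuous_subspaceT; exact: cpsi.
pose F x := (\int[lebesgue_measure]_(t in `[-1, x]) psi t)%R.
have dF t : 0 <= t -> is_derive t (1 : R) F (psi t).
  move=> t0.
  have [||dF F'] := @continuous_FTC1_closed R psi (-1) t (t + 1) _ (ipsi _) _ (cpsi t).
  - by rewrite ltrDl.
  - by rewrite (lt_le_trans _ t0)// ltrN10.
  by split => //; rewrite -derive1E F'.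
exists (fun x => F x - F 0); split; first by rewrite subrr.
- apply: (@contPD _ (fun=> - F 0)); last exact: contP_cst.
  apply: continuous_contP => t t0; apply: differentiable_continuous.
  by apply/derivable1_diffP; have [] := dF t t0.
- move=> t t0 e e0.
  have := rderiv_is_derive (dF t t0); rewrite /psi ger0_norm// => /(_ e e0)[d d0 H].
  exists d => // h h0 hd; rewrite (_ : _ - _ - _ = F (t + h) - F t - h * phi t); last by ring.
  exact: H.
Qed.

End OneSided.

(** * Complete semi-inner product spaces *)

(** Positive semidefinite only: states are representatives of functions, so
    nonzero vectors may have norm 0. *)
Definition semi_inner (R : realType) (W : lmodType R) (ip : W -> W -> R) :=
  [/\ forall x y, ip x y = ip y x,
      forall r x y z, ip (r *: x + y) z = r * ip x z + ip y z &
      forall x, 0 <= ip x x].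

Section SemiHilbert.
Context {R : realType} {W : lmodType R}.
Variable ip : W -> W -> R.
Hypothesis ipH : semi_inner ip.
Implicit Types (x y z : W) (r : R).

Definition nm x := Num.sqrt (ip x x).

Lemma ipC x y : ip x y = ip y x. Proof. by case: ipH. Qed.
Lemma ip_ge0 x : 0 <= ip x x. Proof. by case: ipH. Qed.
Lemma ipl r x y z : ip (r *: x + y) z = r * ip x z + ip y z.
Proof. by case: ipH. Qed.
Lemma ip0l z : ip 0 z = 0.
Proof. by have := ipl 1 0 0 z; rewrite scale1r addr0 mul1r => h; lra. Qed.
Lemma ipDl x y z : ip (x + y) z = ip x z + ip y z.
Proof. by have := ipl 1 x y z; rewrite scale1r mul1r. Qed.
Lemma ipZl r x z : ip (r *: x) z = r * ip x z.
Proof. by have := ipl r x 0 z; rewrite ip0l !addr0. Qed.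
Lemma ipNl x z : ip (- x) z = - ip x z.
Proof. by rewrite -scaleN1r ipZl mulN1r. Qed.
Lemma ipBl x y z : ip (x - y) z = ip x z - ip y z.
Proof. by rewrite ipDl ipNl. Qed.
Lemma ip0r z : ip z 0 = 0. Proof. by rewrite ipC ip0l. Qed.
Lemma ipDr x y z : ip z (x + y) = ip z x + ip z y.
Proof. by rewrite ipC ipDl !(ipC z). Qed.
Lemma ipZr r x z : ip z (r *: x) = r * ip z x.
Proof. by rewrite ipC ipZl !(ipC z). Qed.
Lemma ipNr x z : ip z (- x) = - ip z x.
Proof. by rewrite ipC ipNl !(ipC z). Qed.
Lemma ipBr x y z : ip z (x - y) = ip z x - ip z y.
Proof. by rewrite ipC ipBl !(ipC z). Qed.
Definition ipE := (ipBl, ipBr, ipDl, ipDr, ipNl, ipNr, ipZl, ipZr, ip0l, ip0r).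

Lemma nm_ge0 x : 0 <= nm x. Proof. exact: sqrtr_ge0. Qed.
Lemma sqr_nm x : nm x ^+ 2 = ip x x. Proof. by rewrite sqr_sqrtr ?ip_ge0. Qed.

(** Near 0 the linear term dominates the quadratic one. *)
Lemma quad_ge0 (a b : R) : (forall t, 0 <= a * t ^+ 2 + 2 * b * t) -> b = 0.
Proof.
move=> H; pose K := `|a| + 1; have K0 : 0 < K by rewrite ltr_wpDl.
have aK : a <= K by rewrite (le_trans (ler_norm _))// lerDl.
have := H (- b / K).
rewrite (_ : 2 * b * _ = - (2 * b ^+ 2 / K)); last by rewrite expr2; field; exact: lt0r_neq0.
have : a * (- b / K) ^+ 2 <= K * (- b / K) ^+ 2 by rewrite ler_wpM2r// sqr_ge0.
rewrite (_ : K * _ ^+ 2 = b ^+ 2 / K); last by field; exact: lt0r_neq0.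
move=> h1 h2; have : b ^+ 2 / K <= 0.
  by move: h1 h2; rewrite -mulrA; move: (_ / K) (a * _) => *; lra.
rewrite pmulr_lle0 ?invr_gt0// => h3.
by apply/eqP; rewrite -sqrf_eq0 eq_le h3 sqr_ge0.
Qed.

Lemma ip_CS x y : `|ip x y| <= nm x * nm y.
Proof.
have H t : 0 <= ip x x + 2 * ip x y * t + ip y y * t ^+ 2.
  have := ip_ge0 (x + t *: y); rewrite !ipE (ipC y x) => h.
  by apply: le_trans h _; rewrite le_eqVlt; apply/orP; left; apply/eqP; ring.
rewrite -(ler_pXn2r (ltn0Sn 1)) ?nnegrE ?mulr_ge0 ?nm_ge0//.
rewrite exprMn !sqr_nm real_normK ?num_real//.
have [y0|y0] := eqVneq (ip y y) 0.
  suff -> : ip x y = 0 by rewrite expr0n/= mulr_ge0 ?ip_ge0.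
  have h1 := ip_ge0 x.
  apply/eqP/negPn/negP => xy0.
  have := H (- (ip x x + 1) / (2 * ip x y)).
  rewrite y0 mul0r addr0 (_ : _ * _ * _ = - (ip x x + 1)); last by field.
  by lra.
have yp : 0 < ip y y by rewrite lt0r y0 ip_ge0.
have := H (- ip x y / ip y y).
rewrite (_ : _ + _ + _ = (ip x x * ip y y - ip x y ^+ 2) / ip y y); last by field.
by rewrite pmulr_lge0 ?invr_gt0// subr_ge0.
Qed.

Lemma ip_le x y : ip x y <= nm x * nm y.
Proof. exact: le_trans (ler_norm _) (ip_CS x y). Qed.

Lemma nm_null x : (ip x x = 0) <-> (nm x = 0).
Proof.
split=> h; first by rewrite /nm h sqrtr0.
by rewrite -sqr_nm h expr0n.
Qed.

Lemma nmZ r x : nm (r *: x) = `|r| * nm x.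
Proof. by rewrite /nm !ipE mulrA -expr2 sqrtrM ?sqr_ge0// sqrtr_sqr. Qed.

Lemma nm0 : nm 0 = 0. Proof. by rewrite /nm ip0l sqrtr0. Qed.

Lemma nmN x : nm (- x) = nm x.
Proof. by rewrite -scaleN1r nmZ normrN1 mul1r. Qed.

Lemma nmD x y : nm (x + y) <= nm x + nm y.
Proof.
rewrite -(ler_pXn2r (ltn0Sn 1)) ?nnegrE ?addr_ge0 ?nm_ge0//.
rewrite sqr_nm !ipE (ipC y x) sqrrD !sqr_nm.
by have := ip_le x y; move: (nm x * nm y) => *; lra.
Qed.

Lemma nmB x y : nm (x - y) = nm (y - x).
Proof. by rewrite -nmN opprB. Qed.

Lemma nm_tri x y z : nm (x - z) <= nm (x - y) + nm (y - z).
Proof. by rewrite (le_trans _ (nmD _ _))// addrA subrK. Qed.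

Lemma nm_subl x y : nm x <= nm y + nm (x - y).
Proof. by rewrite (le_trans _ (nmD _ _))// addrC subrK. Qed.

Lemma nm_dist x y : `|nm x - nm y| <= nm (x - y).
Proof.
rewrite ler_norml; have := nm_subl x y; have := nm_subl y x.
by rewrite nmB => *; apply/andP; split; lra.
Qed.

Lemma ip_null x z : nm x = 0 -> ip x z = 0.
Proof.
move=> x0; apply/eqP; rewrite -normr_le0 (le_trans (ip_CS _ _))//.
by rewrite x0 mul0r.
Qed.

Lemma ip_eq x y z : nm (x - y) = 0 -> ip x z = ip y z.
Proof. by move=> /(@ip_null _ z); rewrite ipBl => /eqP; rewrite subr_eq0 => /eqP. Qed.

Lemma nm_eq x y : nm (x - y) = 0 -> nm x = nm y.
Proof.
by move=> h; apply/eqP; rewrite -subr_eq0 -normr_le0 -h nm_dist.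
Qed.

Lemma nm_le0 x (c : R) : (forall e, 0 < e -> nm x <= e * c) -> nm x = 0.
Proof.
move=> H; apply/eqP; rewrite eq_le nm_ge0 andbT leNgt; apply/negP => h.
have c0 : 0 < c.
  rewrite ltNge; apply/negP => c0; have := H 1 ltr01; rewrite mul1r => h1.
  by have := lt_le_trans h (le_trans h1 c0); rewrite ltxx.
have := H (nm x / (2 * c)) _; rewrite divr_gt0 ?mulr_gt0// => /(_ isT).
by rewrite (_ : _ / _ * c = nm x / 2); [lra|field; exact: lt0r_neq0].
Qed.

Lemma parallelogram x y :
  ip (x - y) (x - y) = 2 * ip x x + 2 * ip y y - ip (x + y) (x + y).
Proof. by rewrite !ipE; ring. Qed.

Definition cauchy_nm (s : nat -> W) := forall e, 0 < e ->
  exists N, forall m n, (N <= m)%N -> (N <= n)%N -> nm (s m - s n) <= e.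
Definition limit_nm (s : nat -> W) x := forall e, 0 < e ->
  exists N, forall n, (N <= n)%N -> nm (s n - x) <= e.

Hypothesis complete : forall s, cauchy_nm s -> exists x, limit_nm s x.

Lemma half_small (c e : R) : 0 < e -> exists N, forall n, (N <= n)%N -> c * 2^-1 ^+ n <= e.
Proof.
move=> e0; have /cvgrPdist_le/(_ e e0)[N _ HN] : (c * 2^-1 ^+ n) @[n --> \oo] --> c * 0.
  by apply: cvgMr; apply: cvg_expr; rewrite ger0_norm ?invr_ge0// invf_lt1// ltr1n.
by exists N => n /HN /=; rewrite mulr0 sub0r normrN; apply: le_trans (ler_norm _).
Qed.

(** Baire category by nested balls, run directly on the seminorms p_i. *)
Lemma banach_steinhaus (I : Type) (p : I -> W -> R) :
  (forall i x y, p i (x + y) <= p i x + p i y) ->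
  (forall i r x, p i (r *: x) = `|r| * p i x) ->
  (forall i, exists K, forall x, p i x <= K * nm x) ->
  (forall x, exists M, forall i, p i x <= M) ->
  exists2 M, 0 <= M & forall i x, p i x <= M * nm x.
Proof.
move=> pD pZ pK pw; apply: contrapT => nbd.
have pN i x : p i (- x) = p i x by rewrite -scaleN1r pZ normrN1 mul1r.
(* every ball contains a smaller one on which some p_i exceeds k *)
have step (s : W * R * nat) : exists s' : W * R * nat,
    [/\ s'.2 = s.2.+1, 0 < s.1.2 -> 0 < s'.1.2, s'.1.2 <= s.1.2 / 2,
        0 < s.1.2 -> forall y, nm (y - s'.1.1) <= s'.1.2 -> nm (y - s.1.1) <= s.1.2 &
        0 < s.1.2 -> exists i, forall y, nm (y - s'.1.1) <= s'.1.2 -> s.2%:R <= p i y].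
  case: s => [[x r] k] /=; have [r0|r0] := ltP 0 r; last first.
    by exists (x, r / 2, k.+1); split=> //= h; have := lt_le_trans h r0; rewrite ltxx.
  have [i [y [yr py]]] : exists i y, nm (y - x) <= r / 2 /\ k%:R + 1 < p i y.
    apply: contrapT => nex; apply: nbd.
    have B i y : nm (y - x) <= r / 2 -> p i y <= k%:R + 1.
      by move=> h; rewrite leNgt; apply/negP => h'; apply: nex; exists i, y.
    exists (2 * (k%:R + 1) / (r / 2)).
      by rewrite divr_ge0 ?mulr_ge0 ?addr_ge0 ?ler0n// ltW// divr_gt0.
    move=> i z; have [K HK] := pK i.
    have C0 : 0 <= k%:R + 1 :> R by rewrite addr_ge0 ?ler0n.
    have bound e : 0 < e -> p i z <= 2 * (k%:R + 1) / (r / 2) * (nm z + e).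
      move=> e0; pose c := nm z + e; have c0 : 0 < c by rewrite ltr_wpDl ?nm_ge0.
      pose w := (r / 2 / c) *: z.
      have wr : nm w <= r / 2.
        rewrite nmZ gtr0_norm; last by rewrite !divr_gt0.
        by rewrite mulrAC ler_pdivrMr// ler_pM2l ?divr_gt0// lerDl ltW.
      have h1 : p i (x + w) <= k%:R + 1 by apply: B; rewrite addrC addKr.
      have h2 : p i x <= k%:R + 1 by apply: B; rewrite subrr nm0 ltW ?divr_gt0.
      have h3 : p i w <= 2 * (k%:R + 1).
        have -> : w = (x + w) + - x by rewrite addrAC subrr add0r.
        by rewrite (le_trans (pD _ _ _))// pN; lra.
      move: h3; rewrite pZ gtr0_norm; last by rewrite !divr_gt0.
      rewrite -(@ler_pM2l _ (c / (r / 2))) ?divr_gt0//.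
      rewrite mulrA (_ : c / (r / 2) * (r / 2 / c) = 1) ?mul1r; last first.
        by field; rewrite !lt0r_neq0.
      by rewrite (mulrC (c / _)) mulrA (mulrAC _ c).
    rewrite leNgt; apply/negP => h.
    pose A := 2 * (k%:R + 1) / (r / 2); rewrite -/A in bound h.
    have A0 : 0 <= A by rewrite divr_ge0 ?mulr_ge0 // ltW// divr_gt0.
    have A1 : 0 < A + 1 by rewrite ltr_wpDl.
    have g0 : 0 < (p i z - A * nm z) / (2 * (A + 1)).
      by rewrite divr_gt0 ?subr_gt0 ?mulr_gt0.
    have := bound _ g0; rewrite mulrDr.
    have : A * ((p i z - A * nm z) / (2 * (A + 1))) <= (A + 1) * ((p i z - A * nm z) / (2 * (A + 1))).
      by rewrite ler_wpM2r ?lerDl// ltW.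
    rewrite (_ : (A + 1) * _ = (p i z - A * nm z) / 2); last by field; rewrite lt0r_neq0.
    by move: h; move: (A * nm z) (A * _) => *; lra.
  have [K HK] := pK i.
  have K10 : 0 < `|K| + 1 by rewrite ltr_wpDl.
  pose r' := Num.min (r / 2) (`|K| + 1)^-1.
  have r'0 : 0 < r' by rewrite lt_min invr_gt0 K10 divr_gt0.
  have r'r : r' <= r / 2 by rewrite ge_min lexx.
  exists (y, r', k.+1); split=> //=.
    move=> _ z zy; rewrite (le_trans (nm_tri _ y _))//.
    by rewrite (_ : r = r / 2 + r / 2); [rewrite lerD// (le_trans zy)|field].
  move=> _; exists i => z zy.
  have : p i y <= p i z + p i (y - z).
    by rewrite (le_trans _ (pD _ _ _))// addrC subrK.
  have : p i (y - z) <= 1.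
    rewrite (le_trans (HK _))//.
    apply: (@le_trans _ _ ((`|K| + 1) * nm (y - z))).
      by rewrite ler_wpM2r ?nm_ge0// (le_trans (ler_norm _))// lerDl.
    rewrite nmB; apply: (@le_trans _ _ ((`|K| + 1) * (`|K| + 1)^-1)).
      by rewrite ler_pM2l// (le_trans zy)// ge_min lexx orbT.
    by rewrite divff// lt0r_neq0.
  by move: py; lra.
have [f Hf] := choice step.
pose s n := iter n f ((0 : W), (1 : R), 0%N).
have s2 n : (s n).2 = n.
  by elim: n => //= n IH; have [-> _ _ _ _] := Hf (s n); rewrite IH.
have r0 n : 0 < (s n).1.2.
  by elim: n => /= [|n IH]; [exact: ltr01|have [_ h _ _ _] := Hf (s n); exact: h].
have rn n : (s n).1.2 <= 2^-1 ^+ n.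
  elim: n => /= [|n IH]; first by rewrite expr0.
  have [_ _ h _ _] := Hf (s n); rewrite (le_trans h)// exprS mulrC.
  by rewrite ler_pM2l ?invr_gt0.
have nest m n y : (m <= n)%N -> nm (y - (s n).1.1) <= (s n).1.2 -> nm (y - (s m).1.1) <= (s m).1.2.
  move=> /subnK <-; elim: (n - m)%N => // d IH h; apply: IH.
  by have [_ _ _ h' _] := Hf (s (d + m)%N); apply: h'.
have inb m n : (m <= n)%N -> nm ((s n).1.1 - (s m).1.1) <= (s m).1.2.
  by move=> mn; apply: nest mn _; rewrite subrr nm0 ltW.
have [e0|x Hx] := complete (s := fun n => (s n).1.1).
  move=> e0'; have [N HN] := half_small 2 e0'.
  exists N => m n Nm Nn; rewrite (le_trans (nm_tri _ (s N).1.1 _))//.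
  rewrite (nmB _ (s n).1.1); have := inb _ _ Nm; have := inb _ _ Nn.
  by have := rn N; have := HN N (leqnn _); lra.
have xin m : nm (x - (s m).1.1) <= (s m).1.2.
  rewrite leNgt; apply/negP => h.
  have g0 : 0 < (nm (x - (s m).1.1) - (s m).1.2) / 2 by rewrite divr_gt0 ?subr_gt0.
  have [N HN] := Hx _ g0; pose n := maxn N m.
  have := nm_tri x (s n).1.1 (s m).1.1; rewrite (nmB x (s n).1.1).
  have := HN n (leq_maxl _ _); have := inb _ _ (leq_maxr N m); rewrite -/n.
  by move: h; lra.
have [M HM] := pw x.
pose k := (Num.truncn `|M|).+1.
have [_ _ _ _ /(_ (r0 k))[i Hi]] := Hf (s k).
have := Hi x (xin k.+1); rewrite s2 => h.
have := le_trans h (HM i); rewrite leNgt => /negP; apply.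
by rewrite (le_lt_trans (ler_norm _))// truncnS_gt.
Qed.

(** F is represented by the minimiser of <x,x> - 2 F x; minimising sequences are
    Cauchy by the parallelogram identity. *)
Lemma riesz (F : W -> R) : (forall r x y, F (r *: x + y) = r * F x + F y) ->
  (exists K, forall x, F x <= K * nm x) -> exists v, forall x, F x = ip v x.
Proof.
move=> Fl [K FK].
have F0 : F 0 = 0 by have := Fl 1 0 0; rewrite scale1r addr0 mul1r => h; lra.
have FD x y : F (x + y) = F x + F y by have := Fl 1 x y; rewrite scale1r mul1r.
have FZ r x : F (r *: x) = r * F x by have := Fl r x 0; rewrite !addr0 F0 addr0.
pose J x := ip x x - 2 * F x.
have JK x : - K ^+ 2 <= J x.
  have : 0 <= (nm x - K) ^+ 2 by exact: sqr_ge0.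
  by rewrite sqrrB sqr_nm /J; have := FK x; rewrite (mulrC (nm x)) => *; lra.
pose A := range J.
have hA : has_inf A by split; [exists (J 0), 0|exists (- K ^+ 2) => _ [x _ <-]].
pose m := inf A.
have mJ x : m <= J x by apply: ge_inf; [case: hA|exists x].
have mid x y : ip (x - y) (x - y) <= 2 * (J x - m) + 2 * (J y - m).
  have := mJ (2^-1 *: (x + y)); rewrite /J !ipE !FZ FD (ipC y x) => h.
  by rewrite /J; lra.
have /choice[s Hs] n : exists x, J x <= m + 2^-1 ^+ n.
  have n0 : 0 < 2^-1 ^+ n :> R by rewrite exprn_gt0// invr_gt0.
  have [_ [x _ <-] h] := inf_adherent n0 hA; exists x; exact: ltW.
have Cs : cauchy_nm s.
  move=> e e0; have e20 : 0 < e ^+ 2 by rewrite exprn_gt0.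
  have [N HN] := half_small 4 e20.
  exists N => a b Na Nb.
  rewrite -(ler_pXn2r (ltn0Sn 1)) ?nnegrE ?nm_ge0 ?(ltW e0)// sqr_nm (le_trans (mid _ _))//.
  by have := HN _ Na; have := HN _ Nb; have := Hs a; have := Hs b; lra.
have [v Hv] := complete Cs.
have Jv : J v <= m.
  pose C := 2 * nm v + 1 + 2 * `|K|.
  have C0 : 0 < C by rewrite /C; have := nm_ge0 v; have := normr_ge0 K; lra.
  rewrite leNgt; apply/negP => h.
  pose e := Num.min 1 ((J v - m) / (4 * C)).
  have e0 : 0 < e by rewrite lt_min ltr01 divr_gt0 ?subr_gt0 ?mulr_gt0.
  have eC : e * C <= (J v - m) / 4.
    apply: (@le_trans _ _ ((J v - m) / (4 * C) * C)).
      by rewrite ler_pM2r// ge_min lexx orbT.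
    by rewrite le_eqVlt; apply/orP; left; apply/eqP; field; exact: lt0r_neq0.
  have [N HN] := Hv e e0.
  have g0 : 0 < J v - m by rewrite subr_gt0.
  have [N2 HN2] := half_small 4 g0; pose n := maxn N N2; pose d := v - s n.
  have d1 : nm d <= e by rewrite nmB; apply: HN; exact: leq_maxl.
  have Jd : J v - J (s n) = 2 * ip v d - ip d d - 2 * F d.
    have -> : s n = v - d by rewrite opprB addrC subrK.
    rewrite /J !ipE -scaleN1r FD FZ (ipC _ v). ring.
  have h1 := ip_le v d; have h2 := ip_ge0 d.
  have h3 : - F d <= `|K| * nm d.
    rewrite -mulN1r -FZ (le_trans (FK _))// nmZ normrN1 mul1r.
    by rewrite ler_wpM2r ?nm_ge0 ?ler_norm.
  have h4 : 2 * (nm v * nm d) + 2 * (`|K| * nm d) <= e * C.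
    rewrite (_ : _ + _ = nm d * (2 * nm v + 2 * `|K|)); last by ring.
    by rewrite ler_pM ?nm_ge0 ?addr_ge0 ?mulr_ge0 ?nm_ge0// /C; lra.
  have h5 := HN2 n (leq_maxr _ _); have h6 := Hs n.
  move: h1 h2 h3 h4 h5 h6 eC Jd h; move: (nm v * nm d) (`|K| * nm d) => *; lra.
exists v => x.
have /eqP : ip v x - F x = 0; last by rewrite subr_eq0 => /eqP.
apply: (@quad_ge0 (ip x x)) => t.
have := mJ (v + t *: x); rewrite /J FD FZ !ipE (ipC x v) => h.
by move: Jv; rewrite /J; lra.
Qed.

End SemiHilbert.

(** * Strong stability of dissipative semigroups *)

Section Semigroup.
Context {R : realType} {W : lmodType R}.
Variable ip : W -> W -> R.
Hypothesis ipH : semi_inner ip.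
Hypothesis complete : forall s, cauchy_nm ip s -> exists x, limit_nm ip s x.
Variable T : R -> W -> W.
Local Notation nrm := (nm ip).
Implicit Types (x y z : W) (r s t e h : R).
Hypothesis Tlin : forall t r x y, 0 <= t ->
  nrm (T t (r *: x + y) - (r *: T t x + T t y)) = 0.
Hypothesis Tbnd : forall t, 0 <= t -> exists K, forall x, nrm (T t x) <= K * nrm x.
Hypothesis T0 : forall x, nrm (T 0 x - x) = 0.
Hypothesis TD : forall s t x, 0 <= s -> 0 <= t ->
  nrm (T (s + t) x - T s (T t x)) = 0.
Hypothesis Tcont : forall x e, 0 < e ->
  exists2 d, 0 < d & forall h, 0 <= h -> h <= d -> nrm (T h x - x) <= e.

Let ipE := (ipE ipH).

Lemma null_trans x y z : nrm (x - y) = 0 -> nrm (y - z) = 0 -> nrm (x - z) = 0.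
Proof.
move=> xy yz; apply/eqP; rewrite eq_le nm_ge0 andbT.
by rewrite (le_trans (nm_tri ipH _ y _))// xy yz addr0.
Qed.

Lemma null_sym x y : nrm (x - y) = 0 -> nrm (y - x) = 0.
Proof. by rewrite nmB. Qed.

Lemma ip_Tlin t r x y z : 0 <= t ->
  ip (T t (r *: x + y)) z = r * ip (T t x) z + ip (T t y) z.
Proof. by move=> t0; rewrite (ip_eq ipH z (Tlin _ _ _ t0)) !ipE. Qed.

Lemma nm_TB t x y : 0 <= t -> nrm (T t x - T t y) = nrm (T t (x - y)).
Proof.
move=> t0; apply: (nm_eq ipH); apply: null_sym.
by have := Tlin (-1) y x t0; rewrite !scaleN1r ![- _ + _]addrC.
Qed.

Lemma nm_TD s t x : 0 <= s -> 0 <= t -> nrm (T (s + t) x) = nrm (T s (T t x)).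
Proof. by move=> s0 t0; apply: (nm_eq ipH); exact: TD. Qed.

Lemma nm_Tsum t x y : 0 <= t -> nrm (T t (x + y)) <= nrm (T t x) + nrm (T t y).
Proof.
move=> t0; have := Tlin 1 x y t0; rewrite !scale1r => /(nm_eq ipH) ->.
exact: nmD.
Qed.

Lemma nm_Tscale t r x : 0 <= t -> nrm (T t (r *: x)) = `|r| * nrm (T t x).
Proof.
move=> t0; have h0 : nrm (T t 0) = 0.
  by have [K /(_ 0)] := Tbnd t0; rewrite nm0// mulr0 => h; apply/eqP; rewrite eq_le h nm_ge0.
have := Tlin r x 0 t0; rewrite addr0 => h; rewrite -nmZ//.
apply: (nm_eq ipH); apply: null_trans h _; rewrite addrC addKr; exact: h0.
Qed.

Lemma Tnull t x y : 0 <= t -> nrm (x - y) = 0 -> nrm (T t x - T t y) = 0.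
Proof.
move=> t0 xy; rewrite nm_TB//; have [K /(_ (x - y))] := Tbnd t0.
by rewrite xy mulr0 => h; apply/eqP; rewrite eq_le h nm_ge0.
Qed.

(** Each orbit is bounded near 0 by right continuity; if no uniform bound held on
    any interval, times t_n -> 0 with large |T t_n| would contradict the principle
    of uniform boundedness. *)
Lemma bounded_near0 : exists2 d, 0 < d & exists2 M, 1 <= M &
  forall t x, 0 <= t -> t <= d -> nrm (T t x) <= M * nrm x.
Proof.
apply: contrapT => nb.
have /choice[tx Htx] (n : nat) : exists tx : R * W, [/\ 0 <= tx.1, tx.1 <= n.+1%:R^-1 &
    n.+1%:R * nrm tx.2 < nrm (T tx.1 tx.2)].
  apply: contrapT => ne; apply: nb; exists n.+1%:R^-1; first by rewrite invr_gt0.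
  exists n.+1%:R => [|t x t0 tn]; first by rewrite ler1n.
  by rewrite leNgt; apply/negP => h; apply: ne; exists (t, x).
have [|||x|M M0 HM] := @banach_steinhaus _ _ ip ipH complete nat (fun n x => nrm (T (tx n).1 x)).
- by move=> n x y; have [h _ _] := Htx n; exact: nm_Tsum.
- by move=> n r x; have [h _ _] := Htx n; exact: nm_Tscale.
- by move=> n; have [h _ _] := Htx n; exact: Tbnd.
- have [d d0 Hd] := Tcont x ltr01.
  pose N := (Num.truncn d^-1).+1.
  exists (\sum_(i < N) nrm (T (tx i).1 x) + (nrm x + 1)) => n.
  have [nN|Nn] := ltnP n N.
    rewrite (bigD1 (Ordinal nN))//= -addrA lerDl addr_ge0//.
      by apply: sumr_ge0 => i _; exact: nm_ge0.
    by rewrite addr_ge0 ?nm_ge0.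
  rewrite ler_wpDl//; first by apply: sumr_ge0 => i _; exact: nm_ge0.
  have [h1 h2 _] := Htx n.
  rewrite (le_trans (nm_subl ipH _ x))// lerD2l; apply: Hd => //.
  rewrite (le_trans h2)// invf_ple ?posrE//.
  apply: ltW; apply: lt_le_trans (truncnS_gt _) _.
  by rewrite ler_nat leqW.
- pose n := Num.truncn M; have [h1 h2 h3] := Htx n.
  have := lt_le_trans h3 (HM n (tx n).2).
  rewrite ltNge => /negP; apply; rewrite ler_wpM2r ?nm_ge0//.
  by apply: ltW; exact: truncnS_gt.
Qed.

Lemma bounded_loc b : exists2 M, 1 <= M &
  forall t x, 0 <= t -> t <= b -> nrm (T t x) <= M * nrm x.
Proof.
have [d d0 [M M1 H]] := bounded_near0.
have M0 : 0 <= M by rewrite (le_trans _ M1).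
have Hn n : forall t x, 0 <= t -> t <= n.+1%:R * d -> nrm (T t x) <= M ^+ n.+1 * nrm x.
  elim: n => [|n IH] t x t0; first by rewrite mul1r expr1; exact: H.
  move=> tn; have [td|dt] := leP t d.
    rewrite (le_trans (H _ _ t0 td))// ler_wpM2r ?nm_ge0// exprS.
    by rewrite ler_peMr ?exprn_ege1.
  have td : 0 <= t - d by rewrite subr_ge0 ltW.
  have E := nm_TD x td (ltW d0); rewrite subrK in E.
  rewrite E (le_trans (IH _ _ td _))//.
    by move: tn; rewrite -[n.+2]addn1 natrD mulrDl mul1r; lra.
  rewrite [M ^+ n.+2]exprSr -mulrA ler_wpM2l ?exprn_ge0//; apply: H => //; exact: ltW.
pose n := Num.truncn (b / d).
exists (M ^+ n.+1); first exact: exprn_ege1.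
move=> t x t0 tb; apply: Hn => //; rewrite (le_trans tb)//.
by rewrite -ler_pdivrMr// ltW// truncnS_gt.
Qed.

Lemma Tcontinuous x t : 0 <= t -> forall e, 0 < e -> exists2 d, 0 < d &
  forall s, 0 <= s -> `|s - t| <= d -> nrm (T s x - T t x) <= e.
Proof.
move=> t0 e e0; have [M M1 HM] := bounded_loc (t + 1).
have M0 : 0 < M by rewrite (lt_le_trans _ M1).
have [d d0 Hd] := Tcont x (divr_gt0 e0 M0).
exists (Num.min 1 d); first by rewrite lt_min ltr01.
move=> s s0; rewrite le_min => /andP[s1 sd].
have main a c : 0 <= a -> a <= t + 1 -> 0 <= c -> c <= d -> nrm (T (a + c) x - T a x) <= e.
  move=> a0 at1 c0 cd.
  rewrite (_ : e = M * (e / M)); last by field; exact: lt0r_neq0.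
  apply: (@le_trans _ _ (nrm (T a (T c x) - T a x))).
    rewrite (le_trans (nm_tri ipH _ (T a (T c x)) _))//.
    by rewrite TD// add0r.
  rewrite nm_TB// (le_trans (HM _ _ a0 at1))// ler_wpM2l ?(ltW M0)//; exact: Hd.
have [st|ts] := leP s t.
  rewrite nmB//.
  move: sd; rewrite distrC ger0_norm ?subr_ge0// => sd.
  have := main s (t - s) s0; rewrite (addrC s) subrK; apply=> //; first by lra.
  by rewrite subr_ge0.
move: sd; rewrite gtr0_norm ?subr_gt0// => sd.
have := main t (s - t) t0; rewrite (addrC t (s - t)) subrK; apply => //; first by lra.
by rewrite subr_ge0 ltW.
Qed.

Lemma contP_ip x z : contP (fun t => ip (T t x) z).
Proof.
move=> t t0 e e0.
have n0 : 0 < nrm z + 1 by rewrite ltr_wpDl ?nm_ge0.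
have [d d0 Hd] := Tcontinuous x t0 (divr_gt0 e0 n0).
exists d => // s s0 /(Hd s s0) h; rewrite -ipBl// (le_trans (ip_CS ipH _ _))//.
rewrite (_ : e = e / (nrm z + 1) * (nrm z + 1)); last by field; exact: lt0r_neq0.
by rewrite ler_pM ?nm_ge0// lerDl.
Qed.

Lemma contP_nm x : contP (fun t => nrm (T t x)).
Proof.
move=> t t0 e e0; have [d d0 Hd] := Tcontinuous x t0 e0.
by exists d => // s s0 /(Hd s s0) h; rewrite (le_trans (nm_dist ipH _ _)).
Qed.

(** The graph of the generator, closed under equality up to null vectors. *)
Definition gen x y := forall e, 0 < e -> exists2 d, 0 < d &
  forall h, 0 < h -> h <= d -> nrm (T h x - x - h *: y) <= h * e.

Lemma gen_null x x' y y' : nrm (x - x') = 0 -> nrm (y - y') = 0 ->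
  gen x y -> gen x' y'.
Proof.
move=> xx yy g e e0; have [d d0 H] := g e e0; exists d => // h h0 hd.
rewrite (_ : nrm _ = nrm (T h x - x - h *: y)) ?H//; apply/esym.
apply: (nm_eq ipH).
have -> : T h x - x - h *: y - (T h x' - x' - h *: y') =
  (T h x - T h x') + (-1) *: ((x - x') + h *: (y - y')).
  rewrite scaleN1r !scalerBr; move: (h *: y) (h *: y') (T h x) (T h x') => a b c f.
  by rewrite !opprD !opprK; rewrite !addrA; do ![rewrite (ACl (1*4*2*5*3*6))//=].
apply/eqP; rewrite eq_le nm_ge0 andbT (le_trans (nmD ipH _ _))//.
rewrite (Tnull (ltW h0) xx) add0r nmZ// normrN1 mul1r (le_trans (nmD ipH _ _))//.
by rewrite xx nmZ// yy mulr0 addr0.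
Qed.

Lemma gen_lin r x x' y y' : gen x y -> gen x' y' -> gen (r *: x + x') (r *: y + y').
Proof.
move=> g g' e e0.
have r0 : 0 < `|r| + 1 by rewrite ltr_wpDl.
have e1 : 0 < e / 2 / (`|r| + 1) by rewrite !divr_gt0.
have e2 : 0 < e / 2 by rewrite divr_gt0.
have [d1 d10 H1] := g _ e1; have [d2 d20 H2] := g' _ e2.
exists (Num.min d1 d2); first by rewrite lt_min d10.
move=> h h0; rewrite le_min => /andP[/(H1 h h0) h1 /(H2 h h0) h2].
pose a := T h x - x - h *: y; pose a' := T h x' - x' - h *: y'.
rewrite (_ : nrm _ = nrm (r *: a + a')).
  rewrite (le_trans (nmD ipH _ _))// nmZ//.
  rewrite (_ : h * e = (`|r| + 1) * (h * (e / 2 / (`|r| + 1))) + h * (e / 2)).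
    by rewrite lerD// ler_pM ?nm_ge0// lerDl.
  by field; exact: lt0r_neq0.
apply: (nm_eq ipH).
have := Tlin r x x' (ltW h0) => E; rewrite -[RHS]E; congr nrm.
rewrite /a /a' !scalerBr !scalerDr !scalerA (mulrC h).
move: (T h (r *: x + x')) (r *: T h x) (T h x') (r *: x) ((r * h) *: y) (h *: y') => A B C D F G.
rewrite !opprD !opprK !addrA.
by rewrite (ACl (1*6*9*(2*7)*(3*10)*(4*8)*(5*11)))/= !addNr !addr0.
Qed.


Lemma null_ext x y : (forall z, ip x z = ip y z) -> nrm (x - y) = 0.
Proof. by move=> H; apply/(nm_null ipH); rewrite ipBl// H subrr. Qed.

Lemma nm_ext x y : (forall z, ip x z = ip y z) -> nrm x = nrm y.
Proof. by move=> /null_ext /(nm_eq ipH). Qed.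

Lemma ip_TD t x y z : 0 <= t -> ip (T t (x + y)) z = ip (T t x) z + ip (T t y) z.
Proof. by move=> t0; have := ip_Tlin 1 x y z t0; rewrite scale1r mul1r. Qed.

Lemma ip_T0 t z : 0 <= t -> ip (T t 0) z = 0.
Proof. by move=> t0; have := ip_Tlin 1 0 0 z t0; rewrite scaler0 addr0 => h; lra. Qed.

Lemma ip_TZ t r x z : 0 <= t -> ip (T t (r *: x)) z = r * ip (T t x) z.
Proof. by move=> t0; have := ip_Tlin r x 0 z t0; rewrite addr0 ip_T0// addr0. Qed.

Lemma ip_TN t x z : 0 <= t -> ip (T t (- x)) z = - ip (T t x) z.
Proof. by move=> t0; rewrite -scaleN1r ip_TZ// mulN1r. Qed.

Lemma ip_TS s t x z : 0 <= s -> 0 <= t -> ip (T (s + t) x) z = ip (T s (T t x)) z.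
Proof. by move=> s0 t0; apply: (ip_eq ipH); exact: TD. Qed.

Lemma ip_TC s t x z : 0 <= s -> 0 <= t -> ip (T s (T t x)) z = ip (T t (T s x)) z.
Proof. by move=> s0 t0; rewrite -!ip_TS// addrC. Qed.

Lemma gen_T x y t : 0 <= t -> gen x y -> gen (T t x) (T t y).
Proof.
move=> t0 g e e0; have [K HK] := Tbnd t0.
have K0 : 0 < `|K| + 1 by rewrite ltr_wpDl.
have [d d0 H] := g _ (divr_gt0 e0 K0); exists d => // h h0 hd.
rewrite (@nm_ext _ (T t (T h x - x - h *: y))); last first.
  by move=> z; rewrite !ipE !(ip_TD, ip_TN, ip_TZ)// (ip_TC _ _ t0 (ltW h0)).
rewrite (le_trans (HK _))//.
apply: (@le_trans _ _ ((`|K| + 1) * (h * (e / (`|K| + 1))))).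
  rewrite (@le_trans _ _ ((`|K| + 1) * nrm (T h x - x - h *: y)))//.
    by rewrite ler_wpM2r ?nm_ge0// (le_trans (ler_norm _))// lerDl.
  by rewrite ler_pM2l// H.
by rewrite le_eqVlt; apply/orP; left; apply/eqP; field; exact: lt0r_neq0.
Qed.

Lemma rderiv_ip x y z t : 0 <= t -> gen x y ->
  rderiv (fun s => ip (T s x) z) t (ip (T t y) z).
Proof.
move=> t0 /(gen_T t0) g e e0.
have z0 : 0 < nrm z + 1 by rewrite ltr_wpDl ?nm_ge0.
have [d d0 H] := g _ (divr_gt0 e0 z0); exists d => // h h0 hd.
have -> : ip (T (t + h) x) z - ip (T t x) z - h * ip (T t y) z =
    ip (T h (T t x) - T t x - h *: T t y) z.
  by rewrite (addrC t h) ip_TS ?(ltW h0)// !ipE.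
rewrite (le_trans (ip_CS ipH _ _))//.
rewrite (_ : h * e = h * (e / (nrm z + 1)) * (nrm z + 1)); last by field; exact: lt0r_neq0.
by rewrite ler_pM ?nm_ge0// ?H// lerDl.
Qed.

(** |a + d|^2 - |a|^2 = 2 <d, a> + |d|^2, where the increment d is of order h. *)
Lemma rderiv_sq x y t : 0 <= t -> gen x y ->
  rderiv (fun s => ip (T s x) (T s x)) t (2 * ip (T t x) (T t y)).
Proof.
move=> t0 /(gen_T t0) g e e0; set a := T t x in g *; set c := T t y in g *.
pose e' := Num.min 1 (e / (4 * (nrm a + 1))).
have a0 : 0 < nrm a + 1 by rewrite ltr_wpDl ?nm_ge0.
have c0 : 0 < nrm c + 1 by rewrite ltr_wpDl ?nm_ge0.
have e'0 : 0 < e' by rewrite lt_min ltr01 divr_gt0// mulr_gt0.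
have [d d0 H] := g _ e'0.
pose d2 := e / (2 * (nrm c + 1) ^+ 2).
have d20 : 0 < d2 by rewrite divr_gt0// mulr_gt0// exprn_gt0.
exists (Num.min d d2); first by rewrite lt_min d0.
move=> h h0; rewrite le_min => /andP[/(H h h0) hr hd2].
set r := _ - _ - _ in hr.
have E z : ip (T (t + h) x) z = ip (a + h *: c + r) z.
  by rewrite (addrC t h) ip_TS ?(ltW h0)// /r !ipE; ring.
rewrite E (ipC ipH) E (_ : _ - _ - _ = 2 * ip a r + ip (h *: c + r) (h *: c + r)); last first.
  by clearbody r; rewrite !ipE (ipC ipH c a) (ipC ipH r a) (ipC ipH r c); ring.
rewrite (le_trans (ler_normD _ _))// (_ : h * e = h * (e / 2) + h * (e / 2)); last by field.
apply: lerD.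
  rewrite normrM ger0_norm// (le_trans (ler_wpM2l _ (ip_CS ipH _ _)))//.
  apply: (@le_trans _ _ (2 * ((nrm a + 1) * (h * (e / (4 * (nrm a + 1))))))).
    rewrite ler_pM2l// ler_pM ?nm_ge0// ?lerDl// (le_trans hr)// ler_pM2l//.
    by rewrite ge_min lexx orbT.
  by rewrite le_eqVlt; apply/orP; left; apply/eqP; field; exact: lt0r_neq0.
rewrite ger0_norm ?ip_ge0// -sqr_nm//.
have hcr : nrm (h *: c + r) <= h * (nrm c + 1).
  rewrite (le_trans (nmD ipH _ _))// nmZ// gtr0_norm// mulrDr mulr1 lerD2l.
  by rewrite (le_trans hr)// -[leRHS]mulr1 ler_pM2l// ge_min lexx.
apply: (@le_trans _ _ ((h * (nrm c + 1)) ^+ 2)).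
  by rewrite ler_pXn2r ?nnegrE ?nm_ge0// mulr_ge0// ltW.
rewrite exprMn expr2 -mulrA ler_pM2l//.
apply: (@le_trans _ _ (d2 * (nrm c + 1) ^+ 2)); first by rewrite ler_pM2r// exprn_gt0.
by rewrite /d2 le_eqVlt; apply/orP; left; apply/eqP; field; exact: lt0r_neq0.
Qed.

Hypothesis dissipative : forall x y, gen x y -> ip x y <= 0.

Lemma contraction_gen x y t : 0 <= t -> gen x y -> nrm (T t x) <= nrm x.
Proof.
move=> t0 g; rewrite -(ler_pXn2r (ltn0Sn 1)) ?nnegrE ?nm_ge0// !sqr_nm//.
have := @rderiv_mv _ (fun s => ip (T s x) (T s x)) 0 0 t
  (fun s => 2 * ip (T s x) (T s y)) (lexx _) t0.
rewrite mul0r subr_le0; have -> : ip (T 0 x) (T 0 x) = ip x x.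
  by rewrite -!sqr_nm// (nm_eq ipH (T0 x)).
apply.
- move=> s s0 e e0.
  have c2 := contPM (contP_nm x) (contP_nm x).
  by have [d d0 H] := c2 s s0 e e0; exists d => // r r0 /(H r r0); rewrite -!expr2 !sqr_nm.
- by move=> s s0 _; exact: rderiv_sq.
- by move=> s s0 _; rewrite pmulr_rle0//; apply: dissipative; exact: gen_T.
Qed.

Lemma primitive_uniq (F G f : R -> R) : F 0 = G 0 -> contP F -> contP G ->
  (forall t, 0 <= t -> rderiv F t (f t)) -> (forall t, 0 <= t -> rderiv G t (f t)) ->
  forall t, 0 <= t -> F t = G t.
Proof.
have half (F' G' : R -> R) : F' 0 = G' 0 -> contP F' -> contP G' ->
  (forall t, 0 <= t -> rderiv F' t (f t)) -> (forall t, 0 <= t -> rderiv G' t (f t)) ->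
  forall t, 0 <= t -> F' t <= G' t.
  move=> FG0 cF cG dF dG t t0.
  have := @rderiv_mv _ (fun s => F' s + (-1) * G' s) 0 0 t (fun=> 0) (lexx _) t0.
  rewrite mul0r subr_le0 FG0 (_ : G' 0 + _ = 0) ?mulN1r ?subrr ?subr_le0//; apply=> //.
    by apply: contPD => //; apply: contPM => //; exact: contP_cst.
  move=> s s0 _; rewrite (_ : 0 = f s + -1 * f s); last by rewrite mulN1r subrr.
  by apply: rderivD; [exact: dF|apply: rderivZ; exact: dG].
by move=> *; apply/eqP; rewrite eq_le !half.
Qed.

(** T t is linear only up to null vectors, but its weak form is linear and bounded,
    so the representation theorem applies. *)
Lemma adjoint t z : 0 <= t -> exists z', forall y, ip (T t y) z = ip z' y.
Proof.
move=> t0; apply: (riesz ipH complete) => [r x y|]; first exact: ip_Tlin.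
have [K HK] := Tbnd t0; exists (K * nrm z) => x.
by rewrite (le_trans (ip_le ipH _ _))// mulrAC ler_wpM2r ?nm_ge0.
Qed.

(** The weak integral of the orbit of x over [0, h], tested against every z; it
    replaces a vector-valued integral. *)
Definition wint x h I := forall z, exists Phi, [/\ Phi 0 = 0, contP Phi,
  forall t, 0 <= t -> rderiv Phi t (ip (T t x) z) & ip I z = Phi h].

Lemma wint_exists x h : 0 <= h -> exists I, wint x h I.
Proof.
move=> h0.
have /choice[Phi HPhi] (z : W) := contP_primitive (contP_ip x z).
have [r z z'||I HI] := riesz ipH complete (F := fun z => Phi z h).
- have [a1 a2 a3] := HPhi z; have [b1 b2 b3] := HPhi z'.
  have [c1 c2 c3] := HPhi (r *: z + z').
  apply: (@primitive_uniq (Phi (r *: z + z')) (fun t => r * Phi z t + Phi z' t)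
    (fun t => ip (T t x) (r *: z + z'))) => //.
  + by rewrite a1 b1 c1 mulr0 addr0.
  + by apply: contPD => //; apply: contPM => //; exact: contP_cst.
  + move=> t t0; rewrite !ipE; apply: rderivD; last exact: b3.
    by apply: rderivZ; exact: a3.
- have [M M1 HM] := bounded_loc h.
  exists (M * nrm x * h) => z; have [a1 a2 a3] := HPhi z.
  have h1 : Phi z h - Phi z 0 <= (M * nrm x * nrm z) * (h - 0).
    apply: (@rderiv_mv _ _ _ _ _ (fun t => ip (T t x) z) (lexx _) h0 a2 (fun t tp _ => a3 t tp)) => t t0 th.
    by rewrite (le_trans (ip_le ipH _ _))// ler_wpM2r ?nm_ge0// HM// ltW.
  by move: h1; rewrite a1 !subr0 mulrAC.
- by exists I => z; exists (Phi z); have [? ? ?] := HPhi z; split.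
Qed.

Lemma wint_near x e : 0 < e -> exists2 d, 0 < d & forall h I, 0 < h -> h <= d ->
  wint x h I -> nrm (I - h *: x) <= h * e.
Proof.
move=> e0; have [d d0 H] := Tcont x e0; exists d => // h I h0 hd HI.
have [v vE] : exists v, v = I - h *: x by exists (I - h *: x).
rewrite -vE; have [Phi [P0 cP dP Ph]] := HI v.
have : ip v v <= h * e * nrm v.
  rewrite {1}vE !ipE Ph.
  have h1 : Phi h - Phi 0 <= (ip x v + e * nrm v) * (h - 0).
    apply: (@rderiv_mv _ _ _ _ _ (fun t => ip (T t x) v) (lexx _) (ltW h0) cP (fun t tp _ => dP t tp)) => t t0 th.
     rewrite -lerBlDl -ipBl// (le_trans (ip_le ipH _ _))//.
    by rewrite ler_wpM2r ?nm_ge0// H// (le_trans (ltW th)).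
  move: h1; rewrite P0 !subr0 => h1.
  by rewrite lerBlDl (le_trans h1)// le_eqVlt; apply/orP; left; apply/eqP; ring.
have [v0|v0] := eqVneq (nrm v) 0; first by rewrite v0 mulr_ge0// ltW.
by rewrite -sqr_nm// expr2 ler_pM2r// lt0r v0 nm_ge0.
Qed.

(** The difference T r I - I is the integral over [h, h + r] minus the one over
    [0, r]. *)
Lemma wint_gen x h I : 0 <= h -> wint x h I -> gen I (T h x - x).
Proof.
move=> h0 HI e e0.
have e2 : 0 < e / 2 by rewrite divr_gt0.
have [d1 d10 H1] := Tcont x e2; have [d2 d20 H2] := Tcontinuous x h0 e2.
exists (Num.min d1 d2); first by rewrite lt_min d10.
move=> r r0; rewrite le_min => /andP[rd1 rd2].
have [v vE] : exists v, v = T r I - I - r *: (T h x - x) by eexists.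
rewrite -vE; have [Phi [P0 cP dP Ph]] := HI v.
have [w Hw] := adjoint v (ltW r0); have [Psi [Q0 cQ dQ Qh]] := HI w.
have Er : ip (T r I) v = Phi (h + r) - Phi r.
  rewrite Hw (ipC ipH) Qh.
  apply: (@primitive_uniq Psi (fun s => Phi (s + r) - Phi r)
    (fun s => ip (T s x) w)) => //.
  - by rewrite add0r subrr Q0.
  - apply: contPD; last exact: contP_cst.
    move=> t t0 k k0; have [d d0 Hd] := cP (t + r) (addr_ge0 t0 (ltW r0)) k k0.
    exists d => // s s0 sd; apply: Hd; first by rewrite addr_ge0// ltW.
    by rewrite (addrC t) addrKA.
  - move=> t t0 k k0; have tr0 : 0 <= t + r by rewrite addr_ge0// ltW.
    have [d d0 Hd] := dP _ tr0 k k0; exists d => // s s0 sd.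
    rewrite (ipC ipH) -Hw -ip_TS ?(ltW r0)// (addrC r).
    have := Hd s s0 sd; rewrite (addrAC t).
    by rewrite (_ : Phi (t + s + r) - Phi r - (Phi (t + r) - Phi r) = Phi (t + s + r) - Phi (t + r))//; ring.
have : ip v v <= r * e * nrm v.
  rewrite {1}vE !ipE Er Ph.
  have hr : h <= h + r by rewrite lerDl ltW.
  have h1 : Phi (h + r) - Phi h <= (ip (T h x) v + e / 2 * nrm v) * (h + r - h).
    apply: (@rderiv_mv _ _ _ _ _ (fun t => ip (T t x) v) h0 hr cP (fun t tp _ => dP t (le_trans h0 tp))) => t th tr.
     rewrite -lerBlDl -ipBl// (le_trans (ip_le ipH _ _))//.
    rewrite ler_wpM2r ?nm_ge0// H2//; first exact: le_trans th.
    by rewrite ger0_norm ?subr_ge0//; lra.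
  have cN : contP (fun t => -1 * Phi t) by apply: contPM => //; exact: contP_cst.
  have h2 : -1 * Phi r - -1 * Phi 0 <= (- ip x v + e / 2 * nrm v) * (r - 0).
    apply: (@rderiv_mv _ _ _ _ _ (fun t => -1 * ip (T t x) v) (lexx _) (ltW r0) cN (fun t tp _ => rderivZ (-1) (dP t tp))) => t t0 tr.
     rewrite mulN1r -lerBlDl opprK addrC -ipBl// (le_trans (ip_le ipH _ _))//.
    rewrite ler_wpM2r ?nm_ge0// nmB// H1// (le_trans (ltW tr))//.
  have E1 : (ip (T h x) v + e / 2 * nrm v) * (h + r - h) =
    r * ip (T h x) v + r * (e / 2 * nrm v) by ring.
  have E2 : (- ip x v + e / 2 * nrm v) * (r - 0) = - (r * ip x v) + r * (e / 2 * nrm v) by ring.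
  have E3 : -1 * Phi r - -1 * Phi 0 = - Phi r by rewrite P0; ring.
  have E4 : r * e * nrm v = r * (e / 2 * nrm v) + r * (e / 2 * nrm v) by field.
  rewrite E1 in h1; rewrite E2 E3 in h2; rewrite E4 mulrBr.
  move: h1 h2; move: (Phi (h + r)) (Phi h) (Phi r) (r * ip (T h x) v) (r * ip x v) (r * (e / 2 * _)).
  by move=> *; lra.
have [v0|v0] := eqVneq (nrm v) 0; first by rewrite v0 mulr_ge0// ltW.
by rewrite -sqr_nm// expr2 ler_pM2r// lt0r v0 nm_ge0.
Qed.


Lemma gen0 : gen 0 0.
Proof.
move=> k k0; exists 1 => // h' h'0 _.
rewrite (@nm_ext _ 0); last by move=> z; rewrite !ipE ip_T0 ?(ltW h'0)//; ring.
by rewrite nm0// ltW// mulr_gt0.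
Qed.

Lemma genZ r x y : gen x y -> gen (r *: x) (r *: y).
Proof.
by move=> g; rewrite -[_ *: x]addr0 -[_ *: y]addr0; apply: gen_lin => //; exact: gen0.
Qed.

(** The averages of an orbit over [0, h] lie in the domain and tend to its start. *)
Lemma gen_dense x e : 0 < e -> exists x' y', gen x' y' /\ nrm (x - x') <= e.
Proof.
move=> e0; have [d d0 H] := wint_near x e0.
have [I HI] := wint_exists x (ltW d0).
have h := H d I d0 (lexx _) HI.
exists (d^-1 *: I), (d^-1 *: (T d x - x)); split.
  by apply: genZ; apply: wint_gen => //; exact: ltW.
rewrite -(ler_pM2l d0) -{1}(gtr0_norm d0) -nmZ// scalerBr scalerA divff ?scale1r ?lt0r_neq0//.
by rewrite nmB.
Qed.

Lemma contraction x t : 0 <= t -> nrm (T t x) <= nrm x.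
Proof.
move=> t0; have [K HK] := Tbnd t0.
rewrite leNgt; apply/negP => h.
have K0 : 0 < `|K| + 2 by rewrite ltr_wpDl.
pose e := (nrm (T t x) - nrm x) / (2 * (`|K| + 2)).
have e0 : 0 < e by rewrite divr_gt0 ?subr_gt0 ?mulr_gt0.
have [x' [y' [g hx]]] := gen_dense x e0.
have h1 := contraction_gen t0 g.
have h2 : nrm (T t x) <= nrm (T t x') + (`|K| + 1) * e.
  rewrite (le_trans (nm_subl ipH _ (T t x')))// lerD2l nm_TB// (le_trans (HK _))//.
  rewrite (@le_trans _ _ ((`|K| + 1) * nrm (x - x')))//.
    by rewrite ler_wpM2r ?nm_ge0// (le_trans (ler_norm _))// lerDl.
  by rewrite ler_wpM2l// addr_ge0.
have h3 : nrm x' <= nrm x + e by rewrite (le_trans (nm_subl ipH _ x))// lerD2l nmB.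
have h4 : (`|K| + 2) * e = (nrm (T t x) - nrm x) / 2 by rewrite /e; field; exact: lt0r_neq0.
have h5 : (`|K| + 2) * e = (`|K| + 1) * e + e by ring.
by move: h h1 h2 h3 h4 h5; move: ((`|K| + 1) * e) ((`|K| + 2) * e) => *; lra.
Qed.

Lemma contractionB x y t : 0 <= t -> nrm (T t x - T t y) <= nrm (x - y).
Proof. by move=> t0; rewrite nm_TB// contraction. Qed.

(** Closedness follows from T h x - x being the integral of T t y, a relation that
    passes to limits; it is used here as the mean value inequality for
    t -> <T t x, v>. *)
Lemma gen_closed x y :
  (forall e, 0 < e -> exists x' y', [/\ gen x' y', nrm (x' - x) <= e & nrm (y' - y) <= e]) ->
  gen x y.
Proof.
move=> H e e0; have e2 : 0 < e / 2 by rewrite divr_gt0.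
have [d d0 Hd] := Tcont y e2; exists d => // h h0 hd.
have [v vE] : exists v, v = T h x - x - h *: y by eexists.
rewrite -vE; have [v0|v0] := eqVneq (nrm v) 0; first by rewrite v0 mulr_ge0// ltW.
have vp : 0 < nrm v by rewrite lt0r v0 nm_ge0.
pose k := h * e / (2 * (h + 2)).
have h2 : 0 < h + 2 by rewrite addr_gt0.
have k0 : 0 < k by rewrite divr_gt0 ?mulr_gt0.
have [x' [y' [g hx hy]]] := H k k0.
have h1 : ip (T h x') v - ip (T 0 x') v <= (ip y v + (k + e / 2) * nrm v) * (h - 0).
  apply: (@rderiv_mv _ (fun t => ip (T t x') v) _ _ _ (fun t => ip (T t y') v) (lexx _) (ltW h0)).
  - exact: contP_ip.
  - by move=> t tp _; exact: rderiv_ip.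
  - move=> t tp th; rewrite -lerBlDl -ipBl// (le_trans (ip_le ipH _ _))//.
    rewrite ler_pM2r// (le_trans (nm_tri ipH _ (T t y) _))// lerD//.
      by rewrite (le_trans (contractionB _ _ tp)).
    by rewrite Hd// (le_trans (ltW th)).
have h3 : ip (T h x) v - ip (T h x') v <= k * nrm v.
  rewrite -ipBl// (le_trans (ip_le ipH _ _))// ler_pM2r//.
  by rewrite (le_trans (contractionB _ _ (ltW h0)))// nmB.
have h4 : ip x' v - ip x v <= k * nrm v.
  by rewrite -ipBl// (le_trans (ip_le ipH _ _))// ler_pM2r.
have : ip v v <= h * e * nrm v.
  rewrite {1}vE !ipE.
  have E0 : ip (T 0 x') v = ip x' v by apply: (ip_eq ipH); exact: T0.
  have E1 : (ip y v + (k + e / 2) * nrm v) * (h - 0) =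
    h * ip y v + (h * k + h * e / 2) * nrm v by field.
  have E2 : h * e * nrm v = (h * k + h * e / 2) * nrm v + 2 * (k * nrm v).
    by rewrite /k; field; exact: lt0r_neq0.
  rewrite E0 E1 in h1; rewrite E2.
  by move: h1 h3 h4; move: (h * ip y v) (_ * nrm v) (k * nrm v) => *; lra.
by rewrite -sqr_nm// expr2 ler_pM2r.
Qed.

Definition isom x := forall t, 0 <= t -> nrm (T t x) = nrm x.

(** The form |z|^2 - |T t z|^2 is positive semidefinite, so a vector on which it
    vanishes is in its radical. *)
Lemma isom_ip x y t : isom x -> 0 <= t -> ip (T t x) (T t y) = ip x y.
Proof.
move=> Ix t0; apply/eqP; rewrite -subr_eq0; apply/eqP.
pose c := ip (T t x) (T t y) - ip x y; rewrite -/c.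
pose a := ip y y - ip (T t y) (T t y).
have a0 : 0 <= a by rewrite subr_ge0 -!sqr_nm// ler_pXn2r ?nnegrE ?nm_ge0 ?contraction.
have H r : 0 <= a - 2 * c * r.
  have := contraction (r *: x + y) t0.
  rewrite -(ler_pXn2r (ltn0Sn 1)) ?nnegrE ?nm_ge0// !sqr_nm// ip_Tlin//.
  rewrite !(ipC ipH (T t x)) !(ipC ipH (T t y)) !ip_Tlin// !ipE.
  have := Ix t t0; move/(congr1 (fun u => u ^+ 2)); rewrite !sqr_nm// => E.
  rewrite E (ipC ipH (T t y) (T t x)) (ipC ipH y x) /a /c => h.
  by lra.
apply/eqP/negPn/negP => c0; have := H ((a + 1) / (2 * c)).
by rewrite (_ : a - _ = -1); [lra|field].
Qed.

Lemma isom_lin r x y : isom x -> isom y -> isom (r *: x + y).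
Proof.
move=> Ix Iy t t0; rewrite /nm; congr Num.sqrt.
by rewrite ip_Tlin// !(ipC ipH _ (T t (_ + _))) !ip_Tlin// !ipE !isom_ip// (ipC ipH y x); ring.
Qed.

Lemma isom_T x s : 0 <= s -> isom x -> isom (T s x).
Proof. by move=> s0 Ix t t0; rewrite -nm_TD// Ix ?Ix// addr_ge0. Qed.

Lemma isom_closed x :
  (forall e, 0 < e -> exists2 x', isom x' & nrm (x' - x) <= e) -> isom x.
Proof.
move=> H t t0; apply/eqP; rewrite eq_le contraction//= leNgt; apply/negP => h.
pose e := (nrm x - nrm (T t x)) / 4.
have e0 : 0 < e by rewrite divr_gt0 ?subr_gt0.
have [x' Ix hx] := H e e0.
have h1 := nm_subl ipH x x'; have h2 := nm_subl ipH (T t x') (T t x).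
have h3 := contractionB x' x t0; rewrite (Ix t t0) in h2.
by rewrite nmB// in h1; move: h h1 h2 h3 hx; rewrite /e => *; lra.
Qed.

Lemma isom_wint x h I : 0 <= h -> isom x -> wint x h I -> isom I.
Proof.
move=> h0 Ix HI t t0; rewrite /nm; congr Num.sqrt.
have [w Hw] := adjoint (T t I) t0.
rewrite Hw (ipC ipH).
have [Phi [P0 cP dP ->]] := HI w; have [Psi [Q0 cQ dQ ->]] := HI I.
apply: (@primitive_uniq _ _ (fun s => ip (T s x) I)) => // [|s s0]; first by rewrite P0.
by rewrite -(isom_ip _ (isom_T s0 Ix) t0) Hw (ipC ipH); exact: dP.
Qed.

Lemma isom0 : isom 0.
Proof. by move=> t t0; apply: nm_ext => z; rewrite ip_T0// ip0l. Qed.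

Lemma isomZ r x : isom x -> isom (r *: x).
Proof. by move=> Ix; rewrite -[_ *: x]addr0; apply: isom_lin => //; exact: isom0. Qed.

Lemma isom_gen x y : isom x -> gen x y -> isom y.
Proof.
move=> Ix g; apply: isom_closed => e e0; have [d d0 H] := g e e0.
exists (d^-1 *: (T d x - x)); last first.
  rewrite -(ler_pM2l d0) -{1}(gtr0_norm d0) -nmZ// scalerBr scalerA divff ?scale1r ?lt0r_neq0//.
  exact: H.
have -> : d^-1 *: (T d x - x) = d^-1 *: T d x + (- d^-1) *: x.
  by rewrite scalerBr scaleNr.
apply: isom_lin; first by apply: isom_T => //; exact: ltW.
exact: isomZ.
Qed.

Lemma isom_gen_ip0 x y : isom x -> gen x y -> ip x y = 0.
Proof.
move=> Ix g; have H := rderiv_sq (lexx 0) g.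
have E t : 0 <= t -> ip (T t x) (T t x) = ip x x.
  by move=> t0; rewrite isom_ip.
have E0 : ip (T 0 x) (T 0 y) = ip x y by rewrite isom_ip.
apply/eqP; rewrite -normr_le0 leNgt; apply/negP => c0.
have [d d0 Hd] := H _ c0; have := Hd d d0 (lexx _).
rewrite add0r !E ?(ltW d0)// E0 subrr sub0r normrN normrM (gtr0_norm d0) ler_pM2l//.
by rewrite normrM ger0_norm//; lra.
Qed.

(** The norm is constant along isometric orbits; polarise the derivative. *)
Lemma isom_skew x y z w : isom x -> gen x y -> isom z -> gen z w ->
  ip y z + ip x w = 0.
Proof.
move=> Ix gx Iz gz; have := isom_gen_ip0 (isom_lin 1 Ix Iz) (gen_lin 1 gx gz).
rewrite !ipE !mul1r (isom_gen_ip0 Ix gx) (isom_gen_ip0 Iz gz) (ipC ipH y z) => h.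
by lra.
Qed.

Variable U : set_system nat.
Hypothesis Ultra : UltraFilter U.
Hypothesis cofinU : \oo `<=` U.
Hypothesis precompact : forall x y : nat -> W,
  (exists C, forall n, nrm (x n) <= C /\ nrm (y n) <= C) ->
  (forall n, gen (x n) (y n)) ->
  forall e, 0 < e -> exists2 A, U A & forall m n, A m -> A n -> nrm (x m - x n) <= e.

Let U_ne (A : set nat) : U A -> exists n, A n.
Proof. by move=> UA; have [n An] := @filter_ex _ U _ A UA; exists n. Qed.

Let UI (A B : set nat) : U A -> U B -> U (A `&` B).
Proof. exact: filterI. Qed.

Let U_ge (N : nat) : U [set n | (N <= n)%N].
Proof. by apply: cofinU; exists N. Qed.

Definition ucauchy (f : nat -> W) := forall e, 0 < e ->
  exists2 A, U A & forall m n, A m -> A n -> nrm (f m - f n) <= e.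
Definition ulim (f : nat -> W) x := forall e, 0 < e ->
  exists2 A, U A & forall n, A n -> nrm (f n - x) <= e.

(** A nested sequence of sets of the ultrafilter yields an ordinary Cauchy sequence. *)
Lemma ucauchy_lim f : ucauchy f -> exists x, ulim f x.
Proof.
move=> us.
have p n : 0 < 2^-1 ^+ n :> R by rewrite exprn_gt0// invr_gt0.
have /choice[A HA] (k : nat) : exists A : set nat, U A /\
    forall m n, A m -> A n -> nrm (f m - f n) <= 2^-1 ^+ k.
  by have [A UA H] := us _ (p k); exists A.
pose B := fix B k := if k is k'.+1 then B k' `&` A k else A 0%N.
have UB k : U (B k).
  by elim: k => [|k IH] /=; [have [] := HA 0%N|apply: UI => //; have [] := HA k.+1].
have BA i k : (i <= k)%N -> B k `<=` A i.
  elim: k => [|k IH]; first by rewrite leqn0 => /eqP ->.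
  by rewrite leq_eqVlt => /predU1P[->|/IH h] n [] //= /h.
have /choice[i Hi] (k : nat) : exists n, B k n by apply: U_ne.
have [|x Hx] := complete (s := f \o i).
  move=> e e0; have [N HN] := half_small 1 e0; exists N => m n Nm Nn /=.
  rewrite (@le_trans _ _ (2^-1 ^+ N))//; last by rewrite -[leLHS]mul1r HN.
  have [_ H] := HA N.
  by apply: H; [apply: BA Nm _ (Hi _)|apply: BA Nn _ (Hi _)].
exists x => e e0; have e2 : 0 < e / 2 by rewrite divr_gt0.
have [N1 H1] := Hx _ e2; have [N2 H2] := half_small 1 e2.
pose N := maxn N1 N2; exists (A N); first by have [] := HA N.
move=> n An; rewrite (le_trans (nm_tri ipH _ (f (i N)) _))//.
have [_ H] := HA N.
have h1 : nrm (f n - f (i N)) <= 2^-1 ^+ N by apply: H => //; apply: BA (leqnn _) _ (Hi _).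
have h2 := H1 N (leq_maxl _ _); have h3 := H2 N (leq_maxr _ _).
rewrite mul1r in h3; rewrite /= in h2; rewrite (le_trans (lerD (le_trans h1 h3) h2))//.
by lra.
Qed.

Lemma ulim_nm f x : ulim f x -> forall e, 0 < e ->
  exists2 A, U A & forall n, A n -> `|nrm (f n) - nrm x| <= e.
Proof.
move=> fx e e0; have [A UA HA] := fx e e0; exists A => // n An.
by rewrite (le_trans (nm_dist ipH _ _))// HA.
Qed.

Lemma gen_ulim f g x y : (forall n, gen (f n) (g n)) -> ulim f x -> ulim g y -> gen x y.
Proof.
move=> fg fx gy; apply: gen_closed => e e0.
have [A UA HA] := fx e e0; have [B UB HB] := gy e e0.
have [n [An Bn]] := U_ne (UI UA UB).
by exists (f n), (g n); split; [exact: fg|exact: HA|exact: HB].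
Qed.

Lemma isom_ulim f x : (forall n, isom (f n)) -> ulim f x -> isom x.
Proof.
move=> If fx; apply: isom_closed => e e0; have [A UA HA] := fx e e0.
by have [n An] := U_ne UA; exists (f n); [exact: If|exact: HA].
Qed.

(** The orbit of a domain point is precompact, since its graph norm decreases.
    Along a limit point z the norm equals the limit of |T t x|, and so does the norm
    of T t z: hence z has an isometric orbit. *)
Lemma omega_limit x y : gen x y -> exists z, isom z /\
  forall t, 0 <= t -> nrm z <= nrm (T t x) /\
  forall e, 0 < e -> exists2 t, 0 <= t & nrm (T t x) <= nrm z + e.
Proof.
move=> g.
have n0 n : 0 <= n%:R :> R by [].
have mono s t : 0 <= s -> 0 <= t -> nrm (T (s + t) x) <= nrm (T t x).
  by move=> s0 t0; rewrite nm_TD// contraction.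
have [|z Hz] := @ucauchy_lim (fun n => T n%:R x).
  apply: (@precompact _ (fun n => T n%:R y)).
    exists (nrm x + nrm y) => n; split; rewrite (le_trans (contraction _ (n0 n)))//.
      by rewrite lerDl nm_ge0.
    by rewrite lerDr nm_ge0.
  by move=> n; apply: gen_T.
have near_z (t : R) e : 0 <= t -> 0 < e -> exists2 n : nat, t <= n%:R & `|nrm (T n%:R x) - nrm z| <= e.
  move=> t0 e0; have [A UA HA] := ulim_nm Hz e0.
  have [n [An /= tn]] := U_ne (UI UA (U_ge (Num.truncn t).+1)).
  exists n; last exact: HA.
  by rewrite (@le_trans _ _ (Num.truncn t).+1%:R) ?ler_nat// ltW// truncnS_gt.
have low t : 0 <= t -> nrm z <= nrm (T t x).
  move=> t0; rewrite leNgt; apply/negP => h.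
  have e0 : 0 < (nrm z - nrm (T t x)) / 2 by rewrite divr_gt0 ?subr_gt0.
  have [n tn] := near_z t _ t0 e0; rewrite ler_norml => /andP[h1 _].
  have := mono (n%:R - t) t; rewrite subr_ge0 subrK => /(_ tn t0).
  by move: h h1; lra.
exists z; split; last first.
  move=> t t0; split; [exact: low|move=> e e0].
  have [n _] := near_z 0 e (lexx _) e0; rewrite ler_norml => /andP[_ h].
  by exists n%:R => //; lra.
move=> t t0; apply/eqP; rewrite eq_le contraction//= leNgt; apply/negP => h.
pose e := (nrm z - nrm (T t z)) / 2.
have e0 : 0 < e by rewrite divr_gt0 ?subr_gt0.
have [A UA HA] := Hz e e0; have [n An] := U_ne UA.
have h1 := low (t + n%:R) (addr_ge0 t0 (n0 n)); rewrite nm_TD// in h1.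
have h2 := nm_subl ipH (T t (T n%:R x)) (T t z).
have h3 := contractionB (T n%:R x) z t0; have h4 := HA n An.
by move: h h1 h2 h3 h4; rewrite /e; lra.
Qed.

Hypothesis no_kernel : forall x, gen x 0 -> nrm x = 0.
Hypothesis no_oscillation : forall x y (m : R), 0 < m ->
  gen x y -> gen y (- m ^+ 2 *: x) -> nrm x = 0.

(** On the isometric part the generator G is skew and has precompact graph balls, so
    the infimum m^2 of |G u|^2 over unit vectors is attained: minimising sequences
    converge in the graph norm by the parallelogram identity. At a minimiser
    <G u, G z> = m^2 <u, z> for all z, so T s u stays in the plane of u and G u
    and rotates with frequency m. Hence G (G u) = - m^2 u, which is excluded. *)
Lemma isom_gen_trivial x y : isom x -> gen x y -> nrm x = 0.
Proof.
move=> Ix g; apply/eqP/negPn/negP => x0.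
have normalized u v : isom u -> gen u v -> nrm u != 0 ->
    [/\ isom ((nrm u)^-1 *: u), gen ((nrm u)^-1 *: u) ((nrm u)^-1 *: v) &
        ip ((nrm u)^-1 *: u) ((nrm u)^-1 *: u) = 1].
  move=> Iu gu u0; split; [exact: isomZ|exact: genZ|].
  by rewrite !ipE -sqr_nm//; field.
pose E := [set a | exists u v, [/\ isom u, gen u v, ip u u = 1 & a = ip v v]].
have E0 : lbound E 0 by move=> _ [u [v [_ _ _ ->]]]; exact: ip_ge0.
have hE : has_inf E.
  split; last by exists 0.
  have [a1 a2 a3] := normalized _ _ Ix g x0.
  by exists (ip ((nrm x)^-1 *: y) ((nrm x)^-1 *: y)), ((nrm x)^-1 *: x), ((nrm x)^-1 *: y).
pose m2 := inf E.
have m20 : 0 <= m2 by apply: lb_le_inf => //; case: hE.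
have m2_le u v : isom u -> gen u v -> 0 <= ip v v - m2 * ip u u.
  move=> Iu gu; rewrite subr_ge0; have [u0|u0] := eqVneq (nrm u) 0.
    by have := u0; rewrite -nm_null// => ->; rewrite mulr0 ip_ge0.
  have up : 0 < nrm u by rewrite lt0r u0 nm_ge0.
  rewrite -sqr_nm// -ler_pdivlMr ?exprn_gt0//.
  apply: ge_inf; first by case: hE.
  have [a1 a2 a3] := normalized _ _ Iu gu u0.
  exists ((nrm u)^-1 *: u), ((nrm u)^-1 *: v); split=> //.
  by rewrite !ipE; field.
have p n : 0 < 2^-1 ^+ n :> R by rewrite exprn_gt0// invr_gt0.
have /choice[uv Huv] (n : nat) : exists uv : W * W, [/\ isom uv.1, gen uv.1 uv.2,
    ip uv.1 uv.1 = 1 & ip uv.2 uv.2 <= m2 + 2^-1 ^+ n].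
  have [_ [u [v [Iu gu u1 ->]]] h] := inf_adherent (p n) hE.
  by exists (u, v); split=> //; exact: ltW.
pose f n := (uv n).1; pose f' n := (uv n).2.
have If n : isom (f n) by have [] := Huv n.
have gf n : gen (f n) (f' n) by have [] := Huv n.
have f1 n : ip (f n) (f n) = 1 by have [] := Huv n.
have f2 n : ip (f' n) (f' n) <= m2 + 2^-1 ^+ n by have [] := Huv n.
have cf : ucauchy f.
  apply: (precompact _ gf); exists (m2 + 2) => n; split.
    by rewrite /nm f1 sqrtr1; lra.
  rewrite -(ler_pXn2r (ltn0Sn 1)) ?nnegrE ?nm_ge0 ?addr_ge0// sqr_nm// (le_trans (f2 n))//.
  have : 2^-1 ^+ n <= 1 :> R by rewrite exprn_ile1 ?invr_ge0 ?invf_le1 ?ler1n.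
  have := sqr_ge0 m2; rewrite sqrrD; lra.
(* the mean of f a and f c has norm close to 1, hence an image of norm at least
   close to m, and the images of f a and f c must be close to each other *)
have cf' : ucauchy f'.
  move=> e e0.
  have e10 : 0 < e ^+ 2 / 2 by rewrite divr_gt0 ?exprn_gt0.
  pose k := Num.min 1 (e ^+ 2 / (2 * (m2 + 1))).
  have m21 : 0 < m2 + 1 by rewrite ltr_wpDl.
  have k0 : 0 < k by rewrite lt_min ltr01 divr_gt0 ?exprn_gt0 ?mulr_gt0.
  have [A UA HA] := cf k k0; have [N HN] := half_small 4 e10.
  exists (A `&` [set n | (N <= n)%N]); first by apply: UI.
  move=> a c [Aa /= Na] [Ac /= Nc].
  rewrite -(ler_pXn2r (ltn0Sn 1)) ?nnegrE ?nm_ge0 ?(ltW e0)// sqr_nm//.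
  have h1 := m2_le _ _ (isom_lin 1 (If a) (If c)) (gen_lin 1 (gf a) (gf c)).
  have h2 := parallelogram ipH (f a) (f c); have h3 := parallelogram ipH (f' a) (f' c).
  have h4 : m2 * ip (f a - f c) (f a - f c) <= e ^+ 2 / 2.
    rewrite -sqr_nm//; apply: (@le_trans _ _ ((m2 + 1) * k)); last first.
      apply: (@le_trans _ _ ((m2 + 1) * (e ^+ 2 / (2 * (m2 + 1))))).
        by rewrite ler_pM2l// ge_min lexx orbT.
      by rewrite le_eqVlt; apply/orP; left; apply/eqP; field; exact: lt0r_neq0.
    rewrite ler_pM ?sqr_ge0 ?lerDl// (@le_trans _ _ (k ^+ 2))//.
      by rewrite ler_pXn2r ?nnegrE ?nm_ge0 ?(ltW k0)// HA.
    by rewrite expr2 -[leRHS]mulr1 ler_pM2l// ge_min lexx.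
  rewrite !scale1r in h1; rewrite h2 in h4; rewrite h3.
  rewrite !f1 in h4.
  have := f2 a; have := f2 c; have := HN _ Na; have := HN _ Nc.
  move: h1 h4; rewrite !mulrDr mulrN; move: (m2 * ip _ _) (ip (f' a) _) (ip (f' c) _) => *; lra.
have [u Hu] := ucauchy_lim cf; have [v Hv] := ucauchy_lim cf'.
have Iu := isom_ulim If Hu; have gu := gen_ulim gf Hu Hv.
have nu : nrm u = 1.
  apply/eqP; rewrite -subr_eq0 -normr_le0 leNgt; apply/negP => e0.
  have e2 : 0 < `|nrm u - 1| / 2 by rewrite divr_gt0.
  have [A UA HA] := ulim_nm Hu e2; have [n An] := U_ne UA.
  by have := HA n An; rewrite {1}/nm f1 sqrtr1 distrC; lra.
have u1 : ip u u = 1 by rewrite -sqr_nm// nu expr1n.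
have v2 : ip v v = m2.
  apply/eqP; rewrite eq_le; apply/andP; split; last first.
    by have := m2_le _ _ Iu gu; rewrite u1 mulr1 subr_ge0.
  rewrite leNgt; apply/negP => h; pose d := ip v v - m2.
  have d0 : 0 < d by rewrite subr_gt0.
  pose K := 2 * nrm v + 1; have K0 : 0 < K by rewrite ltr_wpDl// mulr_ge0 ?nm_ge0.
  have e0 : 0 < Num.min 1 (d / (4 * K)) by rewrite lt_min ltr01 divr_gt0 ?mulr_gt0.
  have [A UA HA] := Hv _ e0; have d20 : 0 < d / 2 by rewrite divr_gt0.
  have [N HN] := half_small 1 d20.
  have [n [An /= Nn]] := U_ne (UI UA (U_ge N)).
  have h1 := HA n An; have h2 := HN n Nn; have h3 := f2 n; rewrite mul1r in h2.
  have h4 : nrm (f' n - v) <= d / (4 * K) by rewrite (le_trans h1)// ge_min lexx orbT.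
  have E1 : ip v v = ip (f' n) (f' n) - 2 * ip v (f' n - v) - ip (f' n - v) (f' n - v).
    by rewrite !ipE (ipC ipH v (f' n)); ring.
  have h5 := ip_CS ipH v (f' n - v); rewrite ler_norml in h5; case/andP: h5 => h5 _.
  have h6 := ip_ge0 ipH (f' n - v).
  have h7 : 2 * (nrm v * nrm (f' n - v)) <= d / 4.
    rewrite mulrA (@le_trans _ _ (K * (d / (4 * K))))//.
      by rewrite ler_pM ?mulr_ge0 ?nm_ge0// lerDl.
    by rewrite le_eqVlt; apply/orP; left; apply/eqP; field; exact: lt0r_neq0.
  by move: h2 h3 E1 h5 h6 h7; rewrite /d; move: (nrm v * _) (ip v (_ - v)) => *; lra.
(* by minimality u is in the radical of the form <G z, G z> - m2 <z, z> *)
have rad z w : isom z -> gen z w -> ip v w = m2 * ip u z.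
  move=> Iz gz; apply/eqP; rewrite -subr_eq0; apply/eqP.
  apply: (@quad_ge0 _ (ip w w - m2 * ip z z)) => r.
  have := m2_le _ _ (isom_lin r Iz Iu) (gen_lin r gz gu).
  rewrite !ipE u1 v2 (ipC ipH z u) (ipC ipH w v) => h.
  by apply: le_trans h _; rewrite le_eqVlt; apply/orP; left; apply/eqP; ring.
have Iv := isom_gen Iu gu.
have [m2z|m2n] := eqVneq m2 0.
  have v0 : nrm v = 0 by apply/(nm_null ipH); rewrite v2.
  have : nrm u = 0.
    apply: no_kernel; apply: gen_null gu; rewrite ?subrr ?nm0// subr0//.
  by rewrite nu => /eqP; rewrite oner_eq0.
pose m := Num.sqrt m2; have m0 : 0 < m by rewrite sqrtr_gt0 lt0r m2n.
have mm : m ^+ 2 = m2 by rewrite sqr_sqrtr.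
(* with phi r the inner product of T r u with the rotated vector, phi' = 0 by the
   radical property and skewness; so phi = 1 and the two unit vectors agree *)
have orbit s : 0 <= s -> nrm (T s u - (cos (m * s) *: u + (sin (m * s) / m) *: v)) = 0.
  move=> s0.
  pose phi r := cos (m * r) * ip (T r u) u + sin (m * r) / m * ip (T r u) v.
  have phi1 : 1 <= phi s.
    have dcos r : is_derive r (1 : R) (fun r : R => cos (m * r)) (- (m * sin (m * r))).
      have -> : (fun r : R => cos (m * r)) = cos \o ( *%R m) by [].
      by apply: is_derive_eq; rewrite /GRing.scale /= mulr1; ring.
    have dsin r : is_derive r (1 : R) (fun r : R => sin (m * r) / m) (cos (m * r)).
      have -> : (fun r : R => sin (m * r) / m) = m^-1 *: (sin \o ( *%R m)).
        by apply/funext => q; rewrite mulrC.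
      by apply: is_derive_eq; rewrite /GRing.scale /= mulr1; field; exact: lt0r_neq0.
    have contP_derive (h h' : R -> R) : (forall r, is_derive r (1 : R) h (h' r)) -> contP h.
      move=> dh; apply: continuous_contP => r _; apply: differentiable_continuous.
      by apply/derivable1_diffP; have [] := dh r.
    have cphi : contP phi.
      by apply: contPD; apply: contPM; (exact: contP_ip || exact: contP_derive).
    have dphi r : 0 <= r -> rderiv phi r 0.
      move=> r0; have h1 := rderivM (rderiv_is_derive (dcos r)) (rderiv_ip u r0 gu).
      have h2 := rderivM (rderiv_is_derive (dsin r)) (rderiv_ip v r0 gu).
      have := rderivD h1 h2; rewrite (_ : _ + _ = 0)//.
      have := isom_skew (isom_T r0 Iu) (gen_T r0 gu) Iu gu.
      have := rad _ _ (isom_T r0 Iu) (gen_T r0 gu).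
      rewrite (ipC ipH v) (ipC ipH u (T r u)) -mm => -> /eqP; rewrite addr_eq0 => /eqP ->.
      by field; exact: lt0r_neq0.
    have cN : contP (fun r => -1 * phi r) by apply: contPM => //; exact: contP_cst.
    have := @rderiv_mv _ (fun r => -1 * phi r) 0 0 s (fun=> -1 * 0) (lexx _) s0 cN
      (fun q qp _ => rderivZ (-1) (dphi q qp)).
    have -> : phi 0 = 1.
      by rewrite /phi mulr0 cos0 sin0 !mul0r addr0 mul1r (ip_eq ipH _ (T0 u)).
    by rewrite mulr0 mul0r => H; have := H (fun _ _ _ => lexx 0); lra.
  apply/(nm_null ipH).
  have Es : ip (T s u) (T s u) = 1 by rewrite isom_ip.
  have uv0 : ip u v = 0 by exact: isom_gen_ip0.
  have cs : cos (m * s) ^+ 2 + sin (m * s) ^+ 2 = 1 by rewrite cos2Dsin2.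
  apply/eqP; rewrite eq_le ip_ge0// andbT.
  rewrite (_ : ip _ _ = 1 - 2 * phi s + (cos (m * s) ^+ 2 + sin (m * s) ^+ 2)).
    by rewrite cs; lra.
  rewrite /phi !ipE (ipC ipH _ (T s u)) (ipC ipH v (T s u)) (ipC ipH v u) uv0 Es u1 v2 -mm.
  by field; exact: lt0r_neq0.
(* at a quarter of the period the orbit of u passes through G u / m, so that G u
   is in the domain *)
pose s := pi / 2 / m.
have s0 : 0 <= s by rewrite !divr_ge0 ?pi_ge0// ltW.
have ms : m * s = pi / 2 by rewrite /s; field; exact: lt0r_neq0.
have := orbit s s0; rewrite ms cos_pihalf sin_pihalf scale0r add0r div1r => Tsu.
have gv : gen v (m *: T s v).
  have gT := genZ m (gen_T s0 gu).
  apply: gen_null gT; last by rewrite subrr nm0.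
  rewrite (@nm_ext _ (m *: (T s u - m^-1 *: v))); first by rewrite nmZ// Tsu mulr0.
  by move=> z; rewrite !ipE; field; exact: lt0r_neq0.
have gv2 : gen v (- m ^+ 2 *: u).
  apply: (gen_null _ _ gv); first by rewrite subrr nm0.
  apply/(nm_null ipH).
  have h1 := isom_skew Iv gv Iu gu.
  have h2 : ip (m *: T s v) (m *: T s v) = m2 ^+ 2.
    by rewrite !ipE isom_ip// v2 -mm; ring.
  have h3 : ip (m *: T s v) u = - m2 by rewrite -v2; lra.
  move: h2 h3; move: (m *: T s v) => w h2 h3.
  by rewrite !ipE (ipC ipH u w) h2 h3 u1 mm; ring.
have := no_oscillation m0 gu gv2; rewrite nu => /eqP; rewrite oner_eq0.
by [].
Qed.

(** Averages of a limit point z of the orbit of a domain point are isometric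
    and in the domain, hence null; so z is null. Domain points are dense. *)
Theorem strong_stability x : 
  (forall t, 0 <= t -> nrm (T t x) <= nrm x) /\
  forall e, 0 < e -> exists2 t0, 0 <= t0 & forall t, t0 <= t -> nrm (T t x) <= e.
Proof.
split=> [t|e e0]; first exact: contraction.
have e2 : 0 < e / 2 by rewrite divr_gt0.
have [x' [y' [g hx]]] := gen_dense x e2.
have [z [Iz Hz]] := omega_limit g.
have z0 : nrm z = 0.
  apply: (@nm_le0 _ _ _ _ 1) => k k0; rewrite mulr1.
  have [d d0 H] := wint_near z k0; have [I HI] := wint_exists z (ltW d0).
  have := H d I d0 (lexx _) HI.
  have I0 := isom_gen_trivial (isom_wint (ltW d0) Iz HI) (wint_gen (ltW d0) HI).
  move=> h; rewrite -(ler_pM2l d0) -{1}(gtr0_norm d0) -nmZ// -nmN//.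
  by rewrite (le_trans (nm_subl ipH _ (- I)))// nmN// I0 add0r opprK addrC.
have [_ /(_ _ e2)[t0 t00 Ht0]] := Hz 0 (lexx _); rewrite z0 add0r in Ht0.
exists t0 => // t tt; have tp := le_trans t00 tt.
rewrite (le_trans (nm_subl ipH _ (T t x')))//.
rewrite (_ : e = e / 2 + e / 2); last by field.
rewrite lerD// ?(le_trans (contractionB _ _ tp))//.
by rewrite -(subrK t0 t) nm_TD ?subr_ge0// (le_trans (contraction _ _)) ?subr_ge0.
Qed.

End Semigroup.

(** * Integrals over an open interval *)

Section IntegralOnInterval.
Context {R : realType}.
Notation mu := (@lebesgue_measure R).
Implicit Types (a b c d x y : R) (f g h F G : R -> R).

Definition ig a b f := mu.-integrable `]a, b[ (EFin \o f).
Definition int a b f : R := \int[mu]_(x in `]a, b[) f x.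
Definition aeq a b f g := {ae mu, forall x, x \in `]a, b[ -> f x = g x}.

Lemma ig_meas a b f : ig a b f -> measurable_fun `]a, b[ f.
Proof. by move=> /measurable_int /measurable_EFinP. Qed.

Lemma igD a b f g : ig a b f -> ig a b g -> ig a b (fun x => f x + g x).
Proof. by move=> hf hg; apply: (@integrableD _ _ _ mu _ _ (EFin \o f) (EFin \o g)). Qed.

Lemma igZ a b k f : ig a b f -> ig a b (fun x => k * f x).
Proof. by move=> hf; apply: (@integrableZl _ _ _ mu _ _ k (EFin \o f)). Qed.

Lemma ig_abs a b f : ig a b f -> ig a b (fun x => `|f x|).
Proof. by move=> hf; apply: (@integrable_norm _ _ _ mu _ f). Qed.

Lemma ig_le a b f g : measurable_fun `]a, b[ f -> ig a b g ->
  (forall x, x \in `]a, b[ -> `|f x| <= g x) -> ig a b f.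
Proof.
move=> mf ig fg; apply: (le_integrable _ _ _ ig) => //.
  exact/measurable_EFinP.
by move=> x xab /=; rewrite lee_fin (le_trans (fg _ xab))// ler_norm.
Qed.

Lemma ig_bounded a b f K : measurable_fun `]a, b[ f ->
  (forall x, x \in `]a, b[ -> `|f x| <= K) -> ig a b f.
Proof.
move=> mf fK; apply: measurable_bounded_integrable => //.
  rewrite [X in (X < _)%E]lebesgue_measure_itv/=.
  by case: ifP => _; rewrite -?EFinB ltry.
exists K; split; first exact: num_real.
by move=> M KM x /= xab; rewrite (le_trans (fK _ xab))// ltW.
Qed.

Lemma ig_cst a b k : ig a b (fun=> k).
Proof. by apply: (@ig_bounded _ _ _ `|k|). Qed.

Lemma ig_ext a b f g : (forall x, x \in `]a, b[ -> f x = g x) -> ig a b f -> ig a b g.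
Proof.
move=> fg; apply: eq_integrable => // x; rewrite inE/= => xab.
by rewrite fg.
Qed.

Lemma itv_sub a b c d : a <= c -> d <= b -> `]c, d[%classic `<=` `]a, b[%classic.
Proof. by move=> ac db; apply: subset_itv; rewrite bnd_simp. Qed.

Lemma ig_sub a b c d f : a <= c -> d <= b -> ig a b f -> ig c d f.
Proof. by move=> ac db; apply: integrableS => //; exact: itv_sub. Qed.

Lemma intD a b f g : ig a b f -> ig a b g ->
  int a b (fun x => f x + g x) = int a b f + int a b g.
Proof. by move=> hf hg; rewrite /int RintegralD. Qed.

Lemma intZ a b k f : ig a b f -> int a b (fun x => k * f x) = k * int a b f.
Proof. by move=> hf; rewrite /int RintegralZl. Qed.

Lemma intB a b f g : ig a b f -> ig a b g ->
  int a b (fun x => f x - g x) = int a b f - int a b g.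
Proof. by move=> hf hg; rewrite /int RintegralB. Qed.

Lemma int_le a b f g : ig a b f -> ig a b g ->
  (forall x, x \in `]a, b[ -> f x <= g x) -> int a b f <= int a b g.
Proof.
move=> hf hg fg; apply: le_Rintegral => // x xab.
Qed.

Lemma int_ge0 a b f : (forall x, x \in `]a, b[ -> 0 <= f x) -> 0 <= int a b f.
Proof. by move=> f0; apply: Rintegral_ge0 => x xab; apply: f0. Qed.

Lemma int_abs a b f : ig a b f -> `|int a b f| <= int a b (fun x => `|f x|).
Proof. by move=> hf; apply: le_normr_Rintegral. Qed.

Lemma int_ext a b f g : (forall x, x \in `]a, b[ -> f x = g x) -> int a b f = int a b g.
Proof. by move=> fg; apply: eq_Rintegral => x; rewrite inE => /fg. Qed.

Lemma int_cst a b k : a <= b -> int a b (fun=> k) = k * (b - a).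
Proof.
move=> ab; rewrite /int Rintegral_cst//= lebesgue_measure_itv/=.
rewrite lte_fin; case: ltP => [_|ba]; first by rewrite -EFinB.
by rewrite (le_anti (introT andP (conj ab ba))) subrr !mulr0.
Qed.

Lemma int_empty a b f : b <= a -> int a b f = 0.
Proof. by move=> ba; rewrite /int set_itv_ge ?bnd_simp -?leNgt// Rintegral_set0. Qed.

Lemma int_split a b c f : a <= c -> c <= b -> ig a b f ->
  int a b f = int a c f + int c b f.
Proof.
move=> ac cb hf.
have := @Rintegral_itvB _ f (BRight a) (BLeft b) c hf.
rewrite !bnd_simp => /(_ ac).
move: cb; rewrite le_eqVlt => /predU1P[->|cb].
  by rewrite (int_empty _ (lexx b)) addr0.
rewrite cb => /(_ isT) /eqP; rewrite subr_eq => /eqP; rewrite /int => ->.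
rewrite addrC -Rintegral_itv_bndo_bndc//.
by apply: integrableS hf => //; apply: subset_itvl; rewrite bnd_simp ltW.
Qed.

Lemma ae_map (P Q : R -> Prop) : (forall x, P x -> Q x) ->
  {ae mu, forall x, P x} -> {ae mu, forall x, Q x}.
Proof. exact: (@filterS _ _ (ae_filter_ringOfSetsType mu)). Qed.

Lemma ae_and (P Q : R -> Prop) : {ae mu, forall x, P x} -> {ae mu, forall x, Q x} ->
  {ae mu, forall x, P x /\ Q x}.
Proof. exact: (@filterI _ _ (ae_filter_ringOfSetsType mu)). Qed.

Lemma aeq_refl a b f : aeq a b f f.
Proof. by apply: aeW => x. Qed.

Lemma aeq_trans a b g f h : aeq a b f g -> aeq a b g h -> aeq a b f h.
Proof. by move=> p q; apply: ae_map (ae_and p q) => x [h1 h2] xab; rewrite h1// h2. Qed.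

Lemma aeq_sub a b c d f g : a <= c -> d <= b -> aeq a b f g -> aeq c d f g.
Proof.
move=> ac db; apply: ae_map => x h xcd; apply: h.
by have := @itv_sub a b c d ac db x xcd.
Qed.

Lemma int_aeq a b f g : measurable_fun `]a, b[ f -> measurable_fun `]a, b[ g ->
  aeq a b f g -> int a b f = int a b g.
Proof.
move=> mf mg fg; rewrite /int /Rintegral; congr fine.
apply: ae_eq_integral => //; [exact/measurable_EFinP|exact/measurable_EFinP|].
by apply: ae_map fg => x h xab /=; rewrite h.
Qed.

Lemma aeq_int a b f g c d : a <= c -> d <= b -> ig a b f -> ig a b g ->
  aeq a b f g -> int c d f = int c d g.
Proof.
move=> ac db hf hg fg; apply: int_aeq; last exact: aeq_sub fg.
  by apply: ig_meas; exact: (ig_sub ac db hf).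
by apply: ig_meas; exact: (ig_sub ac db hg).
Qed.

Definition sqint a b f := measurable_fun `]a, b[ f /\ ig a b (fun x => f x ^+ 2).

Lemma sqint_ig a b f : sqint a b f -> ig a b f.
Proof.
move=> [mf f2]; apply: (@ig_le _ _ _ (fun x => 1 + f x ^+ 2)) => //.
  by apply: igD => //; exact: ig_cst.
move=> x _; rewrite -[f x ^+ 2]real_normK ?num_real//.
by move: (normr_ge0 (f x)); move: `|f x| => r r0; nra.
Qed.

Lemma sqintM a b f g : sqint a b f -> sqint a b g -> ig a b (fun x => f x * g x).
Proof.
move=> [mf f2] [mg g2]; apply: (@ig_le _ _ _ (fun x => f x ^+ 2 + g x ^+ 2)) => //.
- exact: measurable_funM.
- exact: igD.
- move=> x _; rewrite normrM -(real_normK (num_real (f x))) -(real_normK (num_real (g x))).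
  by move: (normr_ge0 (f x)) (normr_ge0 (g x)); move: `|f x| `|g x| => r s r0 s0; nra.
Qed.

Lemma sqintD a b f g : sqint a b f -> sqint a b g -> sqint a b (fun x => f x + g x).
Proof.
move=> hf hg; have [mf f2] := hf; have [mg g2] := hg; split; first exact: measurable_funD.
apply: (@ig_ext _ _ (fun x => f x ^+ 2 + (2 * (f x * g x) + g x ^+ 2))).
  by move=> x _; ring.
by apply: igD => //; apply: igD => //; apply: igZ; exact: sqintM.
Qed.

Lemma sqintZ a b k f : sqint a b f -> sqint a b (fun x => k * f x).
Proof.
move=> [mf f2]; split; first exact: measurable_funM.
apply: (@ig_ext _ _ (fun x => k ^+ 2 * f x ^+ 2)); last exact: igZ.
by move=> x _; rewrite exprMn.
Qed.

Lemma sqintN a b f : sqint a b f -> sqint a b (fun x => - f x).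
Proof.
by move=> /(sqintZ (-1)); under eq_fun do rewrite mulN1r.
Qed.

Lemma sqintB a b f g : sqint a b f -> sqint a b g -> sqint a b (fun x => f x - g x).
Proof. by move=> hf hg; apply: sqintD => //; exact: sqintN. Qed.

Lemma sqint_sub a b c d f : a <= c -> d <= b -> sqint a b f -> sqint c d f.
Proof.
move=> ac db [mf f2]; split; last exact: ig_sub f2.
by apply: measurable_funS mf => //; exact: itv_sub.
Qed.

Lemma sqint_bounded a b f K : measurable_fun `]a, b[ f ->
  (forall x, x \in `]a, b[ -> `|f x| <= K) -> sqint a b f.
Proof.
move=> mf fK; split=> //; apply: (@ig_bounded _ _ _ (K ^+ 2)).
  exact: measurable_funX.
move=> x xab; rewrite normrX ler_pXn2r ?nnegrE ?fK//.
exact: le_trans (fK _ xab).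
Qed.

Lemma sqint_ext a b f g : (forall x, x \in `]a, b[ -> f x = g x) -> sqint a b f -> sqint a b g.
Proof.
move=> fg [mf f2]; split.
  by apply: eq_measurable_fun mf => x; rewrite inE => /fg.
by apply: ig_ext f2 => x xab; rewrite fg.
Qed.

Lemma ig_aeq a b f g : ig a b f -> measurable_fun `]a, b[ g -> aeq a b f g -> ig a b g.
Proof.
move=> /integrableP[mf fi] mg fg; apply/integrableP; split; first exact/measurable_EFinP.
rewrite (le_lt_trans _ fi)// le_eqVlt; apply/orP; left; apply/eqP.
apply: ae_eq_integral => //.
- by apply: measurableT_comp => //; exact/measurable_EFinP.
- exact: measurableT_comp.
- by apply: ae_map fg => x h xab /=; rewrite h.
Qed.

Lemma sqint_aeq a b f g : sqint a b f -> measurable_fun `]a, b[ g -> aeq a b f g ->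
  sqint a b g.
Proof.
move=> [mf f2] mg fg; split => //; apply: (ig_aeq f2); first exact: measurable_funX.
by apply: ae_map fg => x h xab; rewrite h.
Qed.

End IntegralOnInterval.

(** * Smooth functions with compact support *)

Section Bumps.
Context {R : realType}.
Implicit Types (a b c d x y k : R) (f g : R -> R) (p q : {poly R}).

(** A recursive form of smoothness, suited to products and compositions. *)
Fixpoint ndiff n f := if n is m.+1 then
  (forall x, derivable f x 1) /\ ndiff m (f^`())%classic else True.

Lemma ndiffW n f : ndiff n.+1 f -> ndiff n f.
Proof. by elim: n f => //= n IH f [df]; split=> //; apply: IH. Qed.

Lemma derive1nSr n f : derive1n n.+1 f = derive1n n (f^`())%classic.
Proof. by rewrite /derive1n iterSr. Qed.

Lemma ndiffP f : (forall n, ndiff n f) -> forall n x, derivable (derive1n n f) x 1.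
Proof.
move=> H n; move: (H n.+1); elim: n f {H} => [|n IH] f [] // df Hf x.
by rewrite derive1nSr; exact: IH.
Qed.

Lemma ndiff_derive1n f : (forall n x, derivable (derive1n n f) x 1) -> forall n, ndiff n f.
Proof.
move=> H n; elim: n f H => //= n IH f H; split; first exact: (H 0%N).
by apply: IH => m x; rewrite -derive1nSr.
Qed.

Lemma derive1E' f f' : (forall x, is_derive x (1 : R) f (f' x)) -> (f^`())%classic = f'.
Proof. by move=> H; apply/funext => x; rewrite derive1E; have [_ ->] := H x. Qed.

Lemma is_derive1 f x : derivable f x 1 -> is_derive x (1 : R) f (f^`()%classic x).
Proof. by move=> df; apply: DeriveDef => //; rewrite derive1E. Qed.

Lemma ndiffD n f g : ndiff n f -> ndiff n g -> ndiff n (fun x => f x + g x).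
Proof.
elim: n f g => //= n IH f g [df Hf] [dg Hg]; split=> [x|]; first exact: derivableD.
have D x : is_derive x (1 : R) (fun x => f x + g x) ((f^`())%classic x + (g^`())%classic x).
  by apply: is_deriveD; exact: is_derive1.
by rewrite (derive1E' D); exact: IH.
Qed.

Lemma ndiffZ n k f : ndiff n f -> ndiff n (fun x => k * f x).
Proof.
elim: n f => //= n IH f [df Hf]; split=> [x|]; first exact: derivableZ.
have D x : is_derive x (1 : R) (fun x => k * f x) (k * (f^`())%classic x).
  by apply: is_deriveZ; exact: is_derive1.
by rewrite (derive1E' D); exact: IH.
Qed.

Lemma ndiffM n f g : ndiff n f -> ndiff n g -> ndiff n (fun x => f x * g x).
Proof.
elim: n f g => //= n IH f g [df Hf] [dg Hg]; split=> [x|]; first exact: derivableM.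
have Wf : ndiff n f by apply: ndiffW.
have Wg : ndiff n g by apply: ndiffW.
have D x : is_derive x (1 : R) (fun x => f x * g x)
    (f x * (g^`())%classic x + g x * (f^`())%classic x).
  by apply: is_deriveM; exact: is_derive1.
by rewrite (derive1E' D); apply: ndiffD; apply: IH.
Qed.

Lemma ndiff_affine n f k c : ndiff n f -> ndiff n (fun x => f (k * x + c)).
Proof.
elim: n f => //= n IH f [df Hf].
have D x : is_derive x (1 : R) (fun x => f (k * x + c)) (k * (f^`())%classic (k * x + c)).
  have h : is_derive x (1 : R) (fun x : R => k * x + c) k.
    by apply: is_derive_eq; rewrite addr0 /GRing.scale /= mulr1.
  have h2 := is_derive1 (df (k * x + c)).
  have h3 := @is_derive1_comp R f (fun x : R => k * x + c) x _ _ h2 h.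
  by apply: (trigger_derive h3); exact: mulrC.
split=> [x|]; first by have [] := D x.
by rewrite (derive1E' D); apply: ndiffZ; exact: IH.
Qed.

(** The smooth functions p(1/x) exp(-1/x), flat at the origin *)
Definition flat p x := if 0 < x then p.[x^-1] * expR (- x^-1) else 0.

(** The exponential beats every polynomial. *)
Lemma horner_exp_bound q n : exists2 C, 0 <= C &
  forall y, 0 <= y -> `|q.[y]| * y ^+ n * expR (- y) <= C.
Proof.
elim/poly_ind: q n => [|q c IH] n.
  by exists 0 => // y _; rewrite horner0 normr0 !mul0r.
have [C C0 HC] := IH n.+1.
pose D : R := n.+1`!%:R + 1; have D0 : 0 <= D by rewrite addr_ge0.
have mono y : 0 <= y -> y ^+ n * expR (- y) <= D.
  move=> y0; rewrite expRN ler_pdivrMr ?expR_gt0//.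
  have e1 : 1 <= expR y by rewrite (le_trans _ (expR_ge1Dx y))// lerDl.
  have [y1|y1] := leP y 1.
    rewrite (@le_trans _ _ 1) ?exprn_ile1//.
    by rewrite (le_trans e1)// ler_peMl ?expR_ge0// /D lerDr.
  have := expR_ge1Dxn n y0 => h.
  have f0 : 0 < n.+1`!%:R :> R by rewrite ltr0n fact_gt0.
  apply: (@le_trans _ _ (y ^+ n.+1)).
    by rewrite exprS ler_peMl ?exprn_ge0// ltW.
  apply: (@le_trans _ _ (n.+1`!%:R * expR y)); last first.
    by rewrite ler_wpM2r ?expR_ge0// /D lerDl.
  rewrite mulrC -ler_pdivrMr//; apply: le_trans h; by rewrite lerDr.
exists (C + `|c| * D) => [|y y0].
  by rewrite addr_ge0// mulr_ge0.
rewrite !hornerE (@le_trans _ _ ((`|q.[y]| * y + `|c|) * y ^+ n * expR (- y)))//.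
  rewrite -!mulrA ler_wpM2r ?mulr_ge0 ?exprn_ge0 ?expR_ge0//.
  by rewrite (le_trans (ler_normD _ _))// normrM (ger0_norm y0).
rewrite -mulrA mulrDl lerD//.
  by apply: le_trans (HC _ y0); rewrite exprS !mulrA.
by rewrite ler_wpM2l// mono.
Qed.

Lemma flat_bound p : exists2 C, 0 <= C & forall x, `|flat p x| <= C * `|x|.
Proof.
have [C C0 HC] := horner_exp_bound p 1.
exists C => // x; rewrite /flat; case: ifPn => [x0|_]; last by rewrite normr0 mulr_ge0.
have := HC x^-1; rewrite invr_ge0 (ltW x0) => /(_ isT) h.
rewrite normrM (ger0_norm (expR_ge0 _)) (gtr0_norm x0) -ler_pdivrMr//.
by apply: le_trans h; rewrite expr1 mulrAC.
Qed.

(** For x > 0 this is the chain rule; at 0 the bound by C |x| for the polynomial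
    X p shows that the difference quotient tends to 0. *)
Lemma flat_derive p x : is_derive x (1 : R) (flat p) (flat ('X^2 * (p - p^`())) x).
Proof.
have [x0|x0|->] := ltgtP x 0.
- have -> : flat ('X^2 * (p - p^`())) x = 0 by rewrite /flat ltNge (ltW x0).
  apply: (@near_eq_is_derive _ _ _ (cst 0)).
  near=> y; rewrite /flat ifN// -leNgt ltW//; near: y; exact: lt_nbhsl.
- have -> : flat ('X^2 * (p - p^`())) x = ('X^2 * (p - p^`())).[x^-1] * expR (- x^-1).
    by rewrite /flat x0.
  apply: (@near_eq_is_derive _ _ _ (fun y => p.[y^-1] * expR (- y^-1))).
    near=> y; rewrite /flat ifT//; near: y; exact: lt_nbhsr.
  have xn0 : x != 0 by rewrite gt_eqF.
  have dV : is_derive x (1 : R) (fun y : R => y^-1) (- x ^- 2).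
    by apply: is_derive_eq; [apply: is_deriveV|rewrite /GRing.scale/= mulr1].
  have d1 := is_derive1_comp (is_derive_poly p x^-1) dV.
  have d2 := @is_derive1_comp R expR (fun y => - y^-1) x _ _ (is_derive_expR (- x^-1)) (is_deriveN dV).
  have d := is_deriveM d1 d2; apply: (trigger_derive d).
  rewrite !(hornerM, hornerXn, hornerD, hornerN, hornerX).
  rewrite -[LHS]/(p.[x^-1] * (expR (- x^-1) * (- - x ^- 2)) + expR (- x^-1) * (p^`().[x^-1] * - x ^- 2)).
  move: (expR (- x^-1)) (p.[x^-1]) (p^`().[x^-1]) => E P Q.
  by field; exact: xn0.
- have -> : flat ('X^2 * (p - p^`())) 0 = 0 by rewrite /flat ltxx.
  have [C C0 HC] := flat_bound ('X * p).
  have cv : h^-1 *: (flat p (h *: 1 + 0) - flat p 0) @[h --> 0^'] --> (0 : R).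
    apply/cvgrPdist_le => e e0.
    have C1 : 0 < C + 1 by rewrite ltr_wpDl.
    exists (e / (C + 1)) => /=; first exact: divr_gt0.
    move=> h /=; rewrite !sub0r !normrN => he hn0.
    rewrite [flat p 0]/flat ltxx subr0 addr0 /GRing.scale /= mulr1.
    have -> : h^-1 * flat p h = flat ('X * p) h.
      by rewrite /flat; case: ifP => _; rewrite ?mulr0// hornerM hornerX mulrA.
    rewrite (le_trans (HC h))// (@le_trans _ _ ((C + 1) * `|h|)) ?ler_wpM2r ?lerDl//.
    by rewrite mulrC -ler_pdivlMr// ltW.
  by apply: DeriveDef; [apply/cvg_ex; exists 0|exact: cvg_lim cv].
Unshelve. all: by end_near. Qed.

Lemma flat_smooth p n : ndiff n (flat p).
Proof.
elim: n p => //= n IH p; split=> [x|]; first by have [] := flat_derive p x.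
by rewrite (derive1E' (flat_derive p)).
Qed.

(** A smooth bump supported in [c, d], increasing to the indicator of the open
    interval as k tends to infinity. *)
Definition bump k c d x := flat 1 (k * (x - c)) * flat 1 (k * (d - x)).

Lemma flat1E x : 0 < x -> flat 1 x = expR (- x^-1).
Proof. by move=> x0; rewrite /flat x0 hornerC mul1r. Qed.

Lemma flat1_ge0 x : 0 <= flat 1 x.
Proof. by rewrite /flat; case: ifP => // _; rewrite hornerC mul1r expR_ge0. Qed.

Lemma flat1_le1 x : flat 1 x <= 1.
Proof.
rewrite /flat; case: ifP => // x0; rewrite hornerC mul1r -expR0 ler_expR.
by rewrite oppr_le0 invr_ge0 ltW.
Qed.

Lemma bump_ge0 k c d x : 0 <= bump k c d x.
Proof. by rewrite mulr_ge0 ?flat1_ge0. Qed.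

Lemma bump_le1 k c d x : bump k c d x <= 1.
Proof. by rewrite mulr_ile1 ?flat1_ge0 ?flat1_le1. Qed.

Lemma bump_smooth k c d n : ndiff n (bump k c d).
Proof.
apply: ndiffM.
  rewrite (_ : (fun x => _) = (fun x => flat 1 (k * x + (- k * c)))).
    by apply: ndiff_affine; exact: flat_smooth.
  by apply/funext => x; congr flat; ring.
rewrite (_ : (fun x => _) = (fun x => flat 1 ((- k) * x + k * d))).
  by apply: ndiff_affine; exact: flat_smooth.
by apply/funext => x; congr flat; ring.
Qed.

Lemma bump_out k c d x : 0 <= k -> ~~ (c < x < d) -> bump k c d x = 0.
Proof.
move=> k0; rewrite negb_and -!leNgt => /orP[h|h]; rewrite /bump.
  by rewrite {1}/flat ifN ?mul0r// -leNgt mulr_ge0_le0// subr_le0.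
by rewrite {2}/flat ifN ?mulr0// -leNgt mulr_ge0_le0// subr_le0.
Qed.

Lemma test_functionP a b f : test_function a b f <-> (forall n, ndiff n f) /\
  exists c d, [/\ a < c, d < b & forall x, f x != 0 -> c <= x <= d].
Proof.
split=> -[h1 h2]; split=> //; [exact: ndiff_derive1n|exact: ndiffP].
Qed.

Lemma bump_test k a b c d : 0 <= k -> a < c -> d < b -> test_function a b (bump k c d).
Proof.
move=> k0 ac db; apply/test_functionP; split; first by move=> n; exact: bump_smooth.
exists c, d; split=> // x; apply: contraNT => h; apply/eqP; apply: bump_out => //.
by apply: contraNN h => /andP[/ltW -> /ltW ->].
Qed.

End Bumps.

(** * The fundamental lemma of the calculus of variations *)

Section FundamentalLemma.
Context {R : realType}.
Notation mu := (@lebesgue_measure R).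
Implicit Types (a b c d x y : R) (f g h F G : R -> R).

Lemma ndiff_continuous f : ndiff 1 f -> continuous f.
Proof.
by move=> [df _] x; apply: differentiable_continuous; apply/derivable1_diffP; exact: df.
Qed.

Lemma continuous_meas a b f : continuous f -> measurable_fun `]a, b[ f.
Proof. by move=> cf; apply: measurable_funTS; exact: continuous_measurable_fun. Qed.

Lemma bump_cvg c d x : c < x < d -> bump n.+1%:R c d x @[n --> \oo] --> (1 : R).
Proof.
move=> /andP[cx xd].
pose A := (x - c)^-1 + (d - x)^-1.
have -> : (fun n => bump n.+1%:R c d x) = (fun n => expR (- (A * harmonic n))).
  apply/funext => n; rewrite /bump !flat1E ?mulr_gt0 ?subr_gt0 ?ltr0n//.
  rewrite -expRD; congr expR; rewrite /A /= !invfM; ring.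
rewrite -[X in _ --> X]expR0; apply: (cvg_comp _ expR) ; last exact: continuous_expR.
rewrite -oppr0; apply: cvgN; rewrite -(mulr0 A); apply: cvgMr.
exact: cvg_harmonic.
Qed.

Lemma int_dominated a b (f_ : nat -> R -> R) f g :
  (forall n, measurable_fun `]a, b[ (f_ n)) -> measurable_fun `]a, b[ f -> ig a b g ->
  (forall n x, x \in `]a, b[ -> `|f_ n x| <= g x) ->
  (forall x, x \in `]a, b[ -> f_ n x @[n --> \oo] --> f x) ->
  int a b (f_ n) @[n --> \oo] --> int a b f.
Proof.
move=> mf_ mf gi fg ff; rewrite /int /Rintegral.
have igf : ig a b f.
  apply: (ig_le mf gi) => x xab.
  have h : `|f_ n x| @[n --> \oo] --> `|f x| by apply: cvg_norm; exact: ff.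
  rewrite -(cvg_lim _ h)//; apply: limr_le; first by apply/cvg_ex; exists `|f x|.
  by apply: nearW => n; exact: fg.
apply: fine_cvg; rewrite fineK; last by apply: integrable_fin_num => //; exact: igf.
have m1 n : measurable_fun `]a, b[ (EFin \o f_ n) by exact/measurable_EFinP.
have m2 : measurable_fun `]a, b[ (EFin \o f) by exact/measurable_EFinP.
have c1 : {ae mu, forall x, `]a, b[%classic x -> (EFin \o f_ n) x @[n --> \oo] --> (EFin \o f) x}.
  by apply: aeW => x xab; apply: cvg_EFin; [near=> n|exact: ff].
have d1 : {ae mu, forall x n, `]a, b[%classic x -> (`|(EFin \o f_ n) x| <= (EFin \o g) x)%E}.
  by apply: aeW => x n xab /=; rewrite lee_fin; exact: fg.
by have [] := @dominated_convergence _ _ _ mu `]a, b[%classic (measurable_itv _) _ _ _ m1 m2 c1 gi d1.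
Unshelve. all: by end_near. Qed.

Lemma int_indic a b c d f : a <= c -> d <= b ->
  int c d f = int a b (fun x => f x * \1_(`]c, d[%classic) x).
Proof.
move=> ac db; rewrite /int Rintegral_mkcond [RHS]Rintegral_mkcond.
congr Rintegral; apply/funext => x; rewrite !patchE indicE.
have [xcd|xcd] := boolP (x \in `]c, d[%classic); last by rewrite mulr0; case: ifP.
rewrite mulr1 ifT//; move: xcd; rewrite !inE; exact: itv_sub.
Qed.

Lemma bump_meas a b k c d : measurable_fun `]a, b[ (bump k c d : R -> R).
Proof. by apply: continuous_meas; apply: ndiff_continuous; exact: bump_smooth. Qed.

(** The bumps converge boundedly to the indicator of ]c, d[. *)
Lemma int_bump a b c d f : a <= c -> d <= b -> ig a b f ->
  int a b (fun x => f x * bump n.+1%:R c d x) @[n --> \oo] --> int c d f.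
Proof.
move=> ac db igf; have mf := ig_meas igf.
rewrite (int_indic _ ac db).
apply: (@int_dominated _ _ _ _ (fun x => `|f x|)).
- by move=> n; apply: measurable_funM => //; exact: bump_meas.
- by apply: measurable_funM => //; exact: measurable_indic.
- exact: ig_abs.
- move=> n x _; rewrite normrM ler_piMr// ger0_norm ?bump_ge0//; exact: bump_le1.
- move=> x _; apply: cvgMr; rewrite indicE; have [xcd|xcd] := boolP (c < x < d).
    by rewrite mem_set//; exact: bump_cvg.
  rewrite memNset; last by move=> /=; rewrite in_itv/= (negbTE xcd).
  by under eq_fun do rewrite bump_out//; exact: cvg_cst.
Qed.

(** By Lebesgue differentiation f is almost everywhere the derivative of its
    primitive, which is constant. *)
Lemma int_null_aeq a b f : ig a b f ->
  (forall c d, a < c -> c < d -> d < b -> int c d f = 0) -> aeq a b f (fun=> 0).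
Proof.
move=> igf H; pose g := f \_ `]a, b[%classic.
have ig_g : mu.-integrable setT (EFin \o g).
  by rewrite /g -restrict_EFin; apply/integrable_restrict => //=; rewrite setTI.
have lg : locally_integrable [set: R] g by exact: integrable_locally.
have iy y : mu.-integrable [set` Interval (BRight a) (BRight y)] (EFin \o g).
  by apply: integrableS ig_g.
have := FTC1 iy lg; apply: ae_map => z Hx zab.
have /andP[az zb] : a < z < b by rewrite in_itv/= in zab.
have ax' : (BRight a < BRight z)%O by rewrite bnd_simp.
have [_] := Hx ax'.
have -> : g z = f z by rewrite /g patchE mem_set.
move=> <-; rewrite derive1E.
set F := fun _ => _.
have F_cst u v : a < u -> u < v -> v < b -> F v = F u.
  move=> au uv vb; apply/eqP; rewrite -subr_eq0; apply/eqP.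
  rewrite /F (Rintegral_itvB (iy v)) ?bnd_simp ?ltW// -Rintegral_itv_bndo_bndc; last first.
    by apply: integrableS ig_g.
  rewrite -[RHS](H u v)//; apply: int_ext => y yuv.
  rewrite /g patchE mem_set//; apply: itv_sub yuv; exact: ltW.
have near_cst : {near z, cst (F z) =1 F}.
  near=> y; apply/esym; have ay : a < y by near: y; exact: lt_nbhsr.
  have yb : y < b by near: y; exact: lt_nbhsl.
  have [yz|] := ltP y z; first exact/esym/F_cst.
  by rewrite le_eqVlt => /predU1P[->//|zy]; exact: F_cst.
by rewrite -(near_eq_derive _ near_cst) derive_cst.
Unshelve. all: by end_near. Qed.

(** Integrals over subintervals are limits of integrals against bumps. *)
Lemma fundamental_lemma a b f : ig a b f ->
  (forall phi, test_function a b phi -> int a b (fun x => f x * phi x) = 0) ->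
  aeq a b f (fun=> 0).
Proof.
move=> igf H; apply: int_null_aeq => // c d ac cd db.
have := int_bump (ltW ac) (ltW db) igf.
under eq_fun do rewrite (H _ (bump_test (ler0n _ _) ac db)).
by move=> /(cvg_lim (@Rhausdorff _)) <-; exact/lim_cst.
Qed.

End FundamentalLemma.

(** * Absolutely continuous primitives *)

Section ByParts.
Context {R : realType}.
Notation mu := (@lebesgue_measure R).
Implicit Types (a b c d x y : R) (f g h F G : R -> R).

Lemma int_setT a b f : int a b f = \int[mu]_x (f \_ `]a, b[%classic) x.
Proof. by rewrite /int Rintegral_mkcond. Qed.

Lemma int_EFin a b f : ig a b f ->
  (\int[mu]_x ((f \_ `]a, b[%classic) x)%:E)%E = (int a b f)%:E.
Proof.
move=> igf; rewrite int_setT /Rintegral fineK//.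
apply: integrable_fin_num => //.
by have /integrable_mkcond := igf; rewrite restrict_EFin; apply.
Qed.

(** Both sides are integrals of f x * g y over the triangle x < y. *)
Lemma int_byparts0 a b f g : ig a b f -> ig a b g ->
  int a b (fun x => f x * int x b g) = int a b (fun y => int a y f * g y).
Proof.
move=> igf igg.
pose fr := f \_ `]a, b[%classic; pose gr := g \_ `]a, b[%classic.
have mr (u v : R) h : ig u v h -> measurable_fun setT (h \_ `]u, v[%classic).
  by move=> ih; apply/(measurable_restrictT _ _).1 => //; exact: ig_meas.
have ir (u v : R) h : ig u v h -> mu.-integrable setT (EFin \o h \_ `]u, v[%classic).
  by move=> ih; rewrite -restrict_EFin; apply/integrable_restrict => //=; rewrite setTI.
pose K (p : R * R) : R := fr p.1 * gr p.2 * \1_[set p : R * R | p.1 < p.2] p.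
have mlt : measurable [set p : R * R | p.1 < p.2].
  have := @measurable_fun_ltr _ _ R setT (fst : R * R -> R) snd measurable_fst measurable_snd.
  move=> /(_ measurableT [set true] _); rewrite setTI; apply.
  by [].
have mK : measurable_fun setT (EFin \o K).
  apply/measurable_EFinP; apply: measurable_funM; last exact: measurable_indic.
  apply: measurable_funM.
    by apply: (measurableT_comp (mr _ _ f igf)); exact: measurable_fst.
  by apply: (measurableT_comp (mr _ _ g igg)); exact: measurable_snd.
have mKx x : measurable_fun setT (fun y => (EFin \o K) (x, y)).
  exact: measurableT_comp.
have igr := ir _ _ g igg; have ifr := ir _ _ f igf.
have iK : (mu \x mu)%E.-integrable setT (EFin \o K).
  apply/integrable12ltyP => //.
  have [r Hr] : exists r : R, (\int[mu]_y `|(gr y)%:E|)%E = r%:E.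
    exists (fine (\int[mu]_y `|(gr y)%:E|)%E); rewrite fineK//.
    by have /integrableP[_] := igr; rewrite ge0_fin_numE ?integral_ge0.
  have r0 : 0 <= r by rewrite -lee_fin -Hr integral_ge0.
  apply: (@le_lt_trans _ _ (\int[mu]_x (r%:E * `|(fr x)%:E|))%E); last first.
    by apply: integrable_lty => //; apply: integrableZl => //; exact: integrable_abse.
  apply: ge0_le_integral => //.
  - by move=> x _; exact: integral_ge0.
  - apply: (@measurable_fun_fubini_tonelli_F _ _ _ _ _ mu (abse \o (EFin \o K))).
      by apply: (measurableT_comp _ mK).
    by move=> ?; exact: abse_ge0.
  - by apply: measurable_funeM; apply: measurableT_comp => //; apply/measurable_EFinP; exact: (mr _ _ f igf).
  - move=> x _; rewrite -Hr muleC -integralZl//; last exact: integrable_abse.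
    apply: ge0_le_integral => //.
    + by apply: (measurableT_comp _ (mKx x)).
    + by apply: measurable_funeM; apply: measurableT_comp => //; apply/measurable_EFinP; exact: (mr _ _ g igg).
    + move=> y _ /=; rewrite lee_fin /K !normrM ler_piMr// ?mulr_ge0//.
      by rewrite indicE; case: (_ \in _); rewrite ?normr1 ?normr0.
have := Fubini iK.
have -> : (\int[mu]_x \int[mu]_y (EFin \o K) (x, y))%E =
    (\int[mu]_x (((fun x => f x * int x b g) \_ `]a, b[) x)%:E)%E.
  apply: eq_integral => x _; rewrite patchE.
  case: ifPn => xab; last first.
    by apply: integral0_eq => y _; rewrite /= /K /fr patchE /= (negbTE xab) !mul0r.
  have axb : a < x < b by move: xab; rewrite inE /= in_itv.
  have [ax xb] := andP axb.
  have igx := ig_sub (ltW ax) (lexx b) igg.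
  rewrite EFinM -(int_EFin igx) -integralZl//; last exact: ir.
  apply: eq_integral => y _ /=; rewrite -EFinM; congr EFin.
  rewrite /K /= {1}/fr patchE xab -mulrA; congr (_ * _).
  rewrite indicE /gr !patchE; have [xy|yx] := boolP (x < y).
    rewrite (_ : ((x, y) \in [set p : R * R | p.1 < p.2]) = true) ?mulr1; last exact: mem_set.
    rewrite (_ : (y \in `]a, b[%classic) = (y \in `]x, b[%classic))//.
    by apply/idP/idP; rewrite !inE /= !in_itv /= => /andP[h1 h2]; rewrite h2 ?xy// (lt_trans ax).
  rewrite (_ : ((x, y) \in [set p : R * R | p.1 < p.2]) = false); last by apply: memNset => /=; exact/negP.
  rewrite mulr0 ifN//; apply/negP; rewrite inE /= in_itv /= => /andP[h1 h2].
  by rewrite h1 in yx.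
have -> : (\int[mu]_y \int[mu]_x (EFin \o K) (x, y))%E =
    (\int[mu]_y (((fun y => int a y f * g y) \_ `]a, b[) y)%:E)%E.
  apply: eq_integral => y _; rewrite patchE.
  case: ifPn => yab; last first.
    by apply: integral0_eq => x _; rewrite /= /K /gr [X in _ * X * _]patchE /= (negbTE yab) mulr0 mul0r.
  have ayb : a < y < b by move: yab; rewrite inE /= in_itv.
  have [ay yb] := andP ayb.
  have igy := ig_sub (lexx a) (ltW yb) igf.
  rewrite mulrC EFinM -(int_EFin igy) -integralZl//; last exact: ir.
  apply: eq_integral => x _ /=; rewrite -EFinM; congr EFin.
  rewrite /K /= {1}/gr [X in _ * X * _]patchE yab mulrAC mulrC; congr (_ * _).
  rewrite indicE /fr !patchE; have [xy|yx] := boolP (x < y).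
    rewrite (_ : ((x, y) \in [set p : R * R | p.1 < p.2]) = true) ?mulr1; last exact: mem_set.
    rewrite (_ : (x \in `]a, b[%classic) = (x \in `]a, y[%classic))//.
    by apply/idP/idP; rewrite !inE /= !in_itv /= => /andP[h1 h2]; rewrite h1 ?xy// (lt_trans _ yb).
  rewrite (_ : ((x, y) \in [set p : R * R | p.1 < p.2]) = false); last by apply: memNset => /=; exact/negP.
  rewrite mulr0 ifN//; apply/negP; rewrite inE /= in_itv /= => /andP[h1 h2].
  by rewrite h2 in yx.
by rewrite !int_setT /Rintegral => ->.
Qed.

(** [prim a b F f]: F is an absolutely continuous primitive on [a, b] of the
    square-integrable function f *)
Definition prim a b F f := sqint a b f /\
  forall x, a <= x -> x <= b -> F x = F a + int a x f.

Lemma prim_diff a b F f x y : prim a b F f -> a <= x -> x <= y -> y <= b ->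
  F y - F x = int x y f.
Proof.
move=> [sf FE] ax xy yb.
rewrite (FE y)// ?(le_trans ax)// (FE x)// ?(le_trans xy)//.
rewrite (@int_split _ a y x)//; first by ring.
exact: (ig_sub (lexx a) yb (sqint_ig sf)).
Qed.

Lemma prim_sub a b c d F f : a <= c -> c <= d -> d <= b -> prim a b F f -> prim c d F f.
Proof.
move=> ac cd db pF; split; first exact: (sqint_sub ac db (proj1 pF)).
move=> x cx xd; rewrite -(prim_diff pF ac cx (le_trans xd db)).
by rewrite addrC subrK.
Qed.

(** Young inequality |f| <= k + f^2 / k, a substitute for Cauchy-Schwarz that
    needs no square root. *)
Lemma int_young a b f k : a <= b -> 0 < k -> sqint a b f ->
  `|int a b f| <= k * (b - a) + k^-1 * int a b (fun x => f x ^+ 2).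
Proof.
move=> ab k0 sf; have igf := sqint_ig sf; have [_ f2] := sf.
rewrite (le_trans (int_abs igf))// -int_cst// -intZ// -intD ?igZ ?ig_cst//.
apply: int_le; [exact: ig_abs|by apply: igD; [exact: ig_cst|exact: igZ]|].
move=> x _; rewrite -(ler_pM2l k0) mulrDr mulrA divff ?gt_eqF// mul1r.
rewrite -[f x ^+ 2]real_normK ?num_real//.
by move: (normr_ge0 (f x)); move: `|f x| => r r0; nra.
Qed.

(** Young with a small k gives uniform continuity. *)
Lemma prim_unif a b F f e : a <= b -> prim a b F f -> 0 < e ->
  exists2 d, 0 < d & forall x y, a <= x -> x <= y -> y <= b -> y - x <= d ->
    `|F y - F x| <= e.
Proof.
move=> ab pF e0; have [sf _] := pF; have [_ f2] := sf.
pose C := int a b (fun x => f x ^+ 2).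
have C0 : 0 <= C by apply: int_ge0 => x _; exact: sqr_ge0.
pose k := 2 * (C + 1) / e.
have k0 : 0 < k by rewrite divr_gt0// mulr_gt0// ltr_wpDl.
exists (e / (2 * k)); first by rewrite divr_gt0// mulr_gt0.
move=> x y ax xy yb yx; rewrite (prim_diff pF)//.
rewrite (le_trans (int_young xy k0 (sqint_sub ax yb sf)))//.
have h1 : k * (y - x) <= e / 2.
  rewrite (le_trans (ler_wpM2l (ltW k0) yx))// le_eqVlt; apply/orP; left; apply/eqP.
  by field; rewrite gt_eqF.
have h2 : k^-1 * int x y (fun x => f x ^+ 2) <= e / 2.
  rewrite (@le_trans _ _ (k^-1 * (C + 1)))//.
    rewrite ler_pM2l ?invr_gt0// (@le_trans _ _ C) ?lerDl// /C.
    rewrite (@int_split _ a b x) ?(le_trans xy yb)//.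
    rewrite (@int_split _ x b y) ?(ig_sub ax (lexx b))//.
    by rewrite addrCA lerDl addr_ge0// int_ge0// => z _; exact: sqr_ge0.
  rewrite /k le_eqVlt; apply/orP; left; apply/eqP; field.
  by rewrite !gt_eqF// ltr_wpDl.
by rewrite (le_trans (lerD h1 h2))//; lra.
Qed.

Lemma prim_bound a b F f x : a <= b -> prim a b F f -> a <= x -> x <= b ->
  `|F x| <= `|F a| + (b - a) + int a b (fun x => f x ^+ 2).
Proof.
move=> ab pF ax xb; have [sf FE] := pF; have [_ f2] := sf.
rewrite FE// -addrA (le_trans (ler_normD _ _))// lerD2l.
rewrite (le_trans (int_young ax ltr01 (sqint_sub (lexx a) xb sf)))// mul1r invr1 mul1r.
rewrite lerD ?lerB// (@int_split _ a b x)// lerDl int_ge0// => z _; exact: sqr_ge0.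
Qed.

Lemma prim_continuous a b F f x : prim a b F f -> x \in `]a, b[ -> {for x, continuous F}.
Proof.
rewrite in_itv/= => pF /andP[ax xb]; apply/cvgrPdist_le => e e0.
have [d d0 H] := prim_unif (ltW (lt_trans ax xb)) pF e0.
near=> y.
have ay : a <= y by apply: ltW; near: y; exact: lt_nbhsr.
have yb : y <= b by apply: ltW; near: y; exact: lt_nbhsl.
have xyd : `|x - y| <= d.
  by near: y; apply: cvgr_dist_le.
have [xy|/ltW yx] := leP x y.
  rewrite distrC; apply: H => //; first exact: ltW.
  by rewrite -[leLHS]ger0_norm ?subr_ge0// distrC.
apply: H => //; first exact: ltW.
by rewrite -[leLHS]ger0_norm ?subr_ge0.
Unshelve. all: by end_near. Qed.

Lemma prim_meas a b F f : prim a b F f -> measurable_fun `]a, b[ F.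
Proof.
move=> pF; apply: open_continuous_measurable_fun; first exact: interval_open.
by move=> x; rewrite inE/= => xab; exact: prim_continuous pF xab.
Qed.

Lemma prim_sqint a b F f : a <= b -> prim a b F f -> sqint a b F.
Proof.
move=> ab pF; apply: (sqint_bounded (prim_meas pF)) => x.
by rewrite in_itv/= => /andP[ax xb]; apply: (prim_bound ab pF); exact: ltW.
Qed.

(** Write F as F a plus an integral from a, and G as G b minus an integral up to b:
    the mixed term is the triangle identity. *)
Lemma byparts a b F f G g : a <= b -> prim a b F f -> prim a b G g ->
  int a b (fun x => F x * g x) + int a b (fun x => f x * G x) = F b * G b - F a * G a.
Proof.
move=> ab pF pG; have [sf FE] := pF; have [sg GE] := pG.
have igf := sqint_ig sf; have igg := sqint_ig sg.
have sF := prim_sqint ab pF; have sG := prim_sqint ab pG.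
have scst k : sqint a b (fun=> k) by apply: (@sqint_bounded _ _ _ _ `|k|).
have EF : forall x, x \in `]a, b[ -> F x - F a = int a x f.
  move=> x; rewrite in_itv/= => /andP[ax xb].
  by rewrite (prim_diff pF)// ltW.
have EG : forall x, x \in `]a, b[ -> G b - G x = int x b g.
  move=> x; rewrite in_itv/= => /andP[ax xb].
  by rewrite (prim_diff pG)// ltW.
have sF' : sqint a b (fun x => F x - F a) by exact: sqintB.
have sG' : sqint a b (fun x => G b - G x) by exact: sqintB.
have E1 : int a b (fun x => F x * g x) = int a b (fun x => int a x f * g x) + F a * int a b g.
  rewrite -intZ// -intD ?igZ//; last first.
    by apply: ig_ext (sqintM sF' sg) => x xab; rewrite EF.
  by apply: int_ext => x xab; rewrite -EF//; ring.
have E2 : int a b (fun x => f x * G x) = G b * int a b f - int a b (fun x => f x * int x b g).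
  rewrite -intZ// -intB ?igZ//; last first.
    by apply: ig_ext (sqintM sf sG') => x xab; rewrite EG.
  by apply: int_ext => x xab; rewrite -EG//; ring.
rewrite E1 E2 int_byparts0// (FE b)// (GE b)//; ring.
Qed.

Lemma primD a b F f G g : prim a b F f -> prim a b G g ->
  prim a b (fun x => F x + G x) (fun x => f x + g x).
Proof.
move=> [sf FE] [sg GE]; split; first exact: sqintD.
move=> x ax xb; rewrite (FE _ ax xb) (GE _ ax xb) intD; first by ring.
  exact: (ig_sub (lexx a) xb (sqint_ig sf)).
exact: (ig_sub (lexx a) xb (sqint_ig sg)).
Qed.

Lemma primZ a b F f k : prim a b F f -> prim a b (fun x => k * F x) (fun x => k * f x).
Proof.
move=> [sf FE]; split; first exact: sqintZ.
move=> x ax xb; rewrite (FE _ ax xb) intZ; first by ring.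
exact: (ig_sub (lexx a) xb (sqint_ig sf)).
Qed.

Lemma prim_cst a b k : prim a b (fun=> k) (fun=> 0).
Proof.
split; first by apply: (@sqint_bounded _ _ _ _ 0) => // x _; rewrite normr0.
by move=> x ax xb; rewrite int_cst// mul0r addr0.
Qed.

Lemma prim_int a b f k : sqint a b f -> prim a b (fun x => k + int a x f) f.
Proof. by move=> sf; split => // x ax xb; rewrite (int_empty f (lexx a)) addr0. Qed.

Lemma prim_derive a b f : a <= b -> (forall x, derivable f x 1) ->
  continuous (f^`())%classic -> prim a b f (f^`())%classic.
Proof.
move=> ab df cf; split.
  have cw : {within `[a, b], continuous (f^`())%classic} by exact: continuous_subspaceT.
  have [M [_ HM]] := compact_bounded (continuous_compact cw (@segment_compact _ a b)).
  apply: (@sqint_bounded _ _ _ _ (M + 1)); first exact: continuous_meas.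
  move=> x xab; apply: HM; first by rewrite ltrDl.
  exists x => //; exact: subset_itv_oo_cc xab.
move=> x ax xb; have [->|xa] := eqVneq x a; first by rewrite int_empty// addr0.
have ltax : a < x by rewrite lt_neqAle eq_sym xa.
have cx : {within `[a, x], continuous (f^`())%classic} by exact: continuous_subspaceT.
have cff y : {for y, continuous f}.
  by apply: differentiable_continuous; apply/derivable1_diffP; exact: df.
have LR : derivable_oo_LRcontinuous f a x.
  split; first by move=> y _; exact: df.
    by apply: cvg_at_right_filter; exact: cff.
  by apply: cvg_at_left_filter; exact: cff.
have := continuous_FTC2 ltax cx LR (fun y _ => erefl).
move=> h; have -> : int a x (f^`())%classic = f x - f a.
  rewrite /int Rintegral_itv_obnd_cbnd; last first.
    apply: integrableS (continuous_compact_integrable (@segment_compact _ a x) cx) => //.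
    by apply: subset_itv; rewrite bnd_simp.
  rewrite Rintegral_itv_bndo_bndc; last first.
    apply: integrableS (continuous_compact_integrable (@segment_compact _ a x) cx) => //.
    by apply: subset_itv; rewrite bnd_simp.
  by rewrite /Rintegral h.
by ring.
Qed.

End ByParts.

(** * Weak derivatives on an interval *)

Section WeakDerivative.
Context {R : realType}.
Notation mu := (@lebesgue_measure R).
Implicit Types (a b c d x y : R) (f g h F G phi psi : R -> R).

(** Weak derivative of order n of a real function. *)
Definition rwd n a b f g := forall phi, test_function a b phi ->
  int a b (fun x => f x * derive1n n phi x) = (-1) ^+ n * int a b (fun x => g x * phi x).

Lemma test_ndiff a b phi n : test_function a b phi -> ndiff n phi.
Proof. by move=> /test_functionP[]. Qed.

Lemma test_derive a b phi : test_function a b phi -> test_function a b (phi^`())%classic.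
Proof.
move=> /test_functionP[np [c [d [ac db supp]]]]; apply/test_functionP; split.
  by move=> n; have [] := np n.+1.
have supp0 x : ~~ (c <= x <= d) -> phi x = 0.
  by move=> h; apply/eqP; apply: contraNT h; exact: supp.
have zero x : (\near x, cst 0 x = phi x) -> (phi^`())%classic x = 0.
  by move=> h; rewrite derive1E -(near_eq_derive _ h) derive_cst.
exists c, d; split=> // x; apply: contraNT; rewrite negb_and -!ltNge => /orP[h|h].
  apply/eqP/zero; near=> y; rewrite supp0// negb_and -ltNge.
  by apply/orP; left; near: y; exact: lt_nbhsl.
apply/eqP/zero; near=> y; rewrite supp0// negb_and -!ltNge.
by apply/orP; right; near: y; exact: lt_nbhsr.
Unshelve. all: by end_near. Qed.

Lemma test_lin a b k phi psi : test_function a b phi -> test_function a b psi ->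
  test_function a b (fun x => k * phi x + psi x).
Proof.
move=> /test_functionP[np [c [d [ac db supp]]]] /test_functionP[np' [c' [d' [ac' db' supp']]]].
apply/test_functionP; split; first by move=> n; apply: ndiffD => //; exact: ndiffZ.
exists (Num.min c c'), (Num.max d d'); split; rewrite ?lt_min ?gt_max ?ac ?db// => x h.
rewrite ge_min le_max.
have [p0|p0] := eqVneq (phi x) 0.
  have [q0|q0] := eqVneq (psi x) 0; first by rewrite p0 q0 mulr0 addr0 eqxx in h.
  by have /andP[-> ->] := supp' _ q0; rewrite !orbT.
by have /andP[-> ->] := supp _ p0.
Qed.

Lemma test_bound0 a b phi : a < b -> test_function a b phi -> phi a = 0 /\ phi b = 0.
Proof.
move=> ab /test_functionP[_ [c [d [ac db supp]]]]; split; apply/eqP.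
  by apply: contraTT ac => /supp /andP[h _]; rewrite -leNgt.
by apply: contraTT db => /supp /andP[_ h]; rewrite -leNgt.
Qed.

Lemma test_prim a b phi : a <= b -> test_function a b phi -> prim a b phi (phi^`())%classic.
Proof.
move=> ab tp; apply: prim_derive => //; first by have [] := test_ndiff 1 tp.
by apply: ndiff_continuous; have [] := test_ndiff 2 tp.
Qed.

Lemma test_sqint a b phi : a <= b -> test_function a b phi -> sqint a b phi.
Proof. by move=> ab tp; apply: prim_sqint (test_prim ab tp). Qed.

Lemma ig_continuous a b f : continuous f -> ig a b f.
Proof.
move=> cf; apply: integrableS (continuous_compact_integrable (@segment_compact _ a b) _) => //.
  by apply: subset_itv; rewrite bnd_simp.
exact: continuous_subspaceT.
Qed.

(** The primitive vanishes left of the support, and right of it because the total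
    integral is 0. *)
Lemma test_antiderivative a b psi : a < b -> test_function a b psi -> int a b psi = 0 ->
  exists2 phi, test_function a b phi & (phi^`())%classic = psi.
Proof.
move=> ab tp I0; have [np [c [d [ac db supp]]]] := (test_functionP a b psi).1 tp.
have supp0 x : ~~ (c <= x <= d) -> psi x = 0.
  by move=> h; apply/eqP; apply: contraNT h; exact: supp.
have cpsi : continuous psi by exact: ndiff_continuous (np 1%N).
pose phi x := int a x psi.
have phi0 y : y <= c -> phi y = 0.
  move=> yc; rewrite /phi (@int_ext _ _ _ _ (fun=> 0 * 0)); last first.
    move=> z; rewrite in_itv/= mulr0 => /andP[_ zy]; apply: supp0.
    by rewrite negb_and -ltNge (lt_le_trans zy yc).
  by rewrite intZ ?mul0r//; exact: ig_cst.
have dphi x : is_derive x (1 : R) phi (psi x).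
  have [xc|cx] := ltP x c.
    rewrite supp0 ?negb_and -?ltNge ?xc//.
    apply: (@near_eq_is_derive _ _ _ (cst 0)).
    by near=> y; rewrite /= phi0// ltW//; near: y; exact: lt_nbhsl.
  have ax : a < x by exact: lt_le_trans cx.
  have iu u : mu.-integrable [set` Interval (BRight a) (BRight u)] (EFin \o psi).
    apply: integrableS (continuous_compact_integrable (@segment_compact _ a u) _) => //.
      by apply: subset_itv; rewrite bnd_simp.
    exact: continuous_subspaceT.
  have [||D E] := @continuous_FTC1 R psi (BRight a) x (x + 1) _ (iu _) _ (cpsi x).
  - by rewrite ltrDl.
  - by rewrite ?bnd_simp.
  have -> : phi = fun x => \int[mu]_(t in [set` Interval (BRight a) (BRight x)]) psi t.
    apply/funext => y; rewrite /phi /int Rintegral_itv_bndo_bndc//.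
    exact: ig_continuous.
  by rewrite -E; exact: is_derive1.
exists phi; last exact: derive1E'.
apply/test_functionP; split.
  case=> //= n; split=> [x|]; first by have [] := dphi x.
  by rewrite (derive1E' dphi).
exists c, d; split=> // x; apply: contraNT; rewrite negb_and -!ltNge => /orP[h|h].
  by apply/eqP/phi0; exact: ltW.
have tail u v : d <= u -> int u v psi = 0.
  move=> du; rewrite (@int_ext _ _ _ _ (fun=> 0 * 0)); last first.
    move=> z; rewrite in_itv/= mulr0 => /andP[uz _]; apply: supp0.
    by rewrite negb_and -!ltNge (le_lt_trans du uz) orbT.
  by rewrite intZ ?mul0r//; exact: ig_cst.
apply/eqP; rewrite /phi; have [xb|bx] := leP x b.
  have [xa|ax] := leP x a; first exact: int_empty.
  have := @int_split _ a b x psi (ltW ax) xb (ig_continuous _ _ cpsi).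
  by rewrite I0 (tail _ _ (ltW h)) addr0.
rewrite (@int_split _ a x b) ?(ltW ab) ?(ltW bx) ?I0 ?add0r ?tail ?(ltW db)//.
exact: ig_continuous.
Unshelve. all: by end_near. Qed.

Lemma sqint_cst a b k : sqint a b (fun=> k : R).
Proof. by apply: (@sqint_bounded _ _ _ _ `|k|). Qed.

(** Fixed once, such a function turns integrals into point values up to the
    oscillation. *)
Lemma test_unit a b : a < b -> exists2 chi, test_function a b chi & int a b chi = 1.
Proof.
move=> ab; pose c := (2 * a + b) / 3; pose d := (a + 2 * b) / 3.
have ac : a < c by rewrite /c; lra.
have cd : c < d by rewrite /c /d; lra.
have db : d < b by rewrite /d; lra.
have H := int_bump (ltW ac) (ltW db) (ig_cst a b 1).
have [n Hn] : exists n : nat, int a b (bump n.+1%:R c d) != 0.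
  apply: contrapT => nex.
  have E n : int a b (fun x => 1 * bump n.+1%:R c d x) = 0.
    apply/eqP/negPn/negP => h; apply: nex; exists n.
    by rewrite (@int_ext _ _ _ _ (fun x => 1 * bump n.+1%:R c d x))// => x _; rewrite mul1r.
  move: H; under eq_fun do rewrite E; move=> H.
  move: H => /(cvg_lim (@Rhausdorff R)); rewrite lim_cst// int_cst ?(ltW cd)// mul1r.
  by move=> /eqP; rewrite eq_sym subr_eq0 gt_eqF.
have tb := bump_test (ler0n R n.+1) ac db.
have t0 : test_function a b (fun=> 0).
  apply/test_functionP; split.
    by elim=> //= n' IH; split=> // ; rewrite (derive1E' (f' := fun=> 0)).
  by exists c, d; split=> // x; rewrite eqxx.
exists (fun x => (int a b (bump n.+1%:R c d))^-1 * bump n.+1%:R c d x + 0).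
  exact: test_lin.
under eq_fun do rewrite addr0.
by rewrite intZ ?mulVf//; exact: sqint_ig (test_sqint (ltW ab) tb).
Qed.

(** Subtracting a multiple of a fixed chi of integral 1 makes every test function
    a derivative of a test function. *)
Lemma du_bois_reymond a b f : a < b -> sqint a b f ->
  (forall phi, test_function a b phi -> int a b (fun x => f x * (phi^`())%classic x) = 0) ->
  exists k, aeq a b f (fun=> k).
Proof.
move=> ab sf H; have [chi tchi Ichi] := test_unit ab.
have sT phi : test_function a b phi -> sqint a b phi by exact: test_sqint (ltW ab).
pose k := int a b (fun x => f x * chi x).
have sk : sqint a b (fun x => f x - k) by apply: sqintB => //; exact: sqint_cst.
exists k; suff : aeq a b (fun x => f x - k) (fun=> 0).
  by apply: ae_map => x h xab; apply/eqP; rewrite -subr_eq0 h.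
apply: fundamental_lemma; first exact: sqint_ig.
move=> phi tphi; pose s := int a b phi.
have tpsi := test_lin (- s) tchi tphi.
have [|Phi tPhi EPhi] := test_antiderivative ab tpsi.
  rewrite intD ?intZ ?Ichi ?mulr1 ?addNr//.
  - exact: sqint_ig (sT _ tchi).
  - by apply: igZ; exact: sqint_ig (sT _ tchi).
  - exact: sqint_ig (sT _ tphi).
have := H _ tPhi; rewrite EPhi.
rewrite (@int_ext _ _ _ _ (fun x => - s * (f x * chi x) + f x * phi x)); last by move=> x _; ring.
rewrite intD ?intZ; last 3 first.
- exact: sqintM (sT _ tchi).
- by apply: igZ; exact: sqintM (sT _ tchi).
- exact: sqintM (sT _ tphi).
move=> E; rewrite (@int_ext _ _ _ _ (fun x => f x * phi x - k * phi x)); last by move=> x _; ring.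
rewrite intB ?intZ; last 3 first.
- exact: sqint_ig (sT _ tphi).
- exact: sqintM (sT _ tphi).
- by apply: igZ; exact: sqint_ig (sT _ tphi).
by rewrite -/s; move: E; rewrite -/k => E; rewrite mulNr in E; rewrite mulrC -E; ring.
Qed.

Lemma rwd_uniq n a b f g h : a < b -> sqint a b g -> sqint a b h ->
  rwd n a b f g -> rwd n a b f h -> aeq a b g h.
Proof.
move=> ab sg sh wg wh.
suff : aeq a b (fun x => g x - h x) (fun=> 0).
  by apply: ae_map => x E xab; apply/eqP; rewrite -subr_eq0 E.
apply: fundamental_lemma; first by apply: sqint_ig; exact: sqintB.
move=> phi tphi; have sphi := test_sqint (ltW ab) tphi.
rewrite (@int_ext _ _ _ _ (fun x => g x * phi x - h x * phi x)); last by move=> x _; ring.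
rewrite intB ?sqintM//; apply/eqP; rewrite subr_eq0.
have := wg _ tphi; rewrite wh// => /eqP; rewrite eq_sym.
by rewrite (inj_eq (mulfI _))// expf_neq0// oppr_eq0 oner_eq0.
Qed.

Lemma prim_rwd a b F f : a < b -> prim a b F f -> rwd 1 a b F f.
Proof.
move=> ab pF phi tphi; have := byparts (ltW ab) pF (test_prim (ltW ab) tphi).
have [-> ->] := test_bound0 ab tphi; rewrite !mulr0 subrr => /eqP.
by rewrite addr_eq0 expr1 mulN1r => /eqP.
Qed.

Lemma rwd_derive n a b f phi g : rwd n a b f g -> test_function a b phi ->
  int a b (fun x => f x * derive1n n.+1 phi x) =
  (-1) ^+ n * int a b (fun x => g x * (phi^`())%classic x).
Proof. by move=> w tphi; rewrite derive1nSr w//; exact: test_derive. Qed.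

Lemma rwd_comp n a b f g h : rwd n a b f g -> rwd 1 a b g h -> rwd n.+1 a b f h.
Proof.
move=> wf wg phi tphi; rewrite (rwd_derive wf tphi) -[(phi^`())%classic]/(derive1n 1 phi).
by rewrite wg// expr1 mulN1r exprSr mulrN1 mulNr mulrN.
Qed.

Lemma rwd_step n a b f g h : rwd n a b f g -> rwd n.+1 a b f h -> rwd 1 a b g h.
Proof.
move=> wf wg phi tphi; have := wg _ tphi; rewrite (rwd_derive wf tphi).
rewrite exprS -mulrA mulrCA => /(mulfI _) ->//; rewrite ?expr1//.
by rewrite expf_neq0// oppr_eq0 oner_eq0.
Qed.

Lemma rwd_prim a b f g : a < b -> sqint a b f -> sqint a b g -> rwd 1 a b f g ->
  exists k, aeq a b f (fun x => k + int a x g).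
Proof.
move=> ab sf sg w; have pG := prim_int 0 sg.
have sG := prim_sqint (ltW ab) pG.
have [|phi tphi|k Hk] := @du_bois_reymond a b (fun x => f x - (0 + int a x g)) ab.
- exact: sqintB.
- have tphi' := test_derive tphi.
  have sp := test_sqint (ltW ab) tphi'.
  rewrite (@int_ext _ _ _ _ (fun x => f x * derive1n 1 phi x -
    (0 + int a x g) * derive1n 1 phi x)); last by move=> x _; rewrite derive1n1; ring.
  rewrite intB ?derive1n1 ?sqintM// -derive1n1 w// (prim_rwd ab pG)//.
  by rewrite subrr.
by exists k; apply: ae_map Hk => x E xab; rewrite -(E xab); ring.
Qed.

Lemma aeq_continuous a b f g : {in `]a, b[, continuous f} -> {in `]a, b[, continuous g} ->
  aeq a b f g -> {in `]a, b[, f =1 g}.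
Proof.
move=> cf cg [N [mN N0 NS]] x xab; apply/eqP/negPn/negP => fgx.
have /andP[ax xb] : a < x < b by rewrite in_itv/= in xab.
have nx : \forall y \near x, (y \in `]a, b[) /\ (f y != g y).
  have cfg : {for x, continuous (fun x => f x - g x)}.
    by apply: continuousB; [exact: cf|exact: cg].
  have fg0 : f x - g x != 0 by rewrite subr_eq0.
  have h1 : \forall y \near x, f y - g y != 0 by exact: (cvgr_neq0 _ cfg fg0).
  near=> y; split; last by rewrite -subr_eq0; near: y.
  rewrite in_itv/=; apply/andP; split; first by near: y; exact: lt_nbhsr.
  by near: y; exact: lt_nbhsl.
move/nbhs_ballP: nx => [e /= e0 He].
have sub : `]x - e, x + e[%classic `<=` N.
  move=> y /=; rewrite in_itv/= => /andP[y1 y2]; apply: NS => /= E.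
  have [|yab] := He y; first by rewrite /ball/= ltr_norml; apply/andP; split; lra.
  by rewrite E// eqxx.
have h : (mu (`](x - e)%R, (x + e)%R[%classic) <= mu N)%E by apply: le_measure; rewrite ?inE.
rewrite N0 lebesgue_measure_itv/= lte_fin ifT in h; last by move: e0; clear; lra.
by rewrite -EFinB lee_fin in h; move: h e0; clear; lra.
Unshelve. all: by end_near. Qed.

(** Membership in the Sobolev space of order n of one real component. *)
Definition sob n a b f := sqint a b f /\
  forall j, (j <= n)%N -> exists2 g, sqint a b g & rwd j a b f g.

(** Each g j is almost everywhere a primitive of g j.+1; correcting the g j from
    the top down gives representatives that are primitives everywhere. *)
Lemma prim_chain n a b (g : nat -> R -> R) : a < b ->
  (forall j, (j <= n)%N -> sqint a b (g j)) ->
  (forall j, (j < n)%N -> rwd 1 a b (g j) (g j.+1)) ->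
  exists G : nat -> R -> R,
    [/\ forall j, (j <= n)%N -> sqint a b (G j),
        forall j, (j <= n)%N -> aeq a b (g j) (G j) &
        forall j, (j < n)%N -> prim a b (G j) (G j.+1)].
Proof.
move=> ab; elim: n g => [|n IH] g sg wg.
  by exists g; split=> // j _; exact: aeq_refl.
have [G [sG gG pG]] := IH (fun j => g j.+1) (fun j => sg j.+1) (fun j => wg j.+1).
have [k Hk] := rwd_prim ab (sg 0%N isT) (sg 1%N isT) (wg 0%N isT).
have p0 : prim a b (fun x => k + int a x (G 0%N)) (G 0%N) by exact: prim_int (sG 0%N isT).
exists (fun j => if j is i.+1 then G i else fun x => k + int a x (G 0%N)); split.
- by case=> [_|j jn]; [exact: prim_sqint (ltW ab) p0|exact: sG].
- case=> [_|j jn]; last exact: gG.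
  apply: aeq_trans Hk _; apply: aeW => x; rewrite in_itv/= => /andP[ax xb].
  congr (_ + _); apply: (@aeq_int _ a b) => //; first exact: ltW.
  + exact: sqint_ig (sg 1%N isT).
  + exact: sqint_ig (sG 0%N isT).
  + exact: gG 0%N isT.
- by case=> [_|j jn]; [exact: p0|exact: pG].
Qed.

(** A continuous function with n + 1 weak derivatives is the first of a chain of
    iterated primitives, so its classical derivatives up to order n exist and have
    one-sided limits at the ends. *)
Lemma sob_chain n a b f : a < b -> sob n.+1 a b f -> {in `]a, b[, continuous f} ->
  exists G : nat -> R -> R,
    {in `]a, b[, f =1 G 0%N} /\ forall j, (j < n.+1)%N -> prim a b (G j) (G j.+1).
Proof.
move=> ab [sf H] cf.
have /choice[g Hg] (j : nat) : exists g, (j <= n.+1)%N -> sqint a b g /\ rwd j a b f g.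
  have [jn|jn] := leqP j n.+1; last by exists f.
  by have [g sg wg] := H j jn; exists g.
have [|j jn|G [sG gG pG]] := @prim_chain n.+1 a b g ab.
- by move=> j /Hg[].
- by have [_ w1] := Hg _ jn; have [_ w0] := Hg _ (ltnW jn); exact: rwd_step w0 w1.
exists G; split=> //.
have [sg0 wg0] := Hg 0%N isT.
apply: aeq_continuous => //; first by move=> x; exact: (prim_continuous (pG 0%N isT)).
apply: aeq_trans (gG 0%N isT).
apply: (rwd_uniq (n := 0) ab sf sg0 _ wg0).
by move=> phi _; rewrite derive1n0 expr0 mul1r.
Qed.

Lemma prim_rwd2 a b F f g : a < b -> prim a b F f -> prim a b f g -> rwd 2 a b F g.
Proof. by move=> ab pF pf; apply: rwd_comp (prim_rwd ab pf); exact: prim_rwd. Qed.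

Lemma prim_sob2 a b F f g : a < b -> prim a b F f -> prim a b f g -> sob 2 a b F.
Proof.
move=> ab pF pf; split; first exact: prim_sqint (ltW ab) pF.
case=> [_|[_|[_|//]]].
- exists F; first exact: prim_sqint (ltW ab) pF.
  by move=> phi _; rewrite derive1n0 expr0 mul1r.
- by exists f; [case: pF|exact: prim_rwd].
- by exists g; [case: pf|exact: prim_rwd2 pF pf].
Qed.

Lemma prim_derivable a b F f x : prim a b F f -> {in `]a, b[, continuous f} ->
  x \in `]a, b[ -> is_derive x (1 : R) F (f x).
Proof.
move=> pF cf xab; have /andP[ax xb] : a < x < b by rewrite in_itv/= in xab.
pose u := (x + b) / 2; have xu : x < u by rewrite /u; lra.
have ub : u < b by rewrite /u; lra.
have [sf FE] := pF.
have iu : mu.-integrable [set` Interval (BRight a) (BRight u)] (EFin \o f).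
  by apply: integrableS (sqint_ig sf) => //; apply: subset_itv; rewrite bnd_simp.
have [|D E] := @continuous_FTC1 R f (BRight a) x u xu iu _ (cf x xab).
  by rewrite ?bnd_simp.
have := is_derive1 D; rewrite E => D'.
have dF : is_derive x (1 : R) (fun y => F a + \int[mu]_(t in [set` Interval (BRight a) (BRight y)]) f t) (f x).
  by rewrite -[f x]add0r; apply: is_deriveD; exact: is_derive_cst.
apply: near_eq_is_derive dF; near=> y.
have ay : a < y by near: y; exact: lt_nbhsr.
have yb : y < b by near: y; exact: lt_nbhsl.
rewrite (FE y) ?ltW//; congr (_ + _); rewrite /int Rintegral_itv_bndo_bndc//.
exact: (ig_sub (lexx a) (ltW yb) (sqint_ig sf)).
Unshelve. all: by end_near. Qed.

End WeakDerivative.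

(** * Completeness of the square-integrable functions *)

Section RieszFischer.
Context {R : realType}.
Notation mu := (@lebesgue_measure R).
Implicit Types (a b c d x y : R) (f g h F G : R -> R).

Lemma int_fatou a b (f_ : nat -> R -> R) f c :
  (forall n, ig a b (f_ n)) -> (forall n x, x \in `]a, b[ -> 0 <= f_ n x) ->
  (forall n, int a b (f_ n) <= c) ->
  (forall x, x \in `]a, b[ -> f_ n x @[n --> \oo] --> f x) ->
  ig a b f /\ int a b f <= c.
Proof.
move=> igf f0 fc ff.
have mf : measurable_fun `]a, b[ f.
  by apply: (@measurable_fun_cvg _ _ _ _ f_) => // n; exact: ig_meas.
have ef n : (\int[mu]_(x in `]a, b[) (f_ n x)%:E)%E = (int a b (f_ n))%:E.
  by rewrite /int /Rintegral fineK//; apply: integrable_fin_num => //; exact: igf.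
have h1 := @fatou _ _ _ mu `]a, b[%classic (measurable_itv _) (fun n x => (f_ n x)%:E)
  (fun n => (measurable_EFinP _ _).2 (ig_meas (igf n))) (fun n x xab => f0 n x xab).
have h2 : (\int[mu]_(x in `]a, b[) (f x)%:E <= c%:E)%E.
  apply: le_trans (le_trans h1 _).
    rewrite le_eqVlt; apply/orP; left; apply/eqP; apply: eq_integral => x.
    rewrite inE/= => xab; rewrite is_cvg_limn_einfE; last first.
      by apply/cvg_ex; exists (f x)%:E; apply: cvg_EFin; [near=> n|exact: ff].
    apply/esym/cvg_lim => //; apply: cvg_EFin; [near=> n|exact: ff] => //.
  rewrite limn_einf_lim; apply: lime_le; first exact: is_cvg_einfs.
  apply: nearW => n; apply: (@le_trans _ _ (\int[mu]_(x in `]a, b[) (f_ n x)%:E)%E).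
    by apply: ereal_inf_lbound; exists n => //=.
  by rewrite ef lee_fin.
have f0' x : x \in `]a, b[ -> 0 <= f x.
  move=> xab; rewrite -(cvg_lim (@Rhausdorff R) (ff x xab)); apply: limr_ge.
    by apply/cvg_ex; exists (f x); exact: ff.
  by apply: nearW => n; exact: f0.
have igff : ig a b f.
  apply/integrableP; split; first exact/measurable_EFinP.
  apply: le_lt_trans (ltry c); apply: le_trans h2.
  rewrite le_eqVlt; apply/orP; left; apply/eqP; apply: eq_integral => x.
  by rewrite inE/= => xab; rewrite ger0_norm// f0'.
split=> //; rewrite /int /Rintegral -lee_fin fineK//.
by apply: integrable_fin_num => //; exact: igff.
Unshelve. all: by end_near. Qed.

(** The partial sums of |d_k| are increasing with bounded integral, so Fatou makes
    their limit finite almost everywhere. *)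
Lemma ae_summable a b (d_ : nat -> R -> R) c : (forall k, ig a b (d_ k)) ->
  (forall k, int a b (fun x => `|d_ k x|) <= c * 2^-1 ^+ k) ->
  exists E : set R, [/\ measurable E, {ae mu, forall x, x \in `]a, b[ -> E x},
    E `<=` `]a, b[%classic & forall x, E x -> cvgn (series (d_ ^~ x))].
Proof.
move=> igd dc; pose t k x := (`|d_ k x|%:E : \bar R).
have mt k : measurable_fun `]a, b[ (t k).
  by apply/measurable_EFinP; apply: ig_meas; exact: ig_abs.
pose S x := (\sum_(k <oo) t k x)%E.
have mS : measurable_fun `]a, b[ S.
  by apply: ge0_emeasurable_sum => // k x _ _; rewrite lee_fin.
have S0 x : (0 <= S x)%E by apply: nneseries_ge0 => k _ _; rewrite lee_fin.
have IS : (\int[mu]_(x in `]a, b[) S x < +oo)%E.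
  rewrite integral_nneseries//; last by move=> k x _; rewrite lee_fin.
  have ek k : (\int[mu]_(x in `]a, b[) t k x)%E = (int a b (fun x => `|d_ k x|))%:E.
    rewrite /int /Rintegral fineK//; apply: integrable_fin_num => //.
    exact: ig_abs.
  have c0 : 0 <= c.
    by have := dc 0%N; rewrite expr0 mulr1; apply: le_trans; exact: int_ge0.
  apply: le_lt_trans (ltry (c * 2)); apply: lime_le.
    by apply: is_cvg_nneseries => k _ _; apply: integral_ge0 => x _; rewrite lee_fin.
  apply: nearW => n; under eq_bigr do rewrite ek.
  rewrite sumEFin lee_fin big_mkord.
  apply: (@le_trans _ _ (\sum_(k < n) c * 2^-1 ^+ k)); first exact: ler_sum.
  rewrite -mulr_sumr ler_wpM2l//.
  have -> : \sum_(k < n) 2^-1 ^+ k = 2 - 2 * 2^-1 ^+ n :> R.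
    elim: n => [|n IH]; first by rewrite big_ord0 expr0 mulr1 subrr.
    by rewrite big_ord_recr IH /= exprS; lra.
  by rewrite gerBl mulr_ge0// exprn_ge0 ?invr_ge0.
exists (`]a, b[%classic `&` [set x | S x < +oo]%E); split.
- exact: emeasurable_fun_infty_o.
- have iS : mu.-integrable `]a, b[ S.
    apply/integrableP; split=> //; apply: le_lt_trans IS.
    rewrite le_eqVlt; apply/orP; left; apply/eqP; apply: eq_integral => x _.
    by rewrite gee0_abs.
  apply: ae_map (integrable_ae _ iS) => // x h xab; split=> //=.
  by rewrite -ge0_fin_numE// h.
- by move=> x [].
- move=> x [xab Sx]; apply: normed_cvg; apply: nondecreasing_is_cvgn.
    by apply: nondecreasing_series => k _ _ /=.
  exists (fine (S x)) => _ [n _ <-]; rewrite -lee_fin fineK ?ge0_fin_numE//.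
  rewrite /series /= -sumEFin.
  by apply: nneseries_lim_ge => k _; rewrite lee_fin.
Qed.


(** A fast subsequence converges almost everywhere; Fatou identifies its limit as
    the limit in mean square of the whole sequence. *)
Theorem riesz_fischer a b (f : nat -> R -> R) : a <= b -> (forall n, sqint a b (f n)) ->
  (forall e, 0 < e -> exists N, forall m n, (N <= m)%N -> (N <= n)%N ->
     int a b (fun x => (f m x - f n x) ^+ 2) <= e) ->
  exists2 g, sqint a b g & forall e, 0 < e -> exists N, forall n, (N <= n)%N ->
     int a b (fun x => (f n x - g x) ^+ 2) <= e.
Proof.
move=> ab sf Cf.
have p k : 0 < (2^-1 ^+ k) ^+ 2 :> R by rewrite !exprn_gt0 ?invr_gt0.
have /choice[N HN] k := Cf _ (p k).
pose i k := (k + \sum_(j < k.+1) N j)%N.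
have Ni j k : (j <= k)%N -> (N j <= i k)%N.
  move=> jk; rewrite /i (bigD1 (Ordinal (jk : (j < k.+1)%N)))//= addnCA.
  exact: leq_addr.
have ki k : (k <= i k)%N by exact: leq_addr.
pose d k x := f (i k.+1) x - f (i k) x.
have sd k : sqint a b (d k) by exact: sqintB.
have [||E [mE aE Eab cE]] := @ae_summable a b d (b - a + 1).
- by move=> k; exact: sqint_ig.
- move=> k; have q0 : 0 < 2^-1 ^+ k :> R by rewrite exprn_gt0 ?invr_gt0.
  have sabs : sqint a b (fun x => `|d k x|).
    have [md d2] := sd k; split; first exact: (measurableT_comp (@normr_measurable R setT)).
    by apply: ig_ext d2 => x _; rewrite real_normK ?num_real.
  rewrite (le_trans (ler_norm _))// (le_trans (int_young ab q0 sabs))//.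
  rewrite mulrDl mul1r mulrC lerD2l -(ler_pM2l q0) mulrA divff ?gt_eqF// mul1r -expr2.
  rewrite (@int_ext _ _ _ _ (fun x => (d k x) ^+ 2)); last first.
    by move=> x _; rewrite real_normK ?num_real.
  by apply: HN; apply: Ni.
pose h k x := f (i k) x * \1_E x.
pose g x := limn (h ^~ x).
have hE k x : E x -> h k x = f (i k) x by move=> Ex; rewrite /h indicE mem_set ?mulr1.
have hg x : h k x @[k --> \oo] --> g x.
  have [Ex|nEx] := pselect (E x).
    rewrite (_ : (fun k => h k x) = (fun k => f (i 0%N) x + series (d ^~ x) k)).
      have : cvg ((fun k => f (i 0%N) x + series (d ^~ x) k) @ \oo).
        by apply: is_cvgD; [exact: is_cvg_cst|exact: cE].
      rewrite /g; suff -> : (h ^~ x) = (fun k => f (i 0%N) x + series (d ^~ x) k) by [].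
      apply/funext => k; rewrite hE// /series /= telescope_sumr//; ring.
    apply/funext => k; rewrite hE// /series /= telescope_sumr//; ring.
  have h0 : (h ^~ x) = (fun=> 0).
    by apply/funext => k; rewrite /h indicE memNset// mulr0.
  by rewrite /g h0 lim_cst//; exact: cvg_cst.
have fh k : aeq a b (f (i k)) (h k).
  by apply: ae_map aE => x Ex /Ex xE; rewrite hE.
have mh k : measurable_fun `]a, b[ (h k).
  apply: measurable_funM; first by case: (sf (i k)).
  exact: measurable_indic.
have sh k : sqint a b (h k) by exact: sqint_aeq (sf (i k)) (mh k) (fh k).
have mg : measurable_fun `]a, b[ g.
  by apply: (@measurable_fun_cvg _ _ _ _ h) => // x _; exact: hg.
have key e N0 n : (forall m n, (N0 <= m)%N -> (N0 <= n)%N ->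
     int a b (fun x => (f m x - f n x) ^+ 2) <= e) -> (N0 <= n)%N ->
  ig a b (fun x => (f n x - g x) ^+ 2) /\ int a b (fun x => (f n x - g x) ^+ 2) <= e.
  move=> He nN; apply: (@int_fatou _ _ (fun k x => (f n x - h (k + N0)%N x) ^+ 2)).
  - by move=> k; have [] := sqintB (sf n) (sh (k + N0)%N).
  - by move=> k x _; exact: sqr_ge0.
  - move=> k; have iN : (N0 <= i (k + N0))%N by rewrite (leq_trans _ (ki _))// leq_addl.
    rewrite (_ : int _ _ _ = int a b (fun x => (f n x - f (i (k + N0)%N) x) ^+ 2)); first exact: He.
    have [_ i1] := sqintB (sf n) (sh (k + N0)%N).
    have [_ i2] := sqintB (sf n) (sf (i (k + N0)%N)).
    apply: (@aeq_int _ a b) => //; apply: ae_map (fh (k + N0)%N) => x E1 xab.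
    by rewrite -E1.
  - move=> x _; have h1 : h (k + N0)%N x @[k --> \oo] --> g x.
      by have := hg x; rewrite -(cvg_shiftn N0).
    have h2 : f n x - h (k + N0)%N x @[k --> \oo] --> f n x - g x.
      by apply: cvgB => //; exact: cvg_cst.
    by under eq_fun do rewrite expr2; rewrite expr2; exact: cvgM.
exists g.
  have [N0 HN0] := Cf 1 ltr01; have [i1 _] := key 1 N0 N0 HN0 (leqnn _).
  apply: (@sqint_ext _ _ _ (fun x => f N0 x - (f N0 x - g x))).
    by move=> x _; ring.
  apply: sqintB => //; split=> //; apply: measurable_funB => //.
  by case: (sf N0).
move=> e e0; have [N0 HN0] := Cf e e0; exists N0 => n nN.
by have [] := key e N0 n HN0 nN.
Qed.

End RieszFischer.

(** * Real and imaginary parts *)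

Section Components.
Context {R : realType}.
Local Open Scope complex_scope.
Implicit Types (a b x y r : R) (i : bool) (z w : R[i]) (f g : R -> R[i]).

(** Every argument is carried out on real functions, for the two components at
    once; false selects the real part. *)
Definition coc i z : R := if i then complex.Im z else complex.Re z.
Definition co i f : R -> R := fun x => coc i (f x).

Lemma cocD i z w : coc i (z + w) = coc i z + coc i w.
Proof. by case: i z w => [] [a b] [c d]. Qed.
Lemma cocN i z : coc i (- z) = - coc i z.
Proof. by case: i z => [] [a b]. Qed.
Lemma cocB i z w : coc i (z - w) = coc i z - coc i w.
Proof. by rewrite cocD cocN. Qed.
Lemma coc0 i : coc i 0 = 0. Proof. by case: i. Qed.
Lemma cocZ i r z : coc i (r%:C * z) = r * coc i z.
Proof. by case: i z => [] [a b] /=; rewrite mul0r ?subr0 ?addr0 // mulr0 ?addr0. Qed.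
Lemma cocZr i r z : coc i (z * r%:C) = coc i z * r.
Proof. by rewrite mulrC cocZ mulrC. Qed.
Lemma coc_sign i n z : coc i ((-1) ^+ n * z) = (-1) ^+ n * coc i z.
Proof.
elim: n z => [|n IH] z; first by rewrite !expr0 !mul1r.
by rewrite !exprS -!mulrA mulN1r cocN IH mulN1r.
Qed.
Lemma coc_conj z w : complex.Re (z * w^*) = coc false z * coc false w + coc true z * coc true w.
Proof. by case: z w => [a b] [c d] /=; rewrite mulrN opprK. Qed.
Lemma coc_i z i : coc i ('i * z) = if i then coc false z else - coc true z.
Proof. by case: i z => [] [a b] /=; rewrite !mul0r ?mul1r ?add0r ?sub0r. Qed.
Lemma coc_sum i (J : Type) (s : seq J) (P : pred J) (F : J -> R[i]) :
  coc i (\sum_(j <- s | P j) F j) = \sum_(j <- s | P j) coc i (F j).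
Proof. by elim/big_ind2: _ => [|x y z w <- <-|//]; rewrite ?coc0 ?cocD. Qed.
Lemma coc_eq z w : (forall i, coc i z = coc i w) -> z = w.
Proof.
by case: z w => [a b] [c d] H; have /= -> := H true; have /= -> := H false.
Qed.

Lemma coc_cint i a b f : coc i (cint a b f) = int a b (co i f).
Proof. by case: i. Qed.

Lemma sqmodE z : sqmod z = coc false z ^+ 2 + coc true z ^+ 2. Proof. by []. Qed.

Lemma L2P a b f : L2 a b f <-> forall i, sqint a b (co i f).
Proof.
split=> [[mr mi igs] i|H].
  have m i' : measurable_fun `]a, b[ (co i' f) by case: i'.
  split; first exact: m.
  apply: (ig_le _ (igs : ig a b _)); first exact: measurable_funX.
  move=> x _; rewrite ger0_norm ?sqr_ge0// sqmodE /co.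
  by case: i; rewrite ?lerDl ?lerDr sqr_ge0.
have [[mr ir] [mi ii]] := (H false, H true); split=> //.
exact: (igD ir ii).
Qed.

Lemma weakP n a b f g : weak_derivative n a b f g <-> forall i, rwd n a b (co i f) (co i g).
Proof.
have E i phi F : coc i (cint a b (fun x => F x * (phi x)%:C)) = int a b (fun x => co i F x * phi x).
  by rewrite coc_cint; apply: int_ext => x _; rewrite /co cocZr.
split=> [H i phi tphi|H phi tphi].
  by have := congr1 (coc i) (H phi tphi); rewrite coc_sign !E.
by apply: coc_eq => i; rewrite coc_sign !E; exact: H.
Qed.

Lemma SobolevP n a b f : Sobolev n a b f -> forall i, sob n a b (co i f).
Proof.
move=> [/L2P sf H] i; split; first exact: sf.
by move=> j /H[g /L2P sg /weakP wg]; exists (co i g).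
Qed.

Lemma co_pair (F : bool -> R -> R) i : co i (fun x => F false x +i* F true x) = F i.
Proof. by case: i. Qed.

Lemma Sobolev_sob n a b f : (forall i, sob n a b (co i f)) -> Sobolev n a b f.
Proof.
move=> H; split; first by apply/L2P => i; case: (H i).
move=> j jn; have [[_ /(_ j jn)[g0 s0 w0]] [_ /(_ j jn)[g1 s1 w1]]] := (H false, H true).
exists (fun x => g0 x +i* g1 x).
  by apply/L2P => i; rewrite (co_pair (fun i => if i then g1 else g0)); case: i.
by apply/weakP => i; rewrite (co_pair (fun i => if i then g1 else g0)); case: i.
Qed.

Lemma wderivP n a b f : Sobolev n a b f ->
  forall i, sqint a b (co i (wderiv n a b f)) /\ rwd n a b (co i f) (co i (wderiv n a b f)).
Proof.
move=> [_ /(_ n (leqnn n))[g Lg wg]].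
have /= [L W] := @xgetPex _ (fun=> 0 : R[i]) [set g | L2 a b g /\ weak_derivative n a b f g]
  (ex_intro _ g (conj Lg wg)).
by move=> i; split; [exact: (L2P _ _ _).1|exact: (weakP _ _ _ _ _).1].
Qed.

Lemma ccontinuousP D f : ccontinuous D f <-> forall i, {within D, continuous (co i f)}.
Proof. by split=> [[] ? ? []//|H]; split; [exact: (H false)|exact: (H true)]. Qed.

Lemma prim_within (a b : R) (F f : R -> R) : a < b -> prim a b F f ->
  {within `[a, b], continuous F}.
Proof.
move=> ab pF; apply/continuous_within_itvP => //; split.
- by move=> x xab; exact: prim_continuous pF xab.
- apply/cvgrPdist_le => e e0; have [d d0 H] := prim_unif (ltW ab) pF e0.
  have d1 : a < a + d by rewrite ltrDl.
  near=> y; rewrite distrC; apply: H => //.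
    by apply: ltW; near: y; exact: nbhs_right_lt.
  by rewrite lerBlDl; apply: ltW; near: y; exact: nbhs_right_lt.
- apply/cvgrPdist_le => e e0; have [d d0 H] := prim_unif (ltW ab) pF e0.
  have d1 : b - d < b by rewrite gtrBl.
  near=> y; apply: H => //.
    by apply: ltW; near: y; exact: nbhs_left_gt.
  by rewrite lerBlDr -lerBlDl; apply: ltW; near: y; exact: nbhs_left_gt.
Unshelve. all: by end_near. Qed.

Lemma prim_cvg_right (a b : R) (F f : R -> R) : a < b -> prim a b F f -> F x @[x --> a^'+] --> F a.
Proof. by move=> ab /(prim_within ab) /(continuous_within_itvP _ ab)[]. Qed.

Lemma prim_cvg_left (a b : R) (F f : R -> R) : a < b -> prim a b F f -> F x @[x --> b^'-] --> F b.
Proof. by move=> ab /(prim_within ab) /(continuous_within_itvP _ ab)[]. Qed.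

Lemma eq_closed (a b : R) (f g : R -> R) : a < b -> {within `[a, b], continuous f} ->
  {within `[a, b], continuous g} -> {in `]a, b[, f =1 g} -> {in `[a, b], f =1 g}.
Proof.
move=> ab /(continuous_within_itvP _ ab)[_ fa fb] /(continuous_within_itvP _ ab)[_ ga gb] fg.
move=> x; rewrite in_itv/= !le_eqVlt => /andP[].
move=> /predU1P[<- _|ax /predU1P[->|xb]]; last by apply: fg; rewrite in_itv/= ax.
  apply: (cvg_unique (@Rhausdorff R) fa); apply: cvg_trans ga.
  apply: near_eq_cvg; near=> y; rewrite fg// in_itv/=; apply/andP; split.
    by near: y; exact: nbhs_right_gt.
  by near: y; exact: nbhs_right_lt.
apply: (cvg_unique (@Rhausdorff R) fb); apply: cvg_trans gb.
apply: near_eq_cvg; near=> y; rewrite fg// in_itv/=; apply/andP; split.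
  by near: y; exact: nbhs_left_gt.
by near: y; exact: nbhs_left_lt.
Unshelve. all: by end_near. Qed.

Lemma prim_eq (a b : R) (F G f : R -> R) : a <= b -> {in `[a, b], F =1 G} -> prim a b G f -> prim a b F f.
Proof.
move=> ab FG [sf H]; split=> // x ax xb.
by rewrite !FG ?in_itv/= ?lexx ?ax ?xb ?ab//; exact: H.
Qed.

Lemma prim_aeq (a b : R) (F f g : R -> R) : prim a b F f -> sqint a b g -> aeq a b f g -> prim a b F g.
Proof.
move=> [sf H] sg fg; split=> // x ax xb; rewrite H//; congr (_ + _).
by apply: (@aeq_int _ a b) => //; exact: sqint_ig.
Qed.

End Components.

(** * The energy space *)

Section EnergySpace.
Context {R : realType}.
Local Open Scope complex_scope.
Variable b : beam R.
Local Notation l := (len b).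
Implicit Types (i : bool) (f g w z : R -> R) (u v : R -> R[i]) (xi eta zeta : state R) (r : R).

Lemma st_u_lin (c : R[i]) xi eta x : st_u (c *: xi + eta) x = c * st_u xi x + st_u eta x.
Proof. by []. Qed.
Lemma st_v_lin (c : R[i]) xi eta x : st_v (c *: xi + eta) x = c * st_v xi x + st_v eta x.
Proof. by []. Qed.
Lemma st_p_lin (c : R[i]) xi eta : st_p (c *: xi + eta) = c * st_p xi + st_p eta.
Proof. by []. Qed.
Lemma st_q_lin (c : R[i]) xi eta : st_q (c *: xi + eta) = c * st_q xi + st_q eta.
Proof. by []. Qed.
Lemma st_uZ (c : R[i]) xi x : st_u (c *: xi) x = c * st_u xi x. Proof. by []. Qed.
Lemma st_vZ (c : R[i]) xi x : st_v (c *: xi) x = c * st_v xi x. Proof. by []. Qed.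
Lemma st_pZ (c : R[i]) xi : st_p (c *: xi) = c * st_p xi. Proof. by []. Qed.
Lemma st_qZ (c : R[i]) xi : st_q (c *: xi) = c * st_q xi. Proof. by []. Qed.
Lemma st_uB xi eta x : st_u (xi - eta) x = st_u xi x - st_u eta x. Proof. by []. Qed.
Lemma st_vB xi eta x : st_v (xi - eta) x = st_v xi x - st_v eta x. Proof. by []. Qed.
Lemma st_pB xi eta : st_p (xi - eta) = st_p xi - st_p eta. Proof. by []. Qed.
Lemma st_qB xi eta : st_q (xi - eta) = st_q xi - st_q eta. Proof. by []. Qed.
Definition stE := (st_u_lin, st_v_lin, st_p_lin, st_q_lin, st_uZ, st_vZ, st_pZ, st_qZ,
  st_uB, st_vB, st_pB, st_qB).

Lemma l_gt0 : 0 < l. Proof. exact: len_gt0. Qed.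

(** Real form of H2o, with a representative w of the second derivative. *)
Definition H2c f w := exists f1, [/\ prim 0 l f f1, prim 0 l f1 w, f 0 = 0 & f l = 0].

Lemma H2c_sqint f w : H2c f w -> sqint 0 l w.
Proof. by move=> [f1 [_ [] ]]. Qed.

Lemma H2c_lin r f w g z : H2c f w -> H2c g z ->
  H2c (fun x => r * f x + g x) (fun x => r * w x + z x).
Proof.
move=> [f1 [pf pf1 f0 fl]] [g1 [pg pg1 g0 gl]]; exists (fun x => r * f1 x + g1 x); split.
- by apply: primD => //; exact: primZ.
- by apply: primD => //; exact: primZ.
- by rewrite f0 g0 mulr0 addr0.
- by rewrite fl gl mulr0 addr0.
Qed.

Lemma H2c_uniq f w z : H2c f w -> H2c f z -> aeq 0 l w z.
Proof.
move=> [f1 [pf pf1 _ _]] [g1 [pg pg1 _ _]].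
apply: (@rwd_uniq _ 2 0 l f) l_gt0 _ _ _ _; first by case: pf1.
- by case: pg1.
- exact: (prim_rwd2 l_gt0 pf pf1).
- exact: (prim_rwd2 l_gt0 pg pg1).
Qed.

(** The boundary conditions make the components iterated primitives; continuity up
    to the boundary identifies the values everywhere on the interval. *)
Lemma H2oP u : H2o b u <-> forall i, exists w, H2c (co i u) w.
Proof.
split=> [[Su /ccontinuousP cu u0 ul] i|H].
  have Si := SobolevP Su i.
  have [_ ci _] := (continuous_within_itvP _ l_gt0).1 (cu i).
  have [cin c0 cl] := (continuous_within_itvP _ l_gt0).1 (cu i).
  have [G [uG pG]] := sob_chain l_gt0 Si cin.
  have p0 := pG 0%N isT; have p1 := pG 1%N isT.
  have E := eq_closed l_gt0 (cu i) (prim_within l_gt0 p0) uG.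
  exists (G 2%N), (G 1%N); split => //; first exact: prim_eq (ltW l_gt0) E p0.
    by rewrite /co u0 coc0.
  by rewrite /co ul coc0.
split.
- apply: Sobolev_sob => i; have [w [f1 [pf pf1 _ _]]] := H i.
  exact: prim_sob2 l_gt0 pf pf1.
- apply/ccontinuousP => i; have [w [f1 [pf pf1 _ _]]] := H i.
  exact: prim_within l_gt0 pf.
- apply: coc_eq => i; have [w [f1 [_ _ f0 _]]] := H i.
  by rewrite coc0.
- apply: coc_eq => i; have [w [f1 [_ _ _ fl]]] := H i.
  by rewrite coc0.
Qed.

Definition D2 i u := co i (wderiv 2 0 l u).

Lemma H2c_aeq f w z : H2c f w -> sqint 0 l z -> aeq 0 l w z -> H2c f z.
Proof. by move=> [f1 [p p1 f0 fl]] sz wz; exists f1; split=> //; exact: prim_aeq wz. Qed.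

Lemma D2P u i : H2o b u -> H2c (co i u) (D2 i u).
Proof.
move=> Hu; have [Su _ _ _] := Hu; have [w Hw] := (H2oP u).1 Hu i.
have [sD wD] := wderivP Su i; apply: (H2c_aeq Hw) => //.
have [f1 [pf pf1 _ _]] := Hw.
apply: (rwd_uniq l_gt0 (proj1 pf1) sD _ wD); exact: prim_rwd2 l_gt0 pf pf1.
Qed.

Lemma XP xi : X b xi <-> forall i, (exists w, H2c (co i (st_u xi)) w) /\
  sqint 0 l (co i (st_v xi)).
Proof.
split=> [[/H2oP Hu /L2P Hv] i|H]; first by split.
by split; [apply/H2oP => i; case: (H i)|apply/L2P => i; case: (H i)].
Qed.

Lemma X_lin r xi eta : X b xi -> X b eta -> X b (r%:C *: xi + eta).
Proof.
move=> /XP Hx /XP He; apply/XP => i; have [[w Hw] sv] := Hx i; have [[z Hz] sv'] := He i.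
split.
  exists (fun x => r * w x + z x).
  rewrite (_ : co i _ = fun x => r * co i (st_u xi) x + co i (st_u eta) x).
    exact: H2c_lin.
  by apply/funext => x; rewrite /co stE cocD cocZ.
rewrite (_ : co i _ = fun x => r * co i (st_v xi) x + co i (st_v eta) x).
  by apply: sqintD => //; exact: sqintZ.
by apply/funext => x; rewrite /co stE cocD cocZ.
Qed.

Lemma X0 : X b 0.
Proof.
apply/XP => i; have E : co i (0 : R -> R[i]) = fun=> 0.
  by apply/funext => x; rewrite /co coc0.
split; last by rewrite -[st_v 0]/(0 : R -> R[i]) E; exact: sqint_cst.
by exists (fun=> 0), (fun=> 0); rewrite -[st_u 0]/(0 : R -> R[i]) E; split=> //; exact: prim_cst.
Qed.

Lemma X_opp_lin xi eta : xi - eta = ((-1)%:C *: eta + xi : state R).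
Proof.
have -> : (-1)%:C = -1 :> R[i] by rewrite rmorphN1.
by rewrite scaleN1r addrC.
Qed.

Lemma XB xi eta : X b xi -> X b eta -> X b (xi - eta).
Proof. by move=> Hx He; rewrite X_opp_lin; exact: X_lin. Qed.

Definition ipc i xi eta : R :=
  EI b * int 0 l (fun x => D2 i (st_u xi) x * D2 i (st_u eta) x) +
  rho b * int 0 l (fun x => co i (st_v xi) x * co i (st_v eta) x) +
  kappa b * (coc i (st_p xi) * coc i (st_p eta)) +
  mass b * (coc i (st_q xi) * coc i (st_q eta)).

(** The real part of the inner product, see innerXE; a real form is enough since
    stability only involves norms. *)
Definition ipX xi eta := ipc false xi eta + ipc true xi eta.

Lemma X_D2 xi i : X b xi -> sqint 0 l (D2 i (st_u xi)).
Proof. by move=> [/(D2P i) /H2c_sqint]. Qed.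

Lemma X_v xi i : X b xi -> sqint 0 l (co i (st_v xi)).
Proof. by move=> /XP /(_ i)[]. Qed.

Lemma innerXE xi eta : X b xi -> X b eta -> complex.Re (innerX b xi eta) = ipX xi eta.
Proof.
move=> Xx Xe; rewrite /innerX.
have ReD (z w : R[i]) : complex.Re (z + w) = complex.Re z + complex.Re w by exact: (cocD false).
have Rel (k : R) (z w : R[i]) : complex.Re (k%:C * z * w^*) =
    k * (coc false z * coc false w) + k * (coc true z * coc true w).
  by rewrite -mulrA -[LHS]/(coc false _) cocZ -[coc false _]/(complex.Re _) coc_conj mulrDr.
rewrite !ReD !Rel -[complex.Re (cint _ _ _)]/(coc false _) coc_cint.
have sD i := X_D2 i Xx; have sD' i := X_D2 i Xe; have sv i := X_v i Xx; have sv' i := X_v i Xe.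
have iD i := sqintM (sD i) (sD' i); have iv i := sqintM (sv i) (sv' i).
rewrite (@int_ext _ _ _ _ (fun x =>
   (EI b * (D2 false (st_u xi) x * D2 false (st_u eta) x) +
    EI b * (D2 true (st_u xi) x * D2 true (st_u eta) x)) +
   (rho b * (co false (st_v xi) x * co false (st_v eta) x) +
    rho b * (co true (st_v xi) x * co true (st_v eta) x)))); last first.
  by move=> x _; rewrite /co -[coc false _]/(complex.Re _) ReD !Rel.
do ![rewrite intD; last 2 first; try by [apply: igZ|apply: igD; apply: igZ]].
rewrite !intZ// /ipX /ipc; ring.
Qed.


Lemma EI_gt0 : 0 < EI b. Proof. by rewrite mulr_gt0 ?young_gt0 ?inertia_gt0. Qed.

Lemma D2_lin r xi eta i : X b xi -> X b eta ->
  aeq 0 l (D2 i (st_u (r%:C *: xi + eta)))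
          (fun x => r * D2 i (st_u xi) x + D2 i (st_u eta) x).
Proof.
move=> Xx Xe; have [Hx _] := Xx; have [He _] := Xe; have [Hs _] := X_lin r Xx Xe.
have := H2c_lin r (D2P i Hx) (D2P i He); apply: H2c_uniq.
rewrite (_ : (fun x => _) = co i (st_u (r%:C *: xi + eta))); first exact: D2P.
by apply/funext => x; rewrite /co stE cocD cocZ.
Qed.

Lemma int_aeqM f g h : sqint 0 l f -> sqint 0 l g -> sqint 0 l h -> aeq 0 l f g ->
  int 0 l (fun x => f x * h x) = int 0 l (fun x => g x * h x).
Proof.
move=> sf sg sh fg; apply: (@aeq_int _ 0 l) => //; try exact: sqintM.
by apply: ae_map fg => x E xl; rewrite E.
Qed.

Lemma energy_comb (k1 k2 k3 k4 r a a' c c' p p' z q q' y : R) :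
  k1 * (r * a + a') + k2 * (r * c + c') + k3 * ((r * p + p') * z) + k4 * ((r * q + q') * y) =
  r * (k1 * a + k2 * c + k3 * (p * z) + k4 * (q * y)) +
  (k1 * a' + k2 * c' + k3 * (p' * z) + k4 * (q' * y)).
Proof. by ring. Qed.

Lemma ipc_lin i r xi eta zeta : X b xi -> X b eta -> X b zeta ->
  ipc i (r%:C *: xi + eta) zeta = r * ipc i xi zeta + ipc i eta zeta.
Proof.
move=> Xx Xe Xz; have Xs := X_lin r Xx Xe.
have sD := X_D2 i Xx; have sD' := X_D2 i Xe; have sDz := X_D2 i Xz.
have sv := X_v i Xx; have sv' := X_v i Xe; have svz := X_v i Xz.
have lin f g h : sqint 0 l f -> sqint 0 l g -> sqint 0 l h ->
    int 0 l (fun x => (r * f x + g x) * h x) =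
    r * int 0 l (fun x => f x * h x) + int 0 l (fun x => g x * h x).
  move=> sf sg sh; rewrite -intZ; last exact: sqintM.
  rewrite -intD; [|by apply: igZ; exact: sqintM|exact: sqintM].
  by apply: int_ext => x _; ring.
have E1 : int 0 l (fun x => D2 i (st_u (r%:C *: xi + eta)) x * D2 i (st_u zeta) x) =
    r * int 0 l (fun x => D2 i (st_u xi) x * D2 i (st_u zeta) x) +
    int 0 l (fun x => D2 i (st_u eta) x * D2 i (st_u zeta) x).
  rewrite (int_aeqM (X_D2 i Xs) _ sDz (D2_lin r i Xx Xe)) ?lin//.
  by apply: sqintD => //; exact: sqintZ.
have E2 : int 0 l (fun x => co i (st_v (r%:C *: xi + eta)) x * co i (st_v zeta) x) =
    r * int 0 l (fun x => co i (st_v xi) x * co i (st_v zeta) x) +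
    int 0 l (fun x => co i (st_v eta) x * co i (st_v zeta) x).
  by rewrite -lin//; apply: int_ext => x _; rewrite /co stE cocD cocZ.
rewrite /ipc E1 E2 !stE !cocD !cocZ.
exact: energy_comb.
Qed.

Lemma ipcC i xi eta : ipc i xi eta = ipc i eta xi.
Proof.
have C f g : int 0 l (fun x => f x * g x) = int 0 l (fun x => g x * f x).
  by apply: int_ext => x _; rewrite mulrC.
rewrite /ipc C (C (co i (st_v xi))) (mulrC (coc i (st_p xi))) (mulrC (coc i (st_q xi))).
by [].
Qed.

Lemma ipc_parts i xi : [/\ 0 <= ipc i xi xi,
  EI b * int 0 l (fun x => D2 i (st_u xi) x ^+ 2) <= ipc i xi xi,
  rho b * int 0 l (fun x => co i (st_v xi) x ^+ 2) <= ipc i xi xi,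
  kappa b * coc i (st_p xi) ^+ 2 <= ipc i xi xi &
  mass b * coc i (st_q xi) ^+ 2 <= ipc i xi xi].
Proof.
have e : ipc i xi xi = EI b * int 0 l (fun x => D2 i (st_u xi) x ^+ 2) +
  rho b * int 0 l (fun x => co i (st_v xi) x ^+ 2) + kappa b * coc i (st_p xi) ^+ 2 +
  mass b * coc i (st_q xi) ^+ 2 by [].
have h1 : 0 <= EI b * int 0 l (fun x => D2 i (st_u xi) x ^+ 2).
  by rewrite mulr_ge0 ?(ltW EI_gt0)// int_ge0// => x _; exact: sqr_ge0.
have h2 : 0 <= rho b * int 0 l (fun x => co i (st_v xi) x ^+ 2).
  by rewrite mulr_ge0 ?(ltW (rho_gt0 _))// int_ge0// => x _; exact: sqr_ge0.
have h3 : 0 <= kappa b * coc i (st_p xi) ^+ 2 by rewrite mulr_ge0 ?sqr_ge0// ltW ?kappa_gt0.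
have h4 : 0 <= mass b * coc i (st_q xi) ^+ 2 by rewrite mulr_ge0 ?sqr_ge0// ltW ?mass_gt0.
by rewrite e; move: h1 h2 h3 h4; move: (_ * int _ _ _) (rho b * _) (kappa b * _) (mass b * _) => *; split; lra.
Qed.

Lemma ipX_lin r xi eta zeta : X b xi -> X b eta -> X b zeta ->
  ipX (r%:C *: xi + eta) zeta = r * ipX xi zeta + ipX eta zeta.
Proof. by move=> *; rewrite /ipX !ipc_lin//; ring. Qed.

Lemma ipXC xi eta : ipX xi eta = ipX eta xi.
Proof. by rewrite /ipX !(ipcC _ xi). Qed.

Lemma ipX_ge0 xi : 0 <= ipX xi xi.
Proof. by rewrite addr_ge0//; case: (ipc_parts false xi); case: (ipc_parts true xi). Qed.

Lemma ipc_le_ipX i xi : ipc i xi xi <= ipX xi xi.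
Proof.
by case: i; rewrite /ipX ?lerDl ?lerDr; [case: (ipc_parts false xi)|case: (ipc_parts true xi)].
Qed.

Lemma normXE xi : X b xi -> normX b xi = Num.sqrt (ipX xi xi).
Proof. by move=> Xx; rewrite /normX innerXE. Qed.

(** Multiplication by i exchanges the two components up to sign. *)
Lemma ipX_i xi : X b xi -> X b ('i *: xi) -> ipX ('i *: xi) ('i *: xi) = ipX xi xi.
Proof.
move=> Xx Xi.
have D i : aeq 0 l (D2 i (st_u ('i *: xi)))
    (if i then D2 false (st_u xi) else fun x => - D2 true (st_u xi) x).
  have [Hi _] := Xi; have [Hx _] := Xx; apply: H2c_uniq (D2P i Hi) _.
  have E : co i (st_u ('i *: xi)) = if i then co false (st_u xi) else fun x => - co true (st_u xi) x.
    by apply/funext => x; rewrite /co stE coc_i; case: (i).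
  rewrite E; case: i {E}; first exact: D2P.
  have := H2c_lin (-1) (D2P true Hx) (D2P true Hx).
  have := H2c_lin (-2) (D2P true Hx) (D2P true Hx).
  rewrite (_ : (fun x => -2 * co true _ x + _) = fun x => - co true (st_u xi) x).
    rewrite (_ : (fun x => -2 * D2 true _ x + _) = fun x => - D2 true (st_u xi) x)//.
    by apply/funext => x; ring.
  by apply/funext => x; ring.
have key i : ipc i ('i *: xi) ('i *: xi) = ipc (~~ i) xi xi.
  rewrite /ipc; congr (_ + _ + _ + _).
  - congr (_ * _); have sDi := X_D2 i Xi.
    apply: (@aeq_int _ 0 l) => //; try exact: sqintM.
      by apply: sqintM; exact: X_D2.
    by apply: ae_map (D i) => x E xl; rewrite E//; case: (i) => //=; rewrite mulrNN.
  - congr (_ * _); apply: int_ext => x _; rewrite /co stE coc_i.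
    by case: (i) => //=; rewrite mulrNN.
  - by rewrite stE coc_i; case: (i) => //=; rewrite mulrNN.
  - by rewrite stE coc_i; case: (i) => //=; rewrite mulrNN.
by rewrite /ipX !key addrC.
Qed.

Lemma cauchy_real (s : nat -> R) :
  (forall e, 0 < e -> exists N, forall m n, (N <= m)%N -> (N <= n)%N -> (s m - s n) ^+ 2 <= e) ->
  exists x, forall e, 0 < e -> exists N, forall n, (N <= n)%N -> (s n - x) ^+ 2 <= e.
Proof.
have sq_le (x e : R) : 0 <= e -> (x ^+ 2 <= e ^+ 2) = (`|x| <= e).
  by move=> e0; rewrite -[x ^+ 2]real_normK ?num_real// ler_pXn2r ?nnegrE.
move=> H; have : cauchy (s @ \oo).
  apply/cauchy_ballP => e e0.
  have e1 : 0 < (e / 2) ^+ 2 by rewrite exprn_gt0// divr_gt0.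
  have [N HN] := H _ e1.
  exists (s @` [set n | (N <= n)%N], s @` [set n | (N <= n)%N]) => /=.
    by split; exists N => // n Nn /=; exists n.
  move=> [_ _] /= [[m Nm <-] [n Nn <-]]; rewrite /ball/=.
  by have := HN m n Nm Nn; rewrite sq_le ?divr_ge0 ?(ltW e0)// => h; rewrite (le_lt_trans h)//; lra.
move=> /cauchy_cvgP /cvg_ex[x sx]; exists x => e e0.
have q0 : 0 < Num.sqrt e by rewrite sqrtr_gt0.
have /cvgrPdist_le/(_ _ q0)[N _ HN] := sx; exists N => n Nn.
by rewrite -(sqr_sqrtr (ltW e0)) sq_le ?sqrtr_ge0// distrC; exact: HN.
Qed.

Lemma H2c_antiderivative w : sqint 0 l w -> exists f, H2c f w.
Proof.
move=> sw; pose f1 x := 0 + int 0 x w; have p1 : prim 0 l f1 w by exact: prim_int.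
have s1 := prim_sqint (ltW l_gt0) p1.
pose k := - int 0 l f1 / l.
have pk : prim 0 l (fun x => f1 x + k) w.
  have := primD p1 (prim_cst 0 l k).
  by under [X in prim _ _ _ X]eq_fun do rewrite addr0.
have sk := prim_sqint (ltW l_gt0) pk.
exists (fun x => 0 + int 0 x (fun x => f1 x + k)), (fun x => f1 x + k); split => //.
- exact: prim_int.
- by rewrite int_empty// addr0.
- rewrite add0r intD ?int_cst ?(ltW l_gt0)//; last 2 first.
    exact: sqint_ig.
    exact: ig_cst.
  by rewrite /k subr0 divfK ?subrr// gt_eqF// l_gt0.
Qed.

(** The second derivatives and the velocities converge in mean square, the scalars in
    R; the limiting deflection is the twofold primitive that vanishes at both ends. *)
Theorem X_complete (s : nat -> state R) : (forall n, X b (s n)) ->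
  (forall e, 0 < e -> exists N, forall m n, (N <= m)%N -> (N <= n)%N ->
     ipX (s m - s n) (s m - s n) <= e) ->
  exists2 xi, X b xi & forall e, 0 < e -> exists N, forall n, (N <= n)%N ->
     ipX (s n - xi) (s n - xi) <= e.
Proof.
move=> Xs Cs.
have dD i (xi eta : state R) : X b xi -> X b eta -> int 0 l (fun x => D2 i (st_u (xi - eta)) x ^+ 2) =
    int 0 l (fun x => (D2 i (st_u xi) x - D2 i (st_u eta) x) ^+ 2).
  move=> Xx Xe; rewrite X_opp_lin; have Xd := X_lin (-1) Xe Xx.
  have s1 := X_D2 i Xd; have s2 := sqintB (X_D2 i Xx) (X_D2 i Xe).
  apply: (@aeq_int _ 0 l) => //; first by case: s1.
    by case: s2.
  by apply: ae_map (D2_lin (-1) i Xe Xx) => x E xl; rewrite E//; congr (_ ^+ 2); ring.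
have ipcE i (xi eta : state R) : X b xi -> X b eta -> ipc i (xi - eta) (xi - eta) =
   EI b * int 0 l (fun x => (D2 i (st_u xi) x - D2 i (st_u eta) x) ^+ 2) +
   rho b * int 0 l (fun x => (co i (st_v xi) x - co i (st_v eta) x) ^+ 2) +
   kappa b * (coc i (st_p xi) - coc i (st_p eta)) ^+ 2 +
   mass b * (coc i (st_q xi) - coc i (st_q eta)) ^+ 2.
  move=> Xx Xe; rewrite -dD// /ipc; congr (_ * _ + _ * _ + _ * _ + _ * _).
    by apply: int_ext => x _; rewrite /co stE cocB expr2.
    by rewrite stE cocB expr2.
  by rewrite stE cocB expr2.
have small (c e : R) : 0 < c -> 0 < e -> 0 < e * c by move=> *; exact: mulr_gt0.
have CE i e : 0 < e -> exists N, forall m n, (N <= m)%N -> (N <= n)%N ->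
    [/\ int 0 l (fun x => (D2 i (st_u (s m)) x - D2 i (st_u (s n)) x) ^+ 2) <= e,
        int 0 l (fun x => (co i (st_v (s m)) x - co i (st_v (s n)) x) ^+ 2) <= e,
        (coc i (st_p (s m)) - coc i (st_p (s n))) ^+ 2 <= e &
        (coc i (st_q (s m)) - coc i (st_q (s n))) ^+ 2 <= e].
  move=> e0; pose c := Num.min (Num.min (EI b) (rho b)) (Num.min (kappa b) (mass b)).
  have c0 : 0 < c by rewrite !lt_min EI_gt0 rho_gt0 kappa_gt0 mass_gt0.
  have [N HN] := Cs _ (small c e c0 e0); exists N => m n Nm Nn.
  have h := le_trans (ipc_le_ipX i _) (HN m n Nm Nn).
  have [_] := ipc_parts i (s m - s n); rewrite dD//.
  rewrite (@int_ext _ _ _ (fun x => co i (st_v (s m - s n)) x ^+ 2)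
    (fun x => (co i (st_v (s m)) x - co i (st_v (s n)) x) ^+ 2)); last first.
    by move=> x _; rewrite /co stE cocB.
  rewrite !stE !cocB.
  have fin (k t : R) : c <= k -> 0 <= t -> k * t <= ipc i (s m - s n) (s m - s n) -> t <= e.
    move=> ck t0 kt; rewrite -(ler_pM2r c0); apply: le_trans h; apply: le_trans kt.
    by rewrite mulrC ler_wpM2r.
  have i0 f : 0 <= int 0 l (fun x => f x ^+ 2) by apply: int_ge0 => x _; exact: sqr_ge0.
  move=> h1 h2 h3 h4; split.
  - by apply: fin h1; rewrite ?i0// /c !ge_min lexx.
  - by apply: fin h2; rewrite ?i0// /c !ge_min lexx ?orbT.
  - by apply: fin h3; rewrite ?sqr_ge0// /c !ge_min lexx ?orbT.
  - by apply: fin h4; rewrite ?sqr_ge0// /c !ge_min lexx ?orbT.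
have /choice[w Hw] i : exists w, sqint 0 l w /\ forall e, 0 < e -> exists N, forall n, (N <= n)%N ->
    int 0 l (fun x => (D2 i (st_u (s n)) x - w x) ^+ 2) <= e.
  have [n|e e0|w sw Hw] := @riesz_fischer _ 0 l (fun n => D2 i (st_u (s n))) (ltW l_gt0).
  - exact: X_D2.
  - by have [N HN] := CE i e e0; exists N => m n Nm Nn; case: (HN m n Nm Nn).
  - by exists w.
have /choice[v Hv] i : exists v : R -> R, sqint 0 l v /\ forall e, 0 < e -> exists N, forall n, (N <= n)%N ->
    int 0 l (fun x => (co i (st_v (s n)) x - v x) ^+ 2) <= e.
  have [n|e e0|v sv Hv] := @riesz_fischer _ 0 l (fun n => co i (st_v (s n))) (ltW l_gt0).
  - exact: X_v.
  - by have [N HN] := CE i e e0; exists N => m n Nm Nn; case: (HN m n Nm Nn).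
  - by exists v.
have /choice[p Hp] i : exists p : R, forall e, 0 < e -> exists N, forall n, (N <= n)%N ->
    (coc i (st_p (s n)) - p) ^+ 2 <= e.
  apply: cauchy_real => e e0; have [N HN] := CE i e e0; exists N => m n Nm Nn.
  by case: (HN m n Nm Nn).
have /choice[q Hq] i : exists q : R, forall e, 0 < e -> exists N, forall n, (N <= n)%N ->
    (coc i (st_q (s n)) - q) ^+ 2 <= e.
  apply: cauchy_real => e e0; have [N HN] := CE i e e0; exists N => m n Nm Nn.
  by case: (HN m n Nm Nn).
have /choice[f Hf] i : exists f, H2c f (w i) by apply: H2c_antiderivative; case: (Hw i).
pose xi : state R := (fun x => f false x +i* f true x, fun x => v false x +i* v true x,
  p false +i* p true, q false +i* q true).
have Xxi : X b xi.
  apply/XP => i; rewrite /st_u /st_v /= !co_pair; split; first by exists (w i).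
  by case: (Hv i).
have Dxi i : aeq 0 l (D2 i (st_u xi)) (w i).
  have [Hu _] := Xxi; have := D2P i Hu; rewrite {1}/st_u /= co_pair => h.
  exact: H2c_uniq h (Hf i).
have lim_c i e : 0 < e -> exists N, forall n, (N <= n)%N -> ipc i (s n - xi) (s n - xi) <= e.
  move=> e0; have q4 (k : R) : 0 < k -> 0 < e / (4 * k) by move=> k0; rewrite divr_gt0// mulr_gt0.
  have [N1 H1] := (Hw i).2 _ (q4 _ EI_gt0).
  have [N2 H2] := (Hv i).2 _ (q4 _ (rho_gt0 b)).
  have [N3 H3] := Hp i _ (q4 _ (kappa_gt0 b)).
  have [N4 H4] := Hq i _ (q4 _ (mass_gt0 b)).
  exists (maxn (maxn N1 N2) (maxn N3 N4)) => n.
  rewrite !geq_max => /andP[/andP[/H1 h1 /H2 h2] /andP[/H3 h3 /H4 h4]].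
  have fin (k t : R) : 0 < k -> t <= e / (4 * k) -> k * t <= e / 4.
    move=> k0 h; apply: (@le_trans _ _ (k * (e / (4 * k)))); first by rewrite ler_pM2l.
    by rewrite le_eqVlt; apply/orP; left; apply/eqP; field; exact: lt0r_neq0.
  rewrite ipcE//.
  have -> : int 0 l (fun x => (D2 i (st_u (s n)) x - D2 i (st_u xi) x) ^+ 2) =
      int 0 l (fun x => (D2 i (st_u (s n)) x - w i x) ^+ 2).
    have [_ i1] := sqintB (X_D2 i (Xs n)) (X_D2 i Xxi).
    have [_ i2] := sqintB (X_D2 i (Xs n)) (Hw i).1.
    apply: (@aeq_int _ 0 l) => //.
    by apply: ae_map (Dxi i) => x E xl; rewrite E.
  rewrite {1}/xi /st_v /st_p /st_q /= co_pair.
  rewrite (_ : coc i (p false +i* p true) = p i); last by case: (i).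
  rewrite (_ : coc i (q false +i* q true) = q i); last by case: (i).
  have := fin _ _ EI_gt0 h1; have := fin _ _ (rho_gt0 b) h2.
  have := fin _ _ (kappa_gt0 b) h3; have := fin _ _ (mass_gt0 b) h4.
  by rewrite /st_v /st_p /st_q /= => g1 g2 g3 g4; lra.
exists xi => // e e0; have e2 : 0 < e / 2 by rewrite divr_gt0.
have [N1 H1] := lim_c false _ e2; have [N2 H2] := lim_c true _ e2.
exists (maxn N1 N2) => n; rewrite geq_max => /andP[/H1 h1 /H2 h2].
by rewrite /ipX; lra.
Qed.

End EnergySpace.

(** * Functions on the two spans *)

Section Pieces.
Context {R : realType}.
Notation mu := (@lebesgue_measure R).
Implicit Types (a b c x : R) (f g : R -> R) (G : nat -> R -> R).

Lemma ig_glue a b c f : a < c -> c < b -> ig a c f -> ig c b f -> ig a b f.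
Proof.
move=> ac cb i1 i2; rewrite /ig.
have E : `]a, b[%classic = `]a, c] `|` `]c, b[ :> set R.
  by rewrite -itv_bndbnd_setU// bnd_simp ltW.
have mf : measurable_fun `]a, b[ f.
  rewrite E; apply/measurable_funU => //; split; last exact: (ig_meas i2).
  by apply/measurable_fun_itv_bndo_bndcP; exact: (ig_meas i1).
apply/integrableP; split; first exact/measurable_EFinP.
have ma (D : set R) : measurable_fun D f -> measurable_fun D (fun x => `|(EFin \o f) x|)%E.
  by move=> mD; apply: measurableT_comp => //; exact/measurable_EFinP.
rewrite E ge0_integral_setU//; last 2 first.
  by rewrite -E; exact: ma.
  apply/disj_setPS => y [/=]; rewrite !in_itv/= => /andP[_ yc] /andP[cy _].
  by move: (lt_le_trans cy yc); rewrite ltxx.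
have /integrableP[_ h1] := i1; have /integrableP[_ h2] := i2.
rewrite -integral_itv_bndo_bndc; last first.
  exact: ma (ig_meas i1).
exact: lte_add_pinfty.
Qed.

(** The attachment point is a null set. *)
Lemma sqint_glue a b c f : a < c -> c < b -> sqint a c f -> sqint c b f -> sqint a b f.
Proof.
move=> ac cb [m1 i1] [m2 i2]; split; last exact: ig_glue i1 i2.
have E : `]a, b[%classic = `]a, c] `|` `]c, b[ :> set R.
  by rewrite -itv_bndbnd_setU// bnd_simp ltW.
rewrite E; apply/measurable_funU => //; split => //.
exact/measurable_fun_itv_bndo_bndcP.
Qed.

Lemma rwd_ext n a b f g h : {in `]a, b[, f =1 g} -> rwd n a b f h -> rwd n a b g h.
Proof.
move=> fg w phi tphi; rewrite -w//; apply: int_ext => x xab.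
by rewrite fg.
Qed.

Lemma chain_rwd n a b G : a < b -> (forall j, (j < n)%N -> prim a b (G j) (G j.+1)) ->
  rwd n a b (G 0%N) (G n).
Proof.
move=> ab; elim: n => [|n IH] H; first by move=> phi _; rewrite derive1n0 expr0 mul1r.
apply: rwd_comp; first by apply: IH => j jn; apply: H; exact: ltnW.
by apply: prim_rwd => //; exact: H.
Qed.

Lemma chain_derive n a b f G : {in `]a, b[, f =1 G 0%N} ->
  (forall j, (j < n)%N -> prim a b (G j) (G j.+1)) ->
  forall j, (j < n)%N -> {in `]a, b[, derive1n j f =1 G j}.
Proof.
move=> fG pG; elim=> [_|j IH jn] x xab; first by rewrite derive1n0 fG.
have ax : a < x by move: xab; rewrite in_itv/= => /andP[].
have xb : x < b by move: xab; rewrite in_itv/= => /andP[].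
have cG : {in `]a, b[, continuous (G j.+1)}.
  by move=> y yab; exact: prim_continuous (pG _ jn) yab.
have dG := prim_derivable (pG _ (ltnW jn)) cG xab.
rewrite derive1nS derive1E.
suff dF : is_derive x (1 : R) (derive1n j f) (G j.+1 x) by have [_ ->] := dF.
apply: near_eq_is_derive dG; near=> y; rewrite IH ?(ltnW jn)// in_itv/=.
apply/andP; split; near: y; [exact: lt_nbhsr|exact: lt_nbhsl].
Unshelve. all: by end_near. Qed.

Lemma chain_right n a b f G j : a < b -> {in `]a, b[, f =1 G 0%N} ->
  (forall j, (j < n)%N -> prim a b (G j) (G j.+1)) -> (j < n)%N ->
  derive1n j f x @[x --> a^'+] --> G j a.
Proof.
move=> ab fG pG jn; apply: cvg_trans (prim_cvg_right ab (pG j jn)).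
apply: near_eq_cvg; near=> y; rewrite (chain_derive fG pG jn)// in_itv/=.
apply/andP; split; near: y; [exact: nbhs_right_gt|exact: nbhs_right_lt].
Unshelve. all: by end_near. Qed.

Lemma chain_left n a b f G j : a < b -> {in `]a, b[, f =1 G 0%N} ->
  (forall j, (j < n)%N -> prim a b (G j) (G j.+1)) -> (j < n)%N ->
  derive1n j f x @[x --> b^'-] --> G j b.
Proof.
move=> ab fG pG jn; apply: cvg_trans (prim_cvg_left ab (pG j jn)).
apply: near_eq_cvg; near=> y; rewrite (chain_derive fG pG jn)// in_itv/=.
apply/andP; split; near: y; [exact: nbhs_left_gt|exact: nbhs_left_lt].
Unshelve. all: by end_near. Qed.

Lemma byparts2 a b F F1 F2 v v1 v2 : a <= b ->
  prim a b F F1 -> prim a b F1 F2 -> prim a b v v1 -> prim a b v1 v2 ->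
  int a b (fun x => F x * v2 x) - int a b (fun x => F2 x * v x) =
  (F b * v1 b - F a * v1 a) - (F1 b * v b - F1 a * v a).
Proof.
move=> ab pF pF1 pv pv1.
have h1 := byparts ab pF pv1; have h2 := byparts ab pF1 pv.
by rewrite -h1 -h2; ring.
Qed.

Lemma closed_sqint a b f : a < b -> Cn_closed 0 a b f -> sqint a b f.
Proof.
move=> ab [_ /(_ 0%N)cf /(_ 0%N isT)[/cvg_ex[/= L0 f0] /cvg_ex[/= L1 f1]]].
pose g x := if x <= a then L0 else if b <= x then L1 else f x.
have fg : {in `]a, b[, f =1 g}.
  by move=> x; rewrite in_itv/= => /andP[ax xb]; rewrite /g !ifN// -ltNge.
have cg : {within `[a, b], continuous g}.
  apply/continuous_within_itvP => //; split.
  - move=> x xab; have h : f y @[y --> x] --> f x by exact: cf x isT xab.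
    rewrite /continuous_at -(fg _ xab); apply: cvg_trans h; apply: near_eq_cvg.
    have /andP[ax xb] : a < x < b by move: xab; rewrite in_itv.
    near=> y; rewrite fg// in_itv/=.
    by apply/andP; split; near: y; [exact: lt_nbhsr|exact: lt_nbhsl].
  - rewrite {2}/g lexx; apply: cvg_trans f0; apply: near_eq_cvg; near=> y; rewrite fg// in_itv/=.
    by apply/andP; split; near: y; [exact: nbhs_right_gt|exact: nbhs_right_lt].
  - rewrite {2}/g leNgt ab lexx/=; apply: cvg_trans f1; apply: near_eq_cvg; near=> y; rewrite fg// in_itv/=.
    by apply/andP; split; near: y; [exact: nbhs_left_gt|exact: nbhs_left_lt].
have [M [_ HM]] := compact_bounded (continuous_compact cg (@segment_compact _ a b)).
apply: (@sqint_bounded _ _ _ _ (M + 1)).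
  apply: open_continuous_measurable_fun; first exact: interval_open.
  by move=> x; rewrite inE/= => xab; exact: cf x isT xab.
move=> x xab; rewrite fg//; apply: HM; first by rewrite ltrDl.
by exists x => //; exact: subset_itv_oo_cc xab.
Unshelve. all: by end_near. Qed.

End Pieces.

(** * The energy balance *)

Section Dissipation.
Context {R : realType}.
Local Open Scope complex_scope.
Variable b : beam R.
Local Notation l := (len b).
Local Notation l0 := (spot b).
Implicit Types (i : bool) (xi eta zeta : state R) (r : R).

Lemma l0_gt0 : 0 < l0. Proof. by have /andP[] := spot_in b. Qed.
Lemma l0_lt : l0 < l. Proof. by have /andP[] := spot_in b. Qed.
Let l00 := l0_gt0.
Let l0l := l0_lt.

(** What membership in the domain says about one real component of the
    deflection: w and f4 represent its second and fourth derivatives, G j and H j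
    are its j-th derivatives on the two spans. *)
Definition spans (w f4 : R -> R) (G H : nat -> R -> R) :=
  [/\ forall j, (j < 4)%N -> prim 0 l0 (G j) (G j.+1),
      forall j, (j < 4)%N -> prim l0 l (H j) (H j.+1),
      aeq 0 l0 w (G 2%N) /\ aeq l0 l w (H 2%N),
      aeq 0 l0 f4 (G 4%N) /\ aeq l0 l f4 (H 4%N) &
      [/\ G 2%N 0 = 0, H 2%N l = 0 & G 2%N l0 = H 2%N l0]].

Lemma co_cderiv i n (u : R -> R[i]) : co i (cderiv n u) = derive1n n (co i u).
Proof. by case: i. Qed.

Lemma coc_clim i F (f : R -> R[i]) : coc i (clim F f) = lim (co i f x @[x --> F]).
Proof. by case: i. Qed.

Lemma coc_ccvg i F (f : R -> R[i]) z : ccvg F f z -> co i f x @[x --> F] --> coc i z.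
Proof. by move=> []; case: i. Qed.

(** Chains of primitives exist on each span by the structure of Sobolev functions;
    their second members agree with the global weak second derivative by
    uniqueness, and one-sided limits of classical derivatives are values of the
    chain at the ends. *)
Lemma dom_spans xi i : domA b xi -> exists G H,
  spans (D2 b i (st_u xi)) (co i (fourth b (st_u xi))) G H /\
  coc i (shear_jump b (st_u xi)) = EI b * (G 3%N l0 - H 3%N l0).
Proof.
set u := st_u xi; move=> [[Hu _] [S1 S2] [c0 cl] jump [_ _ _]].
have [_ /ccontinuousP cu _ _] := Hu.
have cin : {in `]0, l[, continuous (co i u)}.
  by have [] := (continuous_within_itvP _ (l_gt0 b)).1 (cu i).
have c1 : {in `]0, l0[, continuous (co i u)}.
  by move=> x; rewrite in_itv/= => /andP[x0 xl]; apply: cin; rewrite in_itv/= x0 (lt_trans xl).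
have c2 : {in `]l0, l[, continuous (co i u)}.
  by move=> x; rewrite in_itv/= => /andP[x0 xl]; apply: cin; rewrite in_itv/= xl (lt_trans _ x0).
have [G [uG pG]] := sob_chain l00 (SobolevP S1 i) c1.
have [H [uH pH]] := sob_chain l0l (SobolevP S2 i) c2.
have [f1 [pf pf1 _ _]] := D2P i Hu.
exists G, H; split; first split=> //.
- have l0' := ltW l00; have ll' := ltW l0l; split.
  + apply: (@rwd_uniq _ 2 0 l0 (co i u)) => //.
    * by apply: sqint_sub (proj1 pf1).
    * by have [] := prim_sqint l0' (pG 2%N isT).
    * exact: (prim_rwd2 l00 (prim_sub (lexx _) l0' ll' pf) (prim_sub (lexx _) l0' ll' pf1)).
    * apply: (rwd_ext (f := G 0%N)); first by move=> x xl; rewrite uG.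
      by apply: chain_rwd => // j j2; apply: pG; rewrite (leq_trans j2).
  + apply: (@rwd_uniq _ 2 l0 l (co i u)) => //.
    * by apply: sqint_sub (proj1 pf1).
    * by have [] := prim_sqint ll' (pH 2%N isT).
    * exact: (prim_rwd2 l0l (prim_sub l0' ll' (lexx _) pf) (prim_sub l0' ll' (lexx _) pf1)).
    * apply: (rwd_ext (f := H 0%N)); first by move=> x xl; rewrite uH.
      by apply: chain_rwd => // j j2; apply: pH; rewrite (leq_trans j2).
- split.
  + have [sw ww] := wderivP S1 i.
    apply: (@aeq_trans _ _ _ (co i (wderiv 4 0 l0 u))).
      by apply: aeW => x; rewrite in_itv/= => /andP[_ xl]; rewrite /co /fourth xl.
    apply: (rwd_uniq l00 sw _ ww); first by case: (pG 3%N isT).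
    apply: (rwd_ext (f := G 0%N)); first by move=> x xl; rewrite uG.
    exact: chain_rwd.
  + have [sw ww] := wderivP S2 i.
    apply: (@aeq_trans _ _ _ (co i (wderiv 4 l0 l u))).
      by apply: aeW => x; rewrite in_itv/= => /andP[xl _]; rewrite /co /fourth ltNge (ltW xl).
    apply: (rwd_uniq l0l sw _ ww); first by case: (pH 3%N isT).
    apply: (rwd_ext (f := H 0%N)); first by move=> x xl; rewrite uH.
    exact: chain_rwd.
- split.
  + have h := coc_ccvg (i := i) c0; rewrite co_cderiv coc0 in h.
    by rewrite -(cvg_lim (@Rhausdorff R) (chain_right l00 uG pG (isT : 2 < 4)%N)) (cvg_lim (@Rhausdorff R) h).
  + have h := coc_ccvg (i := i) cl; rewrite co_cderiv coc0 in h.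
    by rewrite -(cvg_lim (@Rhausdorff R) (chain_left l0l uH pH (isT : 2 < 4)%N)) (cvg_lim (@Rhausdorff R) h).
  + have := congr1 (coc i) jump; rewrite !coc_clim !co_cderiv.
    rewrite (cvg_lim (@Rhausdorff R) (chain_left l00 uG pG (isT : 2 < 4)%N)).
    by rewrite (cvg_lim (@Rhausdorff R) (chain_right l0l uH pH (isT : 2 < 4)%N)).
rewrite /shear_jump cocZ cocB !coc_clim !co_cderiv.
rewrite (cvg_lim (@Rhausdorff R) (chain_left l00 uG pG (isT : 3 < 4)%N)).
by rewrite (cvg_lim (@Rhausdorff R) (chain_right l0l uH pH (isT : 3 < 4)%N)).
Qed.

Lemma fourth_sqint xi i : domA b xi -> sqint 0 l (co i (fourth b (st_u xi))).
Proof.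
move=> Dx; have [_ [S1 S2] _ _ _] := Dx; apply: (sqint_glue l00 l0l).
  have [sw _] := wderivP S1 i; apply: sqint_ext sw => x.
  by rewrite in_itv/= => /andP[_ xl]; rewrite /co /fourth xl.
have [sw _] := wderivP S2 i; apply: sqint_ext sw => x.
by rewrite in_itv/= => /andP[xl _]; rewrite /co /fourth ltNge (ltW xl).
Qed.

(** Integration by parts twice on each span: the terms in the slope of v cancel at
    the attachment point because the bending moment is continuous there, the outer
    ones vanish, and only the shear jump times v remains. *)
Lemma beam_identity w f4 G H v v2 : spans w f4 G H ->
  sqint 0 l w -> sqint 0 l f4 -> H2c b v v2 ->
  int 0 l (fun x => w x * v2 x) - int 0 l (fun x => f4 x * v x) =
  - (G 3%N l0 - H 3%N l0) * v l0.
Proof.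
move=> [pG pH [w1 w2] [e1 e2] [g0 hl gh]] sw s4 [v1 [pv pv1 v0 vl]].
have l0' := ltW l00; have ll' := ltW l0l.
have sv := prim_sqint (ltW (l_gt0 b)) pv; have sv2 := proj1 pv1.
have pv' := prim_sub (lexx _) l0' ll' pv; have pv1' := prim_sub (lexx _) l0' ll' pv1.
have qv' := prim_sub l0' ll' (lexx _) pv; have qv1' := prim_sub l0' ll' (lexx _) pv1.
rewrite (@int_split _ 0 l l0) ?sqintM// (@int_split _ 0 l l0 (fun x => f4 x * v x)) ?sqintM//.
have E1 := byparts2 l0' (pG 2%N isT) (pG 3%N isT) pv' pv1'.
have E2 := byparts2 ll' (pH 2%N isT) (pH 3%N isT) qv' qv1'.
have aM c d f g h : 0 <= c -> d <= l -> sqint 0 l f -> sqint c d g -> sqint 0 l h ->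
    aeq c d f g -> int c d (fun x => f x * h x) = int c d (fun x => g x * h x).
  move=> c0 dl sf sg sh fg; have sf' := sqint_sub c0 dl sf; have sh' := sqint_sub c0 dl sh.
  apply: (@aeq_int _ c d) => //; try exact: sqintM.
  by apply: ae_map fg => x E xl; rewrite E.
have sG2 := prim_sqint l0' (pG 2%N isT); have sH2 := prim_sqint ll' (pH 2%N isT).
have sG4 := proj1 (pG 3%N isT); have sH4 := proj1 (pH 3%N isT).
rewrite (aM 0 l0 w (G 2%N))// (aM l0 l w (H 2%N))//.
rewrite (aM 0 l0 f4 (G 4%N))// (aM l0 l f4 (H 4%N))//.
rewrite g0 gh v0 in E1; rewrite hl vl in E2.
move: E1 E2; rewrite /=.
move: (int 0 l0 (fun x => G 2%N x * _)) (int 0 l0 (fun x => G 4%N x * _)).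
move: (int l0 l (fun x => H 2%N x * _)) (int l0 l (fun x => H 4%N x * _)) => a1 a2 a3 a4 E1 E2.
have -> : a3 + a1 - (a4 + a2) = (a3 - a4) + (a1 - a2) by ring.
rewrite E1 E2; ring.
Qed.

Lemma sqint_sum (J : Type) (s : seq J) a c (k : J -> R) (g : J -> R -> R) :
  (forall j, sqint a c (g j)) -> sqint a c (fun x => \sum_(j <- s) k j * g j x).
Proof.
move=> sg; elim: s => [|j s IH]; first by under eq_fun do rewrite big_nil; exact: sqint_cst.
by under eq_fun do rewrite big_cons; apply: sqintD => //; exact: sqintZ.
Qed.

Lemma int_sum (J : Type) (s : seq J) a c (k : J -> R) (g : J -> R -> R) h : a <= c ->
  (forall j, sqint a c (g j)) -> sqint a c h ->
  int a c (fun x => h x * \sum_(j <- s) k j * g j x) =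
  \sum_(j <- s) k j * int a c (fun x => g j x * h x).
Proof.
move=> ac sg sh; elim: s => [|j s IH].
  rewrite big_nil -[RHS](mul0r (c - a)) -int_cst//; apply: int_ext => x _.
  by rewrite big_nil mulr0.
rewrite big_cons -IH -intZ ?sqintM// -intD; first last.
- by apply: sqintM => //; exact: sqint_sum.
- by apply: igZ; exact: sqintM.
by apply: int_ext => x _; rewrite big_cons; ring.
Qed.

Variables (k : nat) (alpha0 : R) (alpha : 'I_k -> R) (psi : 'I_k -> R -> R).
Hypothesis psi_shape : forall j, shape_function b (psi j).
Local Notation B := (opAt b alpha0 alpha psi).
Definition mom i (j : 'I_k) xi := coc i (moment b (psi j) (st_v xi)).

Lemma momE i j xi : mom i j xi = int 0 l (fun x => derive1n 2 (psi j) x * co i (st_v xi) x).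
Proof. by rewrite /mom /moment coc_cint; apply: int_ext => x _; rewrite /co cocZ. Qed.

Lemma psi_sqint j : sqint 0 l (derive1n 2 (psi j)).
Proof.
have [_ [H1 H2 H3] _] := psi_shape j; apply: (closed_sqint (l_gt0 b)); split=> //.
  by move=> n x n0; apply: H2; exact: leq_trans n0 _.
by move=> n n0; apply: H3; exact: leq_trans n0 _.
Qed.

Lemma opAt_v i xi : co i (st_v (B xi)) = fun x => - (EI b / rho b) * co i (fourth b (st_u xi)) x +
  (rho b)^-1 * \sum_(j < k) (- alpha j * mom i j xi) * derive1n 2 (psi j) x.
Proof.
apply/funext => x; rewrite [LHS]cocD mulNr cocN !cocZ mulNr; congr (_ + _ * _).
rewrite coc_sum; apply: eq_bigr => j _.
by rewrite cocZ mulNr cocN cocZ mulrC -mulNr.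
Qed.

Lemma opAt_q i xi : coc i (st_q (B xi)) =
  (mass b)^-1 * (coc i (shear_jump b (st_u xi)) - kappa b * coc i (st_p xi) - alpha0 * coc i (st_q xi)).
Proof. by rewrite [LHS]cocZ cocD cocB mulNr cocN !cocZ. Qed.

Lemma opAt_X xi : domA b xi -> X b (B xi).
Proof.
move=> Dx; have [_ _ _ _ [Hv _ _]] := Dx; apply/XP => i; split.
  by exists (D2 b i (st_v xi)); exact: D2P.
rewrite opAt_v; apply: sqintD; first by apply: sqintZ; exact: fourth_sqint.
by apply: sqintZ; apply: sqint_sum => j; exact: psi_sqint.
Qed.

Lemma dissipation_comp i xi : domA b xi -> ipc b i xi (B xi) =
  - alpha0 * coc i (st_q xi) ^+ 2 - \sum_(j < k) alpha j * mom i j xi ^+ 2.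
Proof.
move=> Dx; have [Xx _ _ _ [Hv pE qE]] := Dx.
have [G [H [sp jE]]] := dom_spans i Dx.
have sv := X_v i Xx; have s4 := fourth_sqint i Dx.
have := beam_identity sp (X_D2 i Xx) s4 (D2P i Hv).
rewrite -[co i (st_v xi) l0]/(coc i (st_v xi l0)) -qE => id.
rewrite /ipc -[D2 b i (st_u (B xi))]/(D2 b i (st_v xi)).
rewrite opAt_q jE -[coc i (st_p (B xi))]/(coc i (st_q xi)) opAt_v.
have -> : int 0 l (fun x => co i (st_v xi) x * (- (EI b / rho b) * co i (fourth b (st_u xi)) x +
    (rho b)^-1 * \sum_(j < k) - alpha j * mom i j xi * derive1n 2 (psi j) x)) =
  - (EI b / rho b) * int 0 l (fun x => co i (fourth b (st_u xi)) x * co i (st_v xi) x) -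
  (rho b)^-1 * \sum_(j < k) alpha j * mom i j xi ^+ 2.
  have sS : sqint 0 l (fun x => \sum_(j < k) - alpha j * mom i j xi * derive1n 2 (psi j) x).
    by apply: sqint_sum => j; exact: psi_sqint.
  have -> : \sum_(j < k) alpha j * mom i j xi ^+ 2 =
    - int 0 l (fun x => co i (st_v xi) x * \sum_(j < k) - alpha j * mom i j xi * derive1n 2 (psi j) x).
    rewrite int_sum ?(ltW (l_gt0 b))//; last by move=> j; exact: psi_sqint.
    by rewrite -sumrN; apply: eq_bigr => j _; rewrite -momE; ring.
  rewrite mulrN opprK -intZ ?sqintM// -intZ ?sqintM// -intD; first last.
  - by apply: igZ; exact: sqintM.
  - by apply: igZ; exact: sqintM.
  by apply: int_ext => x _; ring.
have r0 : rho b != 0 by rewrite gt_eqF// rho_gt0.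
have m0 : mass b != 0 by rewrite gt_eqF// mass_gt0.
move: (\sum_(j < k) _) => S.
have -> : int 0 l (fun x => D2 b i (st_u xi) x * D2 b i (st_v xi) x) =
  int 0 l (fun x => co i (fourth b (st_u xi)) x * co i (st_v xi) x) - (G 3%N l0 - H 3%N l0) * coc i (st_q xi).
  by rewrite -mulNr -id; ring.
by field; rewrite r0 m0.
Qed.

(** Spring, inertia and bending terms cancel, and the shear jump is absorbed by the
    equation of the mass: only the feedback is left. *)
Lemma dissipation xi : domA b xi -> ipX b xi (B xi) =
  (- alpha0 * coc false (st_q xi) ^+ 2 - \sum_(j < k) alpha j * mom false j xi ^+ 2) +
  (- alpha0 * coc true (st_q xi) ^+ 2 - \sum_(j < k) alpha j * mom true j xi ^+ 2).
Proof. by move=> Dx; rewrite /ipX !dissipation_comp. Qed.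

End Dissipation.

(** * Uniform bounds and convergence along an ultrafilter *)

Section UniformBounds.
Context {R : realType}.
Implicit Types (a b c d e x y : R) (f g F : R -> R).

Lemma int_sq_bound a b f e : a <= b -> sqint a b f -> (forall x, x \in `]a, b[ -> `|f x| <= e) ->
  int a b (fun x => f x ^+ 2) <= e ^+ 2 * (b - a).
Proof.
move=> ab [_ f2] fe; rewrite -int_cst//; apply: int_le => //; first exact: ig_cst.
by move=> x /fe h; rewrite -real_normK ?num_real// lerXn2r ?nnegrE// (le_trans _ h).
Qed.

Lemma int_sqD a b f g : sqint a b f -> sqint a b g ->
  int a b (fun x => (f x + g x) ^+ 2) <=
  2 * int a b (fun x => f x ^+ 2) + 2 * int a b (fun x => g x ^+ 2).
Proof.
move=> sf sg; have [_ f2] := sf; have [_ g2] := sg; have [_ s2] := sqintD sf sg.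
rewrite -intZ// -intZ// -intD ?igZ//; apply: int_le => //; first by apply: igD; exact: igZ.
by move=> x _; have := sqr_ge0 (f x - g x); rewrite !expr2; nra.
Qed.

Lemma int_mul_bound a b f g : sqint a b f -> sqint a b g ->
  `|int a b (fun x => f x * g x)| <=
  int a b (fun x => f x ^+ 2) + int a b (fun x => g x ^+ 2).
Proof.
move=> sf sg; have [_ f2] := sf; have [_ g2] := sg.
apply: le_trans (int_abs (sqintM sf sg)) _.
rewrite -intD//; apply: int_le; [by apply: ig_abs; exact: sqintM|exact: igD|].
move=> x _; have h1 := sqr_ge0 (f x - g x); have h2 := sqr_ge0 (f x + g x).
have h3 := sqr_ge0 (f x); have h4 := sqr_ge0 (g x).
by rewrite ler_norml; apply/andP; split; move: h1 h2 h3 h4; rewrite !expr2; nra.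
Qed.

Lemma int_sq_sub a b c d f : a <= c -> c <= d -> d <= b -> sqint a b f ->
  int c d (fun x => f x ^+ 2) <= int a b (fun x => f x ^+ 2).
Proof.
move=> ac cd db [_ f2]; have cb := le_trans cd db.
rewrite (int_split ac cb f2) (int_split cd db (ig_sub ac (lexx b) f2)).
have h1 : 0 <= int a c (fun x => f x ^+ 2) by apply: int_ge0 => x _; exact: sqr_ge0.
have h2 : 0 <= int d b (fun x => f x ^+ 2) by apply: int_ge0 => x _; exact: sqr_ge0.
by lra.
Qed.

Lemma prim_osc a b F f D x y : a <= b -> prim a b F f -> int a b (fun x => f x ^+ 2) <= D ->
  a <= x -> x <= b -> a <= y -> y <= b -> `|F x - F y| <= (b - a) + D.
Proof.
move=> ab pF fD.
wlog xy : x y / y <= x.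
  by move=> W ax xb ay yb; have [h|/ltW h] := leP y x; [|rewrite distrC]; exact: W.
move=> ax xb ay yb; rewrite (prim_diff pF ay xy xb).
have [sf _] := pF.
apply: le_trans (int_young xy ltr01 (sqint_sub ay xb sf)) _.
by rewrite mul1r invr1 mul1r lerD ?lerB// (le_trans _ fD)//; exact: int_sq_sub.
Qed.

(** Averaging against a fixed chi of integral 1 controls the value of F at every
    point by one weak quantity. *)
Lemma prim_anchor a b F f chi D E x : a < b -> prim a b F f -> sqint a b chi -> int a b chi = 1 ->
  int a b (fun x => f x ^+ 2) <= D -> `|int a b (fun x => F x * chi x)| <= E ->
  a <= x -> x <= b -> `|F x| <= E + ((b - a) + D) * int a b (fun x => `|chi x|).
Proof.
move=> ab pF sc ic fD FE ax xb; have ab' := ltW ab; have sF := prim_sqint ab' pF.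
have igc := sqint_ig sc.
have -> : F x = int a b (fun y => F y * chi y) + int a b (fun y => (F x - F y) * chi y).
  rewrite -intD; first last.
  - by apply: sqintM => //; apply: sqintB => //; exact: sqint_cst.
  - exact: sqintM.
  by rewrite -[LHS]mulr1 -ic -intZ//; apply: int_ext => y _; ring.
apply: le_trans (ler_normD _ _) (lerD FE _).
apply: le_trans (int_abs _) _.
  by apply: sqintM => //; apply: sqintB => //; exact: sqint_cst.
rewrite -intZ; last exact: ig_abs.
apply: int_le.
- by apply: ig_abs; apply: sqintM => //; apply: sqintB => //; exact: sqint_cst.
- by apply: igZ; exact: ig_abs.
move=> y; rewrite in_itv/= => /andP[/ltW ay /ltW yb].
by rewrite normrM ler_wpM2r//; exact: prim_osc pF _ _ _ _ _.
Qed.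

Definition lip a b K F := forall x y, a <= x -> x <= y -> y <= b ->
  `|F x| <= K /\ `|F y - F x| <= K * (y - x).

(** Control of F and F2 in mean square controls F1: testing F1 against chi moves the
    derivative to chi, and F1 oscillates little because F2 is its derivative.
    The same step then applies to F itself. *)
Lemma prim2_lip a b C : a < b -> exists2 K, 0 < K & forall F F1 F2,
  prim a b F F1 -> prim a b F1 F2 -> int a b (fun x => F x ^+ 2) <= C ->
  int a b (fun x => F2 x ^+ 2) <= C -> lip a b K F.
Proof.
move=> ab; have ab' := ltW ab; have [chi tc ic] := test_unit ab.
have sc := test_sqint ab' tc; have sc' := test_sqint ab' (test_derive tc).
have pc := test_prim ab' tc; have [ca cb] := test_bound0 ab tc.
pose I := int a b (fun x => `|chi x|).
(* K1 bounds F1, D1 its square in mean, and K0 bounds F *)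
pose K1 := C + int a b (fun x => (chi^`())%classic x ^+ 2) + ((b - a) + C) * I.
pose D1 := K1 ^+ 2 * (b - a).
pose K0 := C + int a b (fun x => chi x ^+ 2) + ((b - a) + D1) * I.
exists (`|K1| + `|K0| + 1).
  by rewrite ltr_wpDl// addr_ge0.
move=> F F1 F2 pF pF1 FC F2C; have sF := prim_sqint ab' pF; have sF1 := prim_sqint ab' pF1.
have B1 x : a <= x -> x <= b -> `|F1 x| <= K1.
  apply: (prim_anchor ab pF1 sc ic F2C).
  have := byparts ab' pF pc; rewrite ca cb !mulr0 subrr => /eqP.
  rewrite addrC addr_eq0 => /eqP ->; rewrite normrN.
  by apply: le_trans (int_mul_bound sF sc') _; rewrite lerD2r.
have B0 x : a <= x -> x <= b -> `|F x| <= K0.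
  apply: (prim_anchor ab pF sc ic).
    apply: int_sq_bound => // x'; rewrite in_itv/= => /andP[/ltW h1 /ltW h2].
    exact: B1.
  by apply: le_trans (int_mul_bound sF sc) _; rewrite lerD2r.
move=> x y ax xy yb; have xb := le_trans xy yb; have ay := le_trans ax xy.
have K1e := ler_norm K1; have K0e := ler_norm K0.
have K1p := normr_ge0 K1; have K0p := normr_ge0 K0.
split; first by apply: le_trans (B0 _ ax xb) _; move: K0e K1p; clear; lra.
rewrite (prim_diff pF ax xy yb).
have sF1' := sqint_sub ax yb sF1.
apply: le_trans (int_abs (sqint_ig sF1')) _.
rewrite -int_cst//; apply: int_le; [exact: ig_abs (sqint_ig _)|exact: ig_cst|].
move=> z; rewrite in_itv/= => /andP[/ltW xz /ltW zy].
apply: le_trans (B1 _ (le_trans ax xz) (le_trans zy yb)) _.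
by move: K1e K0p; clear; lra.
Qed.

Variables (U : set_system nat).
Hypothesis Ultra : UltraFilter U.

Lemma ultra_cauchy (r : nat -> R) K e : 0 < e -> (forall n, `|r n| <= K) ->
  exists2 A, U A & forall m n, A m -> A n -> `|r m - r n| <= e.
Proof.
move=> e0 rK; have PU : ProperFilter U by exact: ultra_proper.
have [|x [_ cx]] := @segment_compact R (- K) K (r @ U) (fmap_proper_filter r PU).
  by apply: (@filterS _ U _ setT); [move=> n _; rewrite /= in_itv/= -ler_norml|exact: filterT].
have e2 : 0 < e / 2 by lra.
have Ux : U [set n | `|x - r n| <= e / 2].
  have [//|UC] := in_ultra_setVsetC [set n | `|x - r n| <= e / 2] Ultra.
  have [y [/= hy hb]] := cx [set z | ~ (`|x - z| <= e / 2)] (ball x (e / 2)) UC (nbhsx_ballx _ _ e2).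
  by case: hy; apply: ltW.
exists [set n | `|x - r n| <= e / 2] => // m n /= hm hn.
have -> : r m - r n = (x - r n) - (x - r m) by ring.
apply: le_trans (ler_normB _ _) _.
by move: hm hn; clear; lra.
Qed.

(** Uniform closeness is propagated from the left end in steps of length d, each
    step using convergence at one more point. *)
Lemma ultra_uniform (F : nat -> R -> R) a b K e : a < b -> 0 < K -> 0 < e ->
  (forall n, lip a b K (F n)) ->
  exists2 A, U A & forall m n, A m -> A n -> forall x, a <= x -> x <= b ->
    `|F m x - F n x| <= e.
Proof.
move=> ab K0 e0 FK; pose d := e / (3 * K).
have d0 : 0 < d by rewrite divr_gt0// mulr_gt0.
have Kd : K * d = e / 3 by rewrite /d; field; rewrite gt_eqF.
suff H N : exists2 A, U A & forall m n, A m -> A n -> forall x, a <= x -> x <= b ->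
    x <= a + N%:R * d -> `|F m x - F n x| <= e.
  have [N bN] : exists N, b <= a + N%:R * d.
    exists (Num.bound ((b - a) / d)).
    have ba : 0 <= b - a by rewrite subr_ge0 ltW.
    have /ltW := archi_boundP (divr_ge0 ba (ltW d0)).
    by rewrite ler_pdivrMr//; lra.
  have [A UA AH] := H N; exists A => // m n Am An x ax xb.
  by apply: AH => //; exact: le_trans bN.
have step y : a <= y -> y <= b -> exists2 A, U A & forall m n, A m -> A n -> forall x,
    y <= x -> x <= b -> x <= y + d -> `|F m x - F n x| <= e.
  move=> ay yb; have e3 : 0 < e / 3 by lra.
  have [|A UA AH] := @ultra_cauchy (fun n => F n y) K _ e3.
    by move=> n; have [] := FK n y y ay (lexx y) yb.
  exists A => // m n Am An x yx xb xy; have h := AH _ _ Am An.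
  have [_ hm] := FK m y x ay yx xb; have [_ hn] := FK n y x ay yx xb.
  have hK : K * (x - y) <= e / 3 by rewrite -Kd ler_pM2l//; lra.
  have -> : F m x - F n x = (F m x - F m y) - (F n x - F n y) + (F m y - F n y) by ring.
  apply: le_trans (ler_normD _ _) _; have := ler_normB (F m x - F m y) (F n x - F n y).
  by move: h hm hn hK; clear; lra.
elim: N => [|N [A UA AH]].
  have [A UA AH] := step a (lexx a) (ltW ab); exists A => // m n Am An x ax xb xa.
  by apply: AH => //; apply: le_trans xa _; rewrite mul0r addr0 lerDl ltW.
have aN : a <= a + N%:R * d by rewrite lerDl mulr_ge0// ltW.
have [bN|Nb] := leP b (a + N%:R * d).
  by exists A => // m n Am An x ax xb _; apply: AH => //; exact: le_trans bN.
have [A' UA' AH'] := step _ aN (ltW Nb).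
exists (A `&` A'); first exact: filterI.
move=> m n [Am A'm] [An A'n] x ax xb xN.
have [h|/ltW h] := leP x (a + N%:R * d); first exact: AH.
by apply: AH' => //; apply: le_trans xN _; rewrite -natr1; lra.
Qed.

End UniformBounds.

(** * Precompactness of the graph balls *)

Section Compactness.
Context {R : realType}.
Local Open Scope complex_scope.
Variable b : beam R.
Local Notation l := (len b).
Local Notation l0 := (spot b).
Variables (k : nat) (alpha0 : R) (alpha : 'I_k -> R) (psi : 'I_k -> R -> R).
Hypothesis psi_shape : forall j, shape_function b (psi j).
Local Notation B := (opAt b alpha0 alpha psi).
Implicit Types (i : bool) (xi eta zeta : state R).

Lemma sum_bound (J : Type) (s : seq J) (g : J -> R -> R) (M : J -> R) a c :
  (forall j, sqint a c (g j)) -> exists K, forall r : J -> R, (forall j, `|r j| <= M j) ->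
    int a c (fun x => (\sum_(j <- s) r j * g j x) ^+ 2) <= K.
Proof.
move=> sg; elim: s => [|j s [K IH]].
  exists (int a c (fun=> 0)) => r _; rewrite le_eqVlt; apply/orP; left; apply/eqP.
  by apply: int_ext => x _; rewrite big_nil expr0n.
exists (2 * (M j ^+ 2 * int a c (fun x => g j x ^+ 2)) + 2 * K) => r rM.
have [_ g2] := sg j.
under [X in int _ _ X]eq_fun do rewrite big_cons.
apply: le_trans (int_sqD (sqintZ _ (sg j)) (sqint_sum _ _ sg)) _.
apply: lerD; rewrite ler_pM2l//; last exact: IH.
under [X in int _ _ X <= _]eq_fun do rewrite exprMn.
rewrite intZ// ler_wpM2r//; first by apply: int_ge0 => x _; exact: sqr_ge0.
by rewrite -real_normK ?num_real// lerXn2r ?nnegrE// (le_trans _ (rM j)).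
Qed.

Lemma scaled_bound (m x C : R) : 0 < m -> m * x <= C -> x <= C / m.
Proof. by move=> m0 h; rewrite ler_pdivlMr// mulrC. Qed.

Lemma sq_bound (x C : R) : x ^+ 2 <= C -> `|x| <= 1 + C.
Proof.
by move=> h; rewrite ler_norml; have h1 := sqr_ge0 (x - 1); have h2 := sqr_ge0 (x + 1);
  move: h h1 h2; rewrite !expr2 => *; apply/andP; split; nra.
Qed.

(** The fourth derivative is recovered from the second slot of the operator, the
    moments being bounded by the norm of the velocity. *)
Lemma fourth_bound i C : exists K, forall xi, domA b xi -> ipX b xi xi <= C ->
  ipX b (B xi) (B xi) <= C -> int 0 l (fun x => co i (fourth b (st_u xi)) x ^+ 2) <= K.
Proof.
have l_ge0 := ltW (l_gt0 b); have r0 := rho_gt0 b; have E0 := EI_gt0 b.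
pose P j := int 0 l (fun x => derive1n 2 (psi j) x ^+ 2).
have [K HK] := @sum_bound _ (index_enum 'I_k) (fun j => derive1n 2 (psi j))
  (fun j => `|- alpha j| * (P j + C / rho b)) 0 l (psi_sqint psi_shape).
pose c1 := rho b / EI b; pose c2 := (EI b)^-1.
exists (2 * (c1 ^+ 2 * (C / rho b)) + 2 * (c2 ^+ 2 * K)) => xi Dx h1 h2.
have Xx : X b xi by case: Dx.
have XB := opAt_X alpha0 alpha psi_shape Dx.
have sv := X_v i Xx; have sB := X_v i XB; have sf := fourth_sqint i Dx.
have vC : int 0 l (fun x => co i (st_v xi) x ^+ 2) <= C / rho b.
  by have [_ _ h _ _] := ipc_parts b i xi; apply: scaled_bound => //; apply: le_trans h _;
    exact: le_trans (ipc_le_ipX b i xi) h1.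
have BC : int 0 l (fun x => co i (st_v (B xi)) x ^+ 2) <= C / rho b.
  by have [_ _ h _ _] := ipc_parts b i (B xi); apply: scaled_bound => //; apply: le_trans h _;
    exact: le_trans (ipc_le_ipX b i (B xi)) h2.
pose S x := \sum_(j < k) (- alpha j * mom b psi i j xi) * derive1n 2 (psi j) x.
have sS : sqint 0 l S by apply: sqint_sum; exact: psi_sqint.
have SK : int 0 l (fun x => S x ^+ 2) <= K.
  apply: HK => j; rewrite normrM ler_wpM2l// momE.
  by apply: le_trans (int_mul_bound (psi_sqint psi_shape j) sv) _; rewrite lerD2l.
have [_ B2] := sB; have [_ S2] := sS.
have -> : int 0 l (fun x => co i (fourth b (st_u xi)) x ^+ 2) =
  int 0 l (fun x => (- c1 * co i (st_v (B xi)) x + c2 * S x) ^+ 2).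
  apply: int_ext => x _; congr (_ ^+ 2); rewrite opAt_v -/(S x) /c1 /c2.
  by field; rewrite !gt_eqF.
apply: le_trans (int_sqD (sqintZ _ sB) (sqintZ _ sS)) _.
apply: lerD; rewrite ler_pM2l//.
  under [X in int _ _ X <= _]eq_fun do rewrite exprMn sqrrN.
  by rewrite intZ// ler_wpM2l// sqr_ge0.
under [X in int _ _ X <= _]eq_fun do rewrite exprMn.
by rewrite intZ// ler_wpM2l// sqr_ge0.
Qed.

Variables (U : set_system nat).
Hypothesis Ultra : UltraFilter U.

Lemma D2B xi eta i : X b xi -> X b eta ->
  aeq 0 l (D2 b i (st_u (xi - eta))) (fun x => D2 b i (st_u xi) x - D2 b i (st_u eta) x).
Proof.
move=> Xx Xe; rewrite X_opp_lin; apply: ae_map (D2_lin (-1) i Xe Xx) => x h xl.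
by rewrite (h xl) mulN1r addrC.
Qed.

Lemma compact_comp (z : nat -> state R) C i e : (forall n, domA b (z n)) ->
  (forall n, ipX b (z n) (z n) <= C /\ ipX b (B (z n)) (B (z n)) <= C) -> 0 < e ->
  exists2 A, U A & forall m n, A m -> A n -> ipc b i (z m - z n) (z m - z n) <= e.
Proof.
move=> Dz zC e0; have PU : ProperFilter U by exact: ultra_proper.
have l_ge0 := ltW (l_gt0 b); have r0 := rho_gt0 b; have E0 := EI_gt0 b.
have k0 := kappa_gt0 b; have m0 := mass_gt0 b.
have l00 := l0_gt0 b; have l0l := l0_lt b; have l0' := ltW l00; have ll' := ltW l0l.
have Xz n : X b (z n) by case: (Dz n).
have XBz n := opAt_X alpha0 alpha psi_shape (Dz n).
have [K4 HK4] := fourth_bound i C.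
have ch n : exists GH : (nat -> R -> R) * (nat -> R -> R),
    spans b (D2 b i (st_u (z n))) (co i (fourth b (st_u (z n)))) GH.1 GH.2.
  by have [G [H [? _]]] := dom_spans i (Dz n); exists (G, H).
have [GH GHP] := choice ch.
have le1 n y : y <= ipc b i (z n) (z n) -> y <= C.
  by move=> h; apply: le_trans h _; apply: le_trans (ipc_le_ipX b i _) _; case: (zC n).
have le2 n y : y <= ipc b i (B (z n)) (B (z n)) -> y <= C.
  by move=> h; apply: le_trans h _; apply: le_trans (ipc_le_ipX b i _) _; case: (zC n).
pose M := `|C / EI b| + `|C / rho b| + `|K4|.
have M1 y : y <= C / EI b -> y <= M.
  by move=> h; apply: le_trans h _; apply: le_trans (ler_norm _) _; rewrite /M -addrA lerDl addr_ge0.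
have M2 y : y <= C / rho b -> y <= M.
  by move=> h; apply: le_trans h _; apply: le_trans (ler_norm _) _;
    rewrite /M addrAC lerDr addr_ge0.
have M3 y : y <= K4 -> y <= M.
  by move=> h; apply: le_trans h _; apply: le_trans (ler_norm _) _; rewrite /M lerDr addr_ge0.
have wM n : int 0 l (fun x => D2 b i (st_u (z n)) x ^+ 2) <= M.
  by apply: M1; apply: scaled_bound => //; apply: (le1 n); case: (ipc_parts b i (z n)).
have fM n : int 0 l (fun x => co i (fourth b (st_u (z n))) x ^+ 2) <= M.
  by apply: M3; apply: HK4 => //; case: (zC n).
have vM n : int 0 l (fun x => co i (st_v (z n)) x ^+ 2) <= M.
  by apply: M2; apply: scaled_bound => //; apply: (le1 n); case: (ipc_parts b i (z n)).
have v2M n : int 0 l (fun x => D2 b i (st_v (z n)) x ^+ 2) <= M.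
  by apply: M1; apply: scaled_bound => //; apply: (le2 n); case: (ipc_parts b i (B (z n))).
have pM n : `|coc i (st_p (z n))| <= 1 + C / kappa b.
  by apply: sq_bound; apply: scaled_bound => //; apply: (le1 n); case: (ipc_parts b i (z n)).
have qM n : `|coc i (st_q (z n))| <= 1 + C / mass b.
  by apply: sq_bound; apply: scaled_bound => //; apply: (le1 n); case: (ipc_parts b i (z n)).
have tr c d f g : 0 <= c -> c <= d -> d <= l -> sqint 0 l f -> sqint c d g -> aeq c d f g ->
    int 0 l (fun x => f x ^+ 2) <= M -> int c d (fun x => g x ^+ 2) <= M.
  move=> c0 cd dl sf sg fg; apply: le_trans.
  have [_ f2] := sqint_sub c0 dl sf; have [_ g2] := sg.
  rewrite -(@aeq_int _ c d (fun x => f x ^+ 2))//; first exact: int_sq_sub.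
  by apply: ae_map fg => x E xl; rewrite E.
have sw n := X_D2 i (Xz n); have sf n := fourth_sqint i (Dz n).
have [KG KG0 HG] := prim2_lip M l00.
have [KH KH0 HH] := prim2_lip M l0l.
have [KV KV0 HV] := prim2_lip M (l_gt0 b).
have lG n : lip 0 l0 KG ((GH n).1 2%N).
  have [pG pH [w1 w2] [f1 f2] _] := GHP n.
  apply: (HG _ _ _ (pG 2%N isT) (pG 3%N isT)).
    by apply: tr w1 (wM n) => //; exact: prim_sqint (pG 2%N isT).
  by apply: tr f1 (fM n) => //; case: (pG 3%N isT).
have lH n : lip l0 l KH ((GH n).2 2%N).
  have [pG pH [w1 w2] [f1 f2] _] := GHP n.
  apply: (HH _ _ _ (pH 2%N isT) (pH 3%N isT)).
    by apply: tr w2 (wM n) => //; exact: prim_sqint (pH 2%N isT).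
  by apply: tr f2 (fM n) => //; case: (pH 3%N isT).
have lV n : lip 0 l KV (co i (st_v (z n))).
  have [_ _ _ _ [Hv _ _]] := Dz n; have [v1 [pv pv1 _ _]] := D2P i Hv.
  exact: (HV _ _ _ pv pv1).
(* the squared energy norm of a state all of whose components are at most 1 *)
pose N := EI b * l0 + EI b * (l - l0) + rho b * l + kappa b + mass b.
have N0 : 0 < N.
  have h1 := mulr_gt0 E0 l00; have h2 : 0 <= EI b * (l - l0) by rewrite mulr_ge0 ?subr_ge0 ?(ltW E0).
  have h3 := mulr_gt0 r0 (l_gt0 b); rewrite /N; lra.
pose d := Num.min 1 (e / N).
have d0 : 0 < d by rewrite lt_min ltr01 divr_gt0.
have dN : d ^+ 2 * N <= e.
  have h1 : d <= 1 by rewrite ge_min lexx.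
  have h2 : d <= e / N by rewrite ge_min lexx orbT.
  by rewrite -ler_pdivlMr// expr2; apply: le_trans h2; rewrite ger_pMl.
have [A1 UA1 HA1] := ultra_uniform Ultra l00 KG0 d0 lG.
have [A2 UA2 HA2] := ultra_uniform Ultra l0l KH0 d0 lH.
have [A3 UA3 HA3] := ultra_uniform Ultra (l_gt0 b) KV0 d0 lV.
have [A4 UA4 HA4] := ultra_cauchy Ultra d0 pM.
have [A5 UA5 HA5] := ultra_cauchy Ultra d0 qM.
exists (A1 `&` A2 `&` A3 `&` A4 `&` A5); first by do !apply: filterI.
move=> m n [[[[m1 m2] m3] m4] m5] [[[[n1 n2] n3] n4] n5].
apply: le_trans dN.
have [pGm pHm [wm1 wm2] _ _] := GHP m; have [pGn pHn [wn1 wn2] _ _] := GHP n.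
have XD := XB (Xz m) (Xz n).
have sD := X_D2 i XD; have [_ sD2] := sD.
have piece c a f g f' g' : 0 <= c -> c < a -> a <= l -> prim c a f f' -> prim c a g g' ->
    aeq c a (D2 b i (st_u (z m))) f -> aeq c a (D2 b i (st_u (z n))) g ->
    (forall x, c <= x -> x <= a -> `|f x - g x| <= d) ->
    int c a (fun x => D2 b i (st_u (z m - z n)) x ^+ 2) <= d ^+ 2 * (a - c).
  move=> c0 ca al pf pg fE gE fg; have sfg := sqintB (prim_sqint (ltW ca) pf) (prim_sqint (ltW ca) pg).
  have [_ fg2] := sfg.
  rewrite (@aeq_int _ c a _ (fun x => (f x - g x) ^+ 2))//; first last.
  - have := aeq_sub c0 al (D2B i (Xz m) (Xz n)) => hD.
    by apply: ae_map (ae_and hD (ae_and fE gE)) => x [E1 [E2 E3]] xl; rewrite E1// E2// E3.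
  - by have [] := sqint_sub c0 al sD.
  apply: int_sq_bound => //; first exact: ltW.
  by move=> x; rewrite in_itv/= => /andP[/ltW h1 /ltW h2]; exact: fg.
have I1 := piece _ _ _ _ _ _ (lexx 0) l00 ll' (pGm 2%N isT) (pGn 2%N isT) wm1 wn1 (HA1 _ _ m1 n1).
have I2 := piece _ _ _ _ _ _ l0' l0l (lexx l) (pHm 2%N isT) (pHn 2%N isT) wm2 wn2 (HA2 _ _ m2 n2).
have I3 : int 0 l (fun x => co i (st_v (z m - z n)) x ^+ 2) <= d ^+ 2 * (l - 0).
  apply: int_sq_bound => //; first exact: X_v.
  move=> x; rewrite in_itv/= => /andP[/ltW h1 /ltW h2].
  by rewrite /co stE cocB; exact: HA3.
have sqb (x y : R) : `|x - y| <= d -> (x - y) ^+ 2 <= d ^+ 2.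
  by move=> h; rewrite -real_normK ?num_real// lerXn2r ?nnegrE// ltW.
have I4 := sqb _ _ (HA4 _ _ m4 n4); have I5 := sqb _ _ (HA5 _ _ m5 n5).
have I12 : int 0 l (fun x => D2 b i (st_u (z m - z n)) x ^+ 2) <= d ^+ 2 * (l0 - 0) + d ^+ 2 * (l - l0).
  by rewrite (int_split l0' ll' sD2) lerD.
rewrite /ipc !stE !cocB.
have -> : int 0 l (fun x => D2 b i (st_u (z m - z n)) x * D2 b i (st_u (z m - z n)) x) =
    int 0 l (fun x => D2 b i (st_u (z m - z n)) x ^+ 2) by [].
have -> : int 0 l (fun x => co i (st_v (z m - z n)) x * co i (st_v (z m - z n)) x) =
    int 0 l (fun x => co i (st_v (z m - z n)) x ^+ 2) by [].
have J1 := ler_wpM2l (ltW E0) I12; have J3 := ler_wpM2l (ltW r0) I3.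
have J4 := ler_wpM2l (ltW k0) I4; have J5 := ler_wpM2l (ltW m0) I5.
rewrite subr0 in J1 J3; rewrite -!expr2.
apply: le_trans (lerD (lerD (lerD J1 J3) J4) J5) _.
by rewrite le_eqVlt; apply/orP; left; apply/eqP; rewrite /N; ring.
Qed.

(** A bound on the graph norm bounds the second and fourth derivatives of the
    deflection on each span, and the velocity with its second derivative. So
    second derivatives and velocities are bounded and equi-Lipschitz, hence
    uniformly Cauchy along the ultrafilter. *)
Theorem graph_compact (z : nat -> state R) C e : (forall n, domA b (z n)) ->
  (forall n, ipX b (z n) (z n) <= C /\ ipX b (B (z n)) (B (z n)) <= C) -> 0 < e ->
  exists2 A, U A & forall m n, A m -> A n -> ipX b (z m - z n) (z m - z n) <= e.
Proof.
move=> Dz zC e0; have PU : ProperFilter U by exact: ultra_proper.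
have e2 : 0 < e / 2 by lra.
have [A1 U1 H1] := compact_comp false Dz zC e2.
have [A2 U2 H2] := compact_comp true Dz zC e2.
exists (A1 `&` A2); first exact: filterI.
move=> m n [m1 m2] [n1 n2]; have h1 := H1 _ _ m1 n1; have h2 := H2 _ _ m2 n2.
by rewrite /ipX; lra.
Qed.

End Compactness.

(** * Real subspaces of the state space *)

Section RealSubspace.
Context {R : realType} {V : lmodType R[i]}.
Local Open Scope complex_scope.

Definition real_closed (P : set V) :=
  P 0 /\ forall (r : R) x y, P x -> P y -> P (r%:C *: x + y).

(** A record instead of a quotient: the abstract theory already works up to null
    vectors. The closure proof is a parameter so that the module structure can be
    inferred from the type. *)
Record subsp (P : set V) (cl : real_closed P) := Subsp { svec : V; svecP : P svec }.

Variables (P : set V) (cl : real_closed P).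
Local Notation S := (subsp cl).

HB.instance Definition _ := gen_eqMixin S.
HB.instance Definition _ := gen_choiceMixin S.

Lemma svec_inj (x y : S) : svec x = svec y -> x = y.
Proof.
by case: x y => [x Px] [y Py] /= xy; move: Px Py; rewrite xy => Px Py; rewrite (Prop_irrelevance Px Py).
Qed.

Let real1 : 1%:C = 1 :> R[i]. Proof. by []. Qed.

Fact closed_add (x y : S) : P (svec x + svec y).
Proof. by rewrite -[svec x]scale1r -real1; apply: cl.2; exact: svecP. Qed.
Fact closed_scale (r : R) (x : S) : P (r%:C *: svec x).
Proof. by rewrite -[_ *: _]addr0; apply: cl.2; [exact: svecP|exact: cl.1]. Qed.
Fact closed_opp (x : S) : P (- svec x).
Proof. by rewrite -scaleN1r -(rmorphN1 (real_complex R)); exact: closed_scale. Qed.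

Let add x y : S := Subsp cl (closed_add x y).
Let opp x : S := Subsp cl (closed_opp x).
Let zero : S := Subsp cl cl.1.
Let scale r x : S := Subsp cl (closed_scale r x).

Fact addA : associative add.
Proof. by move=> x y z; apply: svec_inj; exact: addrA. Qed.
Fact addC : commutative add.
Proof. by move=> x y; apply: svec_inj; exact: addrC. Qed.
Fact add0 : left_id zero add.
Proof. by move=> x; apply: svec_inj; exact: add0r. Qed.
Fact addN : left_inverse zero opp add.
Proof. by move=> x; apply: svec_inj; exact: addNr. Qed.
HB.instance Definition _ := GRing.isZmodule.Build S addA addC add0 addN.

Fact scaleA r r' x : scale r (scale r' x) = scale (r * r') x.
Proof. by apply: svec_inj => /=; rewrite scalerA -rmorphM. Qed.
Fact scale1 : left_id 1 scale.
Proof. by move=> x; apply: svec_inj; exact: scale1r. Qed.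
Fact scaleDr : right_distributive scale +%R.
Proof. by move=> r x y; apply: svec_inj; exact: scalerDr. Qed.
Fact scaleDl x : {morph scale^~ x : r r' / r + r'}.
Proof. by move=> r r'; apply: svec_inj => /=; rewrite rmorphD scalerDl. Qed.
HB.instance Definition _ := GRing.Zmodule_isLmodule.Build R S scaleA scale1 scaleDr scaleDl.

Lemma svecD (x y : S) : svec (x + y) = svec x + svec y. Proof. by []. Qed.
Lemma svecN (x : S) : svec (- x) = - svec x. Proof. by []. Qed.
Lemma svecZ r (x : S) : svec (r *: x) = r%:C *: svec x. Proof. by []. Qed.
Lemma svecB (x y : S) : svec (x - y) = svec x - svec y. Proof. by []. Qed.
End RealSubspace.

Section XSpace.
Context {R : realType}.
Local Open Scope complex_scope.
Variable b : beam R.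
Implicit Types (xi eta zeta : state R).

Section Sub.
Variables (Y : set (state R)) (YX : Y `<=` X b) (cl : real_closed Y).
Hypothesis Yi : forall xi, Y xi -> Y ('i *: xi).
Local Notation S := (subsp cl).
Definition ipS (x y : S) := ipX b (svec x) (svec y).

Lemma ipS_inner : semi_inner ipS.
Proof.
split; [by move=> x y; exact: ipXC| |by move=> x; exact: ipX_ge0].
by move=> r x y z; apply: ipX_lin; apply: YX; exact: svecP.
Qed.

Lemma nmSE (x : S) : nm ipS x = normX b (svec x).
Proof. by rewrite normXE//; apply: YX; exact: svecP. Qed.

Definition mulI (x : S) : S := Subsp cl (Yi (svecP x)).

Lemma svec_mulI x : svec (mulI x) = 'i *: svec x. Proof. by []. Qed.

Lemma mulI_lin r x y : mulI (r *: x + y) = r *: mulI x + mulI y.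
Proof.
apply: svec_inj; rewrite svec_mulI 2!svecD 2!svecZ 2!svec_mulI scalerDr !scalerA.
by rewrite mulrC.
Qed.

Lemma mulIK x : mulI (mulI x) = - x.
Proof. by apply: svec_inj; rewrite svecN 2!svec_mulI scalerA -expr2 sqr_i scaleN1r. Qed.

Lemma ip_mulI2 x : ipS (mulI x) (mulI x) = ipS x x.
Proof. by apply: ipX_i; apply: YX; [|apply: Yi]; exact: svecP. Qed.

Lemma nm_mulI x : nm ipS (mulI x) = nm ipS x.
Proof. by rewrite /nm ip_mulI2. Qed.

(** An isometry of square -1 is skew for the real inner product. *)
Lemma ip_mulI x : ipS x (mulI x) = 0.
Proof.
have h := ip_mulI2 (1 *: x + mulI x).
have hx := ip_mulI2 x.
have c : ipS (mulI x) x = ipS x (mulI x) := ipXC b _ _.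
move: h; rewrite mulI_lin mulIK !scale1r.
rewrite (ipBl ipS_inner) !(ipBr ipS_inner).
rewrite (ipDl ipS_inner) !(ipDr ipS_inner).
rewrite c hx.
move: (ipS x x) (ipS x (mulI x)) => p q {hx c}.
by move=> h; lra.
Qed.
End Sub.

Lemma X_real_closed : real_closed (X b).
Proof. by split; [exact: X0|move=> r x y; exact: X_lin]. Qed.

Lemma X_i xi : X b xi -> X b ('i *: xi).
Proof.
move=> /XP Hx; apply/XP => i.
have E (u : R -> R[i]) : co i ('i *: u) = if i then co false u else fun x => (-1) * co true u x + 0.
  by apply/funext => x; rewrite [LHS]coc_i; case: i => //; rewrite mulN1r addr0.
have [[w0 H0] s0] := Hx false; have [[w1 H1] s1] := Hx true.
rewrite -[st_u ('i *: xi)]/('i *: st_u xi) -[st_v ('i *: xi)]/('i *: st_v xi) !E.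
case: i {E}; first by split; [exists w0|].
have H00 : H2c b (fun=> 0) (fun=> 0).
  by exists (fun=> 0); split=> //; exact: prim_cst.
split; first by exists (fun x => -1 * w1 x + 0); exact: H2c_lin.
by apply: sqintD; [exact: sqintZ|exact: sqint_cst].
Qed.

End XSpace.

(** * Decay of the energy *)

Lemma right_limit0P (R : realType) (f : R -> R) : f h @[h --> 0^'+] --> 0 <->
  forall e, 0 < e -> exists2 d, 0 < d & forall h, 0 < h -> h <= d -> `|f h| <= e.
Proof.
split=> [/cvgrPdist_le fc e e0|H].
  have [d /= d0 Hd] := fc e e0; exists (d / 2); first by rewrite divr_gt0.
  move=> h h0 hd; have := Hd h; rewrite /= !sub0r !normrN; apply=> //.
  by rewrite gtr0_norm//; lra.
apply/cvgrPdist_le => e e0; have [d d0 Hd] := H e e0.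
exists d => //= h; rewrite /= sub0r normrN => hd h0.
by rewrite sub0r normrN; apply: Hd => //; rewrite ltW// (le_lt_trans _ hd)// ler_norm.
Qed.

Section Stability.
Context {R : realType}.
Local Open Scope complex_scope.
Variable b : beam R.
Implicit Types (xi eta zeta : state R).

Section Decay.
Variables (k : nat) (alpha0 : R) (alpha : 'I_k -> R) (psi : 'I_k -> R -> R).
Hypothesis alpha0_gt0 : 0 < alpha0.
Hypothesis alpha_gt0 : forall j, 0 < alpha j.
Hypothesis psi_shape : forall j, shape_function b (psi j).
Local Notation B := (opAt b alpha0 alpha psi).
Variables (Y : set (state R)) (T : R -> state R -> state R).
Hypothesis closedY : closed_subspace b Y.
Hypothesis semigroupT : C0_semigroup b Y T.
Hypothesis generatorT : generated_by b Y T (domA b) B.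
Hypothesis observable : forall xi, eigenvector b (domA b) (opA b) xi ->
  st_v xi (spot b) != 0 \/ exists j : 'I_k, moment b (psi j) (st_v xi) != 0.

Let YX : Y `<=` X b. Proof. by case: closedY. Qed.
Let Y0 : Y 0. Proof. by case: closedY. Qed.
Let Yc (c : R[i]) xi eta : Y xi -> Y eta -> Y (c *: xi + eta).
Proof. by case: closedY => _ _ H _; exact: H. Qed.
Lemma Y_real_closed : real_closed Y. Proof. by split=> // r x y; exact: Yc. Qed.
Lemma Y_i xi : Y xi -> Y ('i *: xi).
Proof. by move=> Yx; rewrite -[_ *: _]addr0; exact: Yc. Qed.

Local Notation E := (subsp (X_real_closed b)).
Local Notation W := (subsp Y_real_closed).
Local Notation ip := (@ipS R b Y Y_real_closed).
Local Notation ipE' := (@ipS R b (X b) (X_real_closed b)).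
Let ipH : semi_inner ip := ipS_inner YX Y_real_closed.
Let ipEH : semi_inner ipE' := ipS_inner (fun _ h => h) (X_real_closed b).
Let nmWE := @nmSE R b Y YX Y_real_closed.
Let nmEE := @nmSE R b (X b) (fun _ h => h) (X_real_closed b).
Let toE xi (Xx : X b xi) : E := Subsp (X_real_closed b) Xx.
Let emb (w : W) : E := toE (YX (svecP w)).
Let iW := @mulI R Y Y_real_closed Y_i.
Let iE := @mulI R (X b) (X_real_closed b) (@X_i R b).

(** Y is invariant for t >= 0 only, whence the case analysis and the default 0. *)
Definition TW t (w : W) : W :=
  match pselect (Y (T t (svec w))) with
  | left h => Subsp Y_real_closed h | right _ => 0 end.

Lemma TWE t w : 0 <= t -> svec (TW t w) = T t (svec w).
Proof.
move=> t0; rewrite /TW; case: pselect => // n; case: n.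
by case: semigroupT => H _ _ _ _; apply: H => //; exact: svecP.
Qed.

Lemma YW_complete (s : nat -> W) : cauchy_nm ip s -> exists x, limit_nm ip s x.
Proof.
move=> cs; have sq (e : R) : 0 < e -> 0 < Num.sqrt e by rewrite sqrtr_gt0.
have nmle (w : W) e : 0 < e -> (nm ip w <= Num.sqrt e) = (ip w w <= e).
  by move=> e0; rewrite /nm ler_sqrt// ltW.
have [|e e0|xi Xx lx] := @X_complete _ b (fun n => svec (s n)).
- by move=> n; apply: YX; exact: svecP.
- have [N HN] := cs _ (sq _ e0); exists N => m n Nm Nn.
  have h := HN _ _ Nm Nn; rewrite (nmle _ _ e0) /ipS svecB in h; exact: h.
have Xs n : X b (svec (s n) - xi) by apply: XB => //; apply: YX; exact: svecP.
have nx e : 0 < e -> exists N, forall n, (N <= n)%N -> normX b (svec (s n) - xi) <= e.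
  move=> e0; have [N HN] := lx _ (exprn_gt0 2 e0); exists N => n Nn.
  by rewrite normXE// -(ler_pXn2r (ltn0Sn 1)) ?nnegrE ?sqrtr_ge0 ?(ltW e0)//
    sqr_sqrtr ?ipX_ge0// HN.
have Yx : Y xi.
  case: closedY => _ _ _ /(_ (fun n => svec (s n)) xi); apply=> //.
    by move=> n; exact: svecP.
  apply/cvgrPdist_le => e e0; have [N HN] := nx e e0; exists N => // n Nn /=.
  by rewrite sub0r normrN ger0_norm ?sqrtr_ge0//; exact: HN.
exists (Subsp Y_real_closed Yx) => e e0; have [N HN] := nx e e0; exists N => n Nn.
by rewrite nmWE svecB; exact: HN.
Qed.

Lemma TW_lin t r x y : 0 <= t -> nm ip (TW t (r *: x + y) - (r *: TW t x + TW t y)) = 0.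
Proof.
move=> t0; rewrite nmWE svecB svecD svecZ !TWE//.
by case: semigroupT => _ /(_ t t0)[H _] _ _ _; apply: H; exact: svecP.
Qed.

Lemma TW_bnd t : 0 <= t -> exists K, forall x, nm ip (TW t x) <= K * nm ip x.
Proof.
move=> t0; case: semigroupT => _ /(_ t t0)[_ [K HK]] _ _ _; exists K => x.
by rewrite !nmWE TWE//; apply: HK; exact: svecP.
Qed.

Lemma TW_0 x : nm ip (TW 0 x - x) = 0.
Proof.
rewrite nmWE svecB TWE//; case: semigroupT => _ _ H _ _.
by apply: H; exact: svecP.
Qed.

Lemma TW_D s t x : 0 <= s -> 0 <= t -> nm ip (TW (s + t) x - TW s (TW t x)) = 0.
Proof.
move=> s0 t0; rewrite nmWE svecB !TWE// ?addr_ge0//.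
by case: semigroupT => _ _ _ H _; apply: H => //; exact: svecP.
Qed.

Lemma TW_cont x e : 0 < e ->
  exists2 d, 0 < d & forall h, 0 <= h -> h <= d -> nm ip (TW h x - x) <= e.
Proof.
move=> e0; case: semigroupT => _ _ _ _ /(_ (svec x) (svecP x))/right_limit0P /(_ e e0)[d d0 H].
exists d => // h h0 hd; have [->|hn] := eqVneq h 0; first by rewrite TW_0 ltW.
rewrite nmWE svecB TWE//; apply: le_trans (ler_norm _) _.
by apply: H => //; rewrite lt_neqAle eq_sym hn.
Qed.

Lemma TW_i t x : 0 <= t -> nm ip (TW t (iW x) - iW (TW t x)) = 0.
Proof.
move=> t0; have [K HK] := TW_bnd t0.
have T00 : nm ip (TW t 0) = 0.
  by apply/le_anti; rewrite nm_ge0 andbT; have := HK 0; rewrite (nm0 ipH) mulr0.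
have h : nm ip (TW t (iW x + 0) - (iW (TW t x) + TW t 0)) = 0.
  rewrite nmWE svecB svecD !TWE// svecD /iW !svec_mulI !TWE//.
  by case: semigroupT => _ /(_ t t0)[H _] _ _ _; apply: H; exact: svecP.
rewrite addr0 in h; apply/le_anti; rewrite nm_ge0 andbT.
have := nm_tri ipH (TW t (iW x)) (iW (TW t x) + TW t 0) (iW (TW t x)).
by rewrite h add0r addrAC subrr add0r T00.
Qed.

Local Notation genW := (gen ip TW).

(** The operators of the semigroup are complex linear up to null vectors. *)
Lemma gen_i x y : genW x y -> genW (iW x) (iW y).
Proof.
move=> g e e0; have [d d0 H] := g e e0; exists d => // h h0 hd.
have iB u v r : iW (u - v - r *: y) = iW u - iW v - r *: iW y.
  apply: svec_inj; rewrite /iW svec_mulI !svecB !svecZ !svec_mulI !scalerBr !scalerA.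
  by rewrite [_ * 'i]mulrC.
have := H h h0 hd; rewrite -(@nm_mulI _ _ _ YX _ Y_i) -/iW iB; apply: le_trans.
have := nm_tri ipH (TW h (iW x) - iW x - h *: iW y) (iW (TW h x) - iW x - h *: iW y) 0.
rewrite !subr0 => /le_trans; apply.
rewrite -[X in _ <= X]add0r lerD2r -(TW_i x (ltW h0)).
have cancel (u v w p : W) : (u - w - p) - (v - w - p) = u - v.
  by rewrite -(addrA u) -(addrA v) -opprD opprB subrKA.
by rewrite cancel.
Qed.

Lemma gen_limit x y : genW x y ->
  normX b ((h^-1)%:C *: (T h (svec x) - svec x) - svec y) @[h --> 0^'+] --> (0 : R).
Proof.
move=> g; apply/right_limit0P => e e0; have [d d0 H] := g e e0; exists d => // h h0 hd.
have -> : normX b ((h^-1)%:C *: (T h (svec x) - svec x) - svec y) =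
    nm ip (h^-1 *: (TW h x - x - h *: y)).
  have -> : h^-1 *: (TW h x - x - h *: y) = h^-1 *: (TW h x - x) - y.
    by rewrite scalerBr scalerA mulVf ?gt_eqF// scale1r.
  by rewrite nmWE svecB svecZ svecB TWE// ltW.
rewrite (nmZ ipH) ger0_norm ?mulr_ge0// ?nm_ge0// ger0_norm ?invr_ge0 ?(ltW h0)//.
by rewrite ler_pdivrMl//; exact: H.
Qed.

Lemma domA_X zeta : domA b zeta -> X b zeta. Proof. by case. Qed.

Lemma gen_dom x y : genW x y -> exists2 zeta, domA b zeta &
  eqX b (svec x) zeta /\ eqX b (svec y) (B zeta).
Proof.
move=> g; have [H _] := generatorT (YX (svecP x)) (YX (svecP y)).
have [|zeta [Dz h1 h2]] := H; first by split; [exact: svecP|exact: gen_limit].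
by exists zeta.
Qed.

Lemma eqX_E (x : W) xi (Xx : X b xi) : eqX b (svec x) xi -> nm ipE' (emb x - toE Xx) = 0.
Proof. by move=> h; rewrite nmEE svecB. Qed.

Lemma emb_ip x y : ip x y = ipE' (emb x) (emb y). Proof. by []. Qed.

Lemma emb_nm x : nm ip x = nm ipE' (emb x). Proof. by []. Qed.

Lemma embB x y : emb (x - y) = emb x - emb y.
Proof. by apply: svec_inj; rewrite svecB. Qed.

Lemma eqX_ip (x y : W) xi eta : X b xi -> X b eta -> eqX b (svec x) xi -> eqX b (svec y) eta ->
  ip x y = ipX b xi eta.
Proof.
move=> Xx Xe /(eqX_E Xx) h1 /(eqX_E Xe) h2; rewrite emb_ip (ip_eq ipEH _ h1).
by rewrite (ipC ipEH) (ip_eq ipEH _ h2) (ipC ipEH).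
Qed.

Let loss i zeta := alpha0 * coc i (st_q zeta) ^+ 2 + \sum_(j < k) alpha j * mom b psi i j zeta ^+ 2.

Let dissipE zeta : domA b zeta -> ipX b zeta (B zeta) = - loss false zeta - loss true zeta.
Proof. by move=> Dz; rewrite dissipation// /loss; ring. Qed.

Let terms_ge0 i zeta j : 0 <= alpha j * mom b psi i j zeta ^+ 2.
Proof. by rewrite mulr_ge0 ?sqr_ge0// ltW. Qed.

Let sum_terms_ge0 i zeta : 0 <= \sum_(j < k) alpha j * mom b psi i j zeta ^+ 2.
Proof. by apply: sumr_ge0 => j _. Qed.

Let q_ge0 i zeta : 0 <= alpha0 * coc i (st_q zeta) ^+ 2.
Proof. by rewrite mulr_ge0 ?sqr_ge0// ltW. Qed.

Let loss_ge0 i zeta : 0 <= loss i zeta. Proof. by rewrite addr_ge0. Qed.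

Lemma dissipative_W x y : genW x y -> ip x y <= 0.
Proof.
move=> /gen_dom[zeta Dz [h1 h2]].
rewrite (eqX_ip (domA_X Dz) (opAt_X alpha0 alpha psi_shape Dz) h1 h2) dissipE//.
by have := loss_ge0 false zeta; have := loss_ge0 true zeta; lra.
Qed.

Lemma lossless zeta : domA b zeta -> ipX b zeta (B zeta) = 0 ->
  st_q zeta = 0 /\ forall j, moment b (psi j) (st_v zeta) = 0.
Proof.
move=> Dz; rewrite dissipE// => h.
have L i : loss i zeta = 0.
  have h0 := loss_ge0 false zeta; have h1 := loss_ge0 true zeta.
  by case: i; lra.
have Q i : alpha0 * coc i (st_q zeta) ^+ 2 = 0 /\
    \sum_(j < k) alpha j * mom b psi i j zeta ^+ 2 = 0.
  by have := L i; have := q_ge0 i zeta; have := sum_terms_ge0 i zeta; rewrite /loss => *; lra.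
split.
  apply: coc_eq => i; rewrite coc0; have [/eqP + _] := Q i.
  by rewrite mulf_eq0 gt_eqF//= sqrf_eq0 => /eqP.
move=> j; apply: coc_eq => i; rewrite coc0; have [_ Hs] := Q i.
have /(_ j isT)/eqP := psumr_eq0P (fun j _ => terms_ge0 i zeta j) Hs.
by rewrite mulf_eq0 gt_eqF//= sqrf_eq0 => /eqP.
Qed.

Lemma opAt_opA zeta : st_q zeta = 0 -> (forall j, moment b (psi j) (st_v zeta) = 0) ->
  B zeta = opA b zeta.
Proof.
move=> q0 m0; rewrite /opAt /opA q0 mulr0 addr0; congr (_, _, _, _).
by apply/funext => x; rewrite big1 ?mulr0 ?addr0// => j _; rewrite m0 !mulr0.
Qed.

(** An eigenvector for the eigenvalue i mu loses no energy, so the feedback vanishes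
    on it and it is an eigenvector of the uncontrolled operator. Its velocity at
    the attachment point, equal to q, and its moments vanish, against the
    observability assumption. *)
Lemma eig_null mu z : genW z (mu *: iW z) -> nm ip z = 0.
Proof.
move=> /gen_dom[zeta Dz [h1 h2]].
have Xz := domA_X Dz; have Xb := opAt_X alpha0 alpha psi_shape Dz.
have [q0 m0] : st_q zeta = 0 /\ forall j, moment b (psi j) (st_v zeta) = 0.
  apply: lossless => //; rewrite -(eqX_ip Xz Xb h1 h2) (ipZr ipH).
  by rewrite (@ip_mulI _ _ _ YX _ Y_i) mulr0.
have e1 := eqX_E Xz h1; have e2 := eqX_E Xb h2.
apply/eqP/negPn/negP => /eqP nz.
have [|v0|[j mj]] := observable (xi := zeta); last by rewrite m0 eqxx in mj.
  split=> //.
    move=> z0; apply: nz; rewrite emb_nm (nm_eq ipEH e1) nmEE.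
    by move: z0; rewrite /eqX subr0.
  exists (mu%:C * 'i); rewrite -opAt_opA// -scalerA.
  rewrite /eqX -[zeta in 'i *: zeta]/(svec (toE Xz)) -[B zeta]/(svec (toE Xb)).
  rewrite -(@svec_mulI _ _ _ (@X_i R b)) -svecZ -svecB -nmEE.
  have E : emb (mu *: iW z) = mu *: iE (emb z).
    by apply: svec_inj; rewrite svecZ /iE svec_mulI.
  apply/le_anti; rewrite nm_ge0 andbT.
  apply: le_trans (nm_tri ipEH _ (emb (mu *: iW z)) _) _.
  rewrite (nmB ipEH) e2 add0r E.
  have -> : mu *: iE (emb z) - mu *: iE (toE Xz) = mu *: iE (emb z - toE Xz).
    apply: svec_inj; rewrite svecB !svecZ /iE !svec_mulI svecB.
    by rewrite !scalerBr.
  by rewrite (nmZ ipEH) (@nm_mulI _ _ _ (fun _ h => h) _ (@X_i R b)) e1 mulr0.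
by case: Dz => _ _ _ _ [_ _ qE]; rewrite -qE q0 eqxx in v0.
Qed.

Lemma no_kernel_W x : genW x 0 -> nm ip x = 0.
Proof. by move=> g; apply: (@eig_null 0); rewrite scale0r. Qed.

(** The vectors G x + i mu x with mu = m and mu = - m are eigenvectors; their
    difference is 2 i m x. *)
Lemma no_oscillation_W x y m : 0 < m -> genW x y -> genW y (- m ^+ 2 *: x) -> nm ip x = 0.
Proof.
move=> m0 gx gy.
have osc mu : mu ^+ 2 = m ^+ 2 -> nm ip (mu *: iW x + y) = 0.
  move=> mm; apply: (@eig_null mu).
  have := gen_lin ipH TW_lin mu (gen_i gx) gy; congr (gen _ _ _ _).
  rewrite /iW mulI_lin mulIK scalerDr scalerN scalerN scalerA -expr2 mm addrC.
  by rewrite scaleNr.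
have h1 := osc m erefl; have h2 := osc (- m) (sqrrN m).
have E : (m *: iW x + y) - (- m *: iW x + y) = (2 * m) *: iW x.
  by rewrite opprD addrACA subrr addr0 scaleNr opprK -scalerDl; congr (_ *: _); ring.
have : nm ip ((2 * m) *: iW x) <= 0.
  rewrite -E; apply: le_trans (nmD ipH _ _) _.
  by rewrite h1 (nmN ipH) h2 addr0.
rewrite (nmZ ipH) (@nm_mulI _ _ _ YX _ Y_i) pmulr_rle0; last first.
  by rewrite normr_gt0 gt_eqF// mulr_gt0.
by move=> h; apply/le_anti; rewrite h nm_ge0.
Qed.

Lemma precompact_W (U : set_system nat) (Ultra : UltraFilter U) (x y : nat -> W) :
  (exists C, forall n, nm ip (x n) <= C /\ nm ip (y n) <= C) ->
  (forall n, genW (x n) (y n)) ->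
  forall e, 0 < e -> exists2 A, U A & forall m n, A m -> A n -> nm ip (x m - x n) <= e.
Proof.
move=> [C HC] g e e0.
have ch n : exists zeta, domA b zeta /\ (eqX b (svec (x n)) zeta /\ eqX b (svec (y n)) (B zeta)).
  by have [zeta Dz h] := gen_dom (g n); exists zeta.
have [z zP] := choice ch.
have Dz n : domA b (z n) by case: (zP n).
have Xz n := domA_X (Dz n); have Xb n := opAt_X alpha0 alpha psi_shape (Dz n).
have C0 : 0 <= C by have [h _] := HC 0%N; apply: le_trans h; exact: nm_ge0.
have sqC w : nm ip w <= C -> ip w w <= C ^+ 2.
  by move=> h; rewrite -(sqr_nm ipH) lerXn2r ?nnegrE ?nm_ge0.
have zC n : ipX b (z n) (z n) <= C ^+ 2 /\ ipX b (B (z n)) (B (z n)) <= C ^+ 2.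
  have [_ [h1 h2]] := zP n; have [c1 c2] := HC n.
  rewrite -(eqX_ip (Xz n) (Xz n) h1 h1) -(eqX_ip (Xb n) (Xb n) h2 h2).
  by split; exact: sqC.
have [A UA HA] := graph_compact psi_shape Ultra Dz zC (exprn_gt0 2 e0).
exists A => // m n Am An; have h := HA _ _ Am An.
have [_ [hm _]] := zP m; have [_ [hn _]] := zP n.
have em := eqX_E (Xz m) hm; have en := eqX_E (Xz n) hn.
rewrite emb_nm embB.
apply: le_trans (nm_tri ipEH _ (toE (Xz m)) _) _; rewrite em add0r.
apply: le_trans (nm_tri ipEH _ (toE (Xz n)) _) _; rewrite [X in _ + X](nmB ipEH) en addr0.
by rewrite nmEE svecB (normXE (XB (Xz m) (Xz n))) -(ler_pXn2r (ltn0Sn 1)) ?nnegrE ?sqrtr_ge0 ?(ltW e0)//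
  sqr_sqrtr ?ipX_ge0.
Qed.

Theorem beam_stability : strongly_asymptotically_stable b Y T.
Proof.
have [U [Ultra cofU]] := ultraFilterLemma eventually_filter.
have main w := strong_stability ipH YW_complete TW_lin TW_bnd TW_0 TW_D TW_cont
  dissipative_W Ultra cofU (precompact_W Ultra) no_kernel_W no_oscillation_W w.
have nE t xi (Yx : Y xi) : 0 <= t ->
    nm ip (TW t (Subsp Y_real_closed Yx)) = normX b (T t xi).
  by move=> t0; rewrite nmWE TWE.
have nE0 xi (Yx : Y xi) : nm ip (Subsp Y_real_closed Yx) = normX b xi by rewrite nmWE.
split.
  move=> eps eps0; exists eps => // xi t Yx xe t0; rewrite -(nE _ _ Yx t0).
  have [H _] := main (Subsp Y_real_closed Yx).
  by apply: le_lt_trans (H t t0) _; rewrite nE0.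
move=> xi Yx; have [_ H] := main (Subsp Y_real_closed Yx).
apply/cvgrPdist_le => e e0; have [t0 t00 Ht] := H e e0.
near=> t; have tt : t0 <= t by near: t; apply: nbhs_pinfty_ge; exact: num_real.
rewrite sub0r normrN ger0_norm ?sqrtr_ge0// -(nE _ _ Yx (le_trans t00 tt)).
exact: Ht.
Unshelve. all: by end_near. Qed.

End Decay.
End Stability.

Theorem theorem5p1 (R : realType) (b : beam R) (k : nat)
    (alpha0 : R) (alpha : 'I_k -> R) (psi : 'I_k -> R -> R)
    (alpha0_gt0 : 0 < alpha0)
    (alpha_gt0 : forall j, 0 < alpha j)
    (psi_shape : forall j, shape_function b (psi j))
    (Y : set (state R)) (T : R -> state R -> state R)
    (closedY : closed_subspace b Y)
    (semigroupT : C0_semigroup b Y T)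
    (generatorT : generated_by b Y T (domA b) (opAt b alpha0 alpha psi))
    (observable : forall xi, eigenvector b (domA b) (opA b) xi ->
       st_v xi (spot b) != 0 \/
       exists j : 'I_k, moment b (psi j) (st_v xi) != 0) :
  strongly_asymptotically_stable b Y T.
Proof.
exact: (beam_stability alpha0_gt0 alpha_gt0 psi_shape closedY semigroupT generatorT observable).
Qed.
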